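(* Assume (S0)–(S2) and (H0)–(H3). If the amplitude $\epsilon=|u_+-u_-|$ of the stationary radiative shock profile $(U,Q)$ is sufficiently small, then the profile is spectrally stable: for every $\lambda\in\mathbb C$ with $\Re\lambda\ge0$, $\lambda\ne0$, the eigenvalue problem \[ \lambda u+(A(U)u)_x+Lq_x=0,\qquad -q_{xx}+q+(B(U)u)_x=0 \] has no nontrivial solution $(u,q)$ decaying at $\pm\infty$ (in $L^2$, with $u\in H^1$); equivalently, the linearized operator $\mathcal L$ has no eigenvalue in $\{\Re\lambda\ge0\}\setminus\{0\}$.
   Context: System $u_t+f(u)_x+Lq_x=0$, $-q_{xx}+q+g(u)_x=0$ with $u\in\mathcal U\subseteq\mathbb R^n$, $q\in\mathbb R$, $L\in\mathbb R^{n\times1}$ constant; $A=Df\in\mathbb R^{n\times n}$, $B=Dg\in\mathbb R^{1\times n}$, eigenvalues $a_1\le\dots\le a_n$ of $A$ with right/left eigenvectors $r_j,l_j$. (S0) $f,g\in C^2$. (S1) For every $u$ there is a symmetric positive definite $A_0(u)$ with $A_0A$ symmetric and $A_0LB$ symmetric positive semidefinite of rank one; $a_p$ is simple. (S2) No eigenvector of $A(u)$ lies in $\ker(LB(u))$. $(U,Q)$ is a stationary profile: $f(U)_x+LQ_x=0$, $-Q_{xx}+Q+g(U)_x=0$, $U\to u_\pm$, $Q\to0$ as $x\to\pm\infty$, with (H0) $f(u_+)=f(u_-)$; (H1) $a_p(u_+)<0<a_{p+1}(u_+)$, $a_{p-1}(u_-)<0<a_p(u_-)$; (H2) $(\nabla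 a_p)^\top r_p\ne0$; (H3) $l_p(u_\pm)LB(u_\pm)r_p(u_\pm)>0$. $\mathcal K=(1-\partial_x^2)^{-1}$, $\mathcal Lu=-(A(U)u)_x+L\partial_x\mathcal K\partial_x(B(U)u)$. In the small-amplitude regime the profile satisfies: $u_\pm$ lie in a neighborhood of a state $u_*$ of radius $\epsilon$, $U_x=\mathcal O(\epsilon^2)e^{-\eta\epsilon|x|}(r_p(u_* )+\mathcal O(\epsilon))$, $U_{xx}=\mathcal O(\epsilon^3)e^{-\theta\epsilon|x|}$ for some $\eta,\theta>0$, and $a_p(U(x))$ is strictly decreasing with $(a_p)_x=\mathcal O(|U_x|)$. *)

(* Defs.v *)
From HB Require Import structures.
From mathcomp Require Import all_boot all_order all_algebra.
From mathcomp Require Import all_classical all_reals all_analysis.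
Set Implicit Arguments. Unset Strict Implicit. Unset Printing Implicit Defensive.
Import Order.TTheory GRing.Theory Num.Theory.
Import numFieldNormedType.Exports.
Local Open Scope classical_set_scope.
Local Open Scope ring_scope.

Section Defs.
Variables (R : realType) (n : nat).

Definition ebasis (j : 'I_n) : 'cV[R]_n := delta_mx j 0.

Definition C2on (V : normedModType R) (U : set 'cV[R]_n) (h : 'cV[R]_n -> V) :=
  forall u, U u ->
    {for u, continuous h} /\
    forall v w : 'cV[R]_n,
      derivable h u v /\ derivable ('D_v h) u w /\
      {for u, continuous ('D_v h)} /\ {for u, continuous ('D_w ('D_v h))}.

Definition jac (f : 'cV[R]_n -> 'cV[R]_n) (u : 'cV[R]_n) : 'M[R]_n :=
  \matrix_(i, j) ('D_(ebasis j) f u) i 0.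
Definition grad_row (g : 'cV[R]_n -> R) (u : 'cV[R]_n) : 'rV[R]_n :=
  \row_j ('D_(ebasis j) g u).

Definition spec_list (M : 'M[R]_n) (s : seq R) :=
  sorted <=%R s /\ char_poly M = \prod_(x <- s) ('X - x%:P).

Definition symmetric_mx (M : 'M[R]_n) := M^T = M.
Definition posdef_mx (M : 'M[R]_n) :=
  symmetric_mx M /\ forall v : 'cV[R]_n, v != 0 -> 0 < (v^T *m M *m v) 0 0.
Definition possemidef_mx (M : 'M[R]_n) :=
  symmetric_mx M /\ forall v : 'cV[R]_n, 0 <= (v^T *m M *m v) 0 0.

End Defs.

Section Weak.
Variable (R : realType).
Local Notation mu := (@lebesgue_measure R).

Definition test_fun (phi : R -> R) :=
  (forall k x, derivable (iter k (@derive1 R R) phi) x 1) /\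
  exists M : R, forall x, M < `|x| -> phi x = 0.

Definition L2fun (h : R -> R) :=
  measurable_fun setT h /\ mu.-integrable setT (fun x => ((h x) ^+ 2)%:E).

Definition weak_deriv (h dh : R -> R) :=
  forall phi, test_fun phi ->
    Rintegral mu setT (fun x => h x * derive1 phi x) =
    - Rintegral mu setT (fun x => dh x * phi x).

Definition L2vec n (u : R -> 'cV[R]_n) := forall i, L2fun (fun x => u x i 0).
Definition H1vec n (u : R -> 'cV[R]_n) :=
  L2vec u /\ exists du : R -> 'cV[R]_n,
    L2vec du /\ forall i, weak_deriv (fun x => u x i 0) (fun x => du x i 0).

End Weak.

Section Problem.
Variable (R : realType).
Local Notation mu := (@lebesgue_measure R).

(* Weak (distributional) formulation of the eigenvalue problem
     lambda u + (A(U) u)_x + L q_x = 0,   -q_xx + q + (B(U) u)_x = 0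
   for lambda = a + i b, u = ur + i ui (u in H^1(R;C^n)), q = qr + i qi
   (q in L^2(R;C)); AU x = A(U(x)), BU x = B(U(x)). *)
Definition eig_weak_sol n (AU : R -> 'M[R]_n) (BU : R -> 'rV[R]_n)
    (L : 'cV[R]_n) (a b : R) (ur ui : R -> 'cV[R]_n) (qr qi : R -> R) :=
  [/\ H1vec ur, H1vec ui, L2fun qr & L2fun qi] /\
  forall phi, test_fun phi ->
    [/\ (forall i, Rintegral mu setT (fun x =>
            (a * ur x i 0 - b * ui x i 0) * phi x
            - ((AU x *m ur x) i 0 + L i 0 * qr x) * derive1 phi x) = 0),
        (forall i, Rintegral mu setT (fun x =>
            (a * ui x i 0 + b * ur x i 0) * phi x
            - ((AU x *m ui x) i 0 + L i 0 * qi x) * derive1 phi x) = 0),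
        Rintegral mu setT (fun x =>
            - qr x * derive1 (derive1 phi) x + qr x * phi x
            - (BU x *m ur x) 0 0 * derive1 phi x) = 0 &
        Rintegral mu setT (fun x =>
            - qi x * derive1 (derive1 phi) x + qi x * phi x
            - (BU x *m ui x) 0 0 * derive1 phi x) = 0].

Definition stat_profile n (Uset : set 'cV[R]_n) (f : 'cV[R]_n -> 'cV[R]_n)
    (g : 'cV[R]_n -> R) (L : 'cV[R]_n) (U : R -> 'cV[R]_n) (Q : R -> R)
    (um up : 'cV[R]_n) :=
  [/\ (forall x, Uset (U x)),
      (forall x, [/\ derivable U x 1, derivable (f \o U) x 1,
                     derivable (g \o U) x 1, derivable Q x 1 &
                     derivable (derive1 Q) x 1]),
      (forall x, derive1 (f \o U) x + derive1 Q x *: L = 0),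
      (forall x, - derive1 (derive1 Q) x + Q x + derive1 (g \o U) x = 0) &
      [/\ U x @[x --> +oo] --> up, U x @[x --> -oo] --> um,
          Q x @[x --> +oo] --> 0 & Q x @[x --> -oo] --> 0]].

End Problem.

(* Main.v *)
(* With [W = - (A u + L q) / lambda] one has [W_x = u], so the eigenvalue equation is available
   together with its integrated version [lambda W + A u + L q = 0].  Symmetrized by [A0 (U)],
   normalized so that [A0 L = B^T], the integrated version is an energy identity whose only
   dangerous coefficient is [- (A0 A)_x / 2].  Along a small profile [A (U)_x = v (A1 + o(1))] with
   [v = - (ap (U))_x >= 0], by (H2), and [- (A0 A)_x / v] is positive on [ker A (ustar)], which is
   spanned by [rp]; by Finsler's lemma it becomes positive definite once [A0] is replaced by
   [A0 (1 + M ap A)].  Adding half the energy of the eigenvalue equation, which produces [|B u|^2],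
   and a small multiple of Kawashima's compensator, which by (S2) controls the rest of [u], gives
   a function [Psi] with [Psi' <= - c (|u|^2 + |q|^2 + |s|^2)], [s = q_x - B u], except possibly
   at the point where [ap (U) = 0] and [u] may fail to be differentiable.  Since [Psi] is monotone
   and dominated by an integrable function, [Psi = 0], hence [u = q = 0].  One may assume
   [ap (ustar) = 0], since otherwise (H1) fails for small amplitudes. *)
Require Import Defs.
From HB Require Import structures.
From mathcomp Require Import all_boot all_order all_algebra.
From mathcomp Require Import all_classical all_reals all_analysis.
From mathcomp Require Import measurable_realfun ring lra.
Import Order.TTheory GRing.Theory Num.Theory.
Import numFieldNormedType.Exports.
Local Open Scope classical_set_scope.
Local Open Scope ring_scope.
Set Implicit Arguments. Unset Strict Implicit. Unset Printing Implicit Defensive.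

(** * Weak derivatives on the line *)

Section Bump.
Variable R : realType.
Implicit Types (p : {poly R}) (x y : R).

(** The coefficients along the profile are read as functions of a pair: the state u = U(x) and the
    direction z in U_x = c z, with z close to rp(ustar). Derivatives along the profile are linear in
    z, so A_x = c DA(u,z) and v = - c D(u,z), where D is the perturbation formula for the speed. The
    factor c, which may vanish and has no prescribed sign, cancels: A_x = v Ah with Ah = - DA / D,
    and Ah converges at (ustar, rp(ustar)) because D tends to the nonzero derivative of (H2). Every
    inequality becomes an open condition at one point, and the threshold only has to keep (u,z) in
    one neighborhood and v small. The obstacle is regularity: A0, rp and lp are given state by
    state, and ap is known to be differentiable only along rp and along the profile. Hence A0 is
    rewritten through Krylov matrices, eigenvectors are obtained by inverting a rank-one
    perturbation of A - ap, and the value of the derivative of the speed follows from these. The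
    constants are fixed in the order M, compensator, its weight m, bound dl on the errors that
    vanish with the amplitude, and last the threshold. *)

Lemma is_derive_quadratic_bound (f : R -> R) x K :
  (forall y, `|f y| <= K * (y - x) ^+ 2) -> is_derive x 1 f 0.
Proof.
move=> H.
have fx : f x = 0.
  by apply/eqP; rewrite -normr_le0 (le_trans (H x))// subrr expr0n mulr0.
have K0 : 0 <= K by have := H (x + 1); rewrite [x + 1]addrC addrK expr1n mulr1; apply: le_trans.
have L : h^-1 *: ((f \o shift x) (h *: (1 : R)) - f x) @[h --> 0^'] --> (0 : R).
  apply/cvgrPdist_le => e e0; near=> h.
  have h0 : h != 0 by near: h; exact: nbhs_dnbhs_neq.
  rewrite sub0r normrN /= fx subr0 normrZ normfV.
  rewrite ler_pdivrMl ?normr_gt0// (le_trans (H _))// /GRing.scale /= mulr1 addrK.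
  rewrite -[h ^+ 2]real_normK ?num_real// expr2 mulrCA ler_pM2l ?normr_gt0//.
  have hs : `|h| <= e / (K + 1).
    by near: h; apply: dnbhs0_le; rewrite divr_gt0// ltr_wpDl.
  rewrite ler_pdivlMr ?ltr_wpDl// in hs.
  rewrite (le_trans _ hs)// mulrDr mulr1 [K * _]mulrC.
  by rewrite lerDl.
apply: DeriveDef; last exact/cvg_lim.
by apply/cvg_ex; exists 0.
Unshelve. all: by end_near. Qed.

(* Closed under differentiation, which is why the polynomial and the pole order are left free. *)
Definition bump p (m : nat) x : R :=
  if 0 < x < 1 then p.[x] / (x * (1 - x)) ^+ m * expR (- (x * (1 - x))^-1) else 0.

Lemma poly_bound01 p : exists2 C, 0 <= C & forall x, 0 < x < 1 -> `|p.[x]| <= C.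
Proof.
exists (\sum_(i < size p) `|p`_i|); first exact: sumr_ge0.
move=> x /andP[x0 x1]; rewrite horner_coef (le_trans (ler_norm_sum _ _ _))//.
apply: ler_sum => i _; rewrite normrM -[leRHS]mulr1 ler_wpM2l//.
by rewrite normrX exprn_ile1// ger0_norm ?ltW.
Qed.

(** With w = x (1 - x), the series of [expR] at 1/w gives w^-m exp(-1/w) <= (m+2)! w^2, and on ]0,
    1[ w is at most the distance to either endpoint. A quadratic bound is what makes the extension
    by zero differentiable at 0 and at 1. *)
Lemma bump_bound p m : exists2 C, 0 <= C &
  forall x, `|bump p m x| <= C * (x - 0) ^+ 2 /\ `|bump p m x| <= C * (x - 1) ^+ 2.
Proof.
have [C C0 HC] := poly_bound01 p.
exists (C * (m.+2)`!%:R); first by rewrite mulr_ge0.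
move=> x; rewrite /bump; case: ifPn => [x01|_]; last first.
  by rewrite normr0; split; rewrite mulr_ge0 ?sqr_ge0// mulr_ge0.
have {HC} HC := HC _ x01; case/andP: x01 => x0 x1.
set w := x * (1 - x).
have w0 : 0 < w by rewrite mulr_gt0// subr_gt0.
suff H : `|p.[x] / w ^+ m * expR (- w^-1)| <= C * (m.+2)`!%:R * w ^+ 2.
  split; apply: (le_trans H); rewrite ler_wpM2l ?mulr_ge0//.
    by rewrite subr0 ler_sqr ?nnegrE ?ltW// /w; nra.
  by rewrite -[leRHS]sqrrN opprB ler_sqr ?nnegrE ?subr_ge0 ?ltW// /w; nra.
rewrite -mulrA normrM -mulrA.
suff H : w ^- m * expR (- w^-1) <= (m.+2)`!%:R * w ^+ 2.
  apply: ler_pM => //.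
  by rewrite ger0_norm// mulr_ge0 ?invr_ge0 ?exprn_ge0 ?expR_ge0// ltW.
have : w^-1 ^+ m.+2 / (m.+2)`!%:R <= expR w^-1.
  apply: le_trans (expR_ge1Dxn m.+1 _); first by rewrite lerDr.
  by rewrite invr_ge0 ltW.
rewrite ler_pdivrMr ?ltr0n ?fact_gt0//.
rewrite expRN -exprVn => H.
rewrite ler_pdivrMr ?expR_gt0// -(ler_pM2r (_ : 0 < w^-1 ^+ 2)); last first.
  by rewrite exprn_gt0// invr_gt0.
rewrite -exprD addn2 (le_trans H)// mulrC.
have -> // : (m.+2)`!%:R * w ^+ 2 * expR w^-1 * w^-1 ^+ 2 = (m.+2)`!%:R * expR w^-1.
by field; rewrite gt_eqF.
Qed.

(** Numerator of the derivative of p w^-m exp(-1/w), w = x (1 - x), over the common denominator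
    w^(m+2). *)
Definition dbump p m : {poly R} :=
  p^`() * ('X * (1 - 'X)) ^+ 2 - m%:R *: (p * ('X * (1 - 'X))^`() * ('X * (1 - 'X)))
  + p * ('X * (1 - 'X))^`().

Lemma is_derive_bump p m x : is_derive x 1 (bump p m) (bump (dbump p m) m.+2 x).
Proof.
have [C C0 HC] := bump_bound p m.
have [x01|] := boolP (0 < x < 1).
  have w0 : x * (1 - x) != 0.
    by case/andP: x01 => x0 x1; rewrite mulf_neq0 ?gt_eqF// subr_gt0.
  pose w := horner ('X * (1 - 'X) : {poly R}).
  have wE y : w y = y * (1 - y) by rewrite /w !hornerE.
  have dw : is_derive x 1 w ('X * (1 - 'X))^`().[x] by exact: is_derive_poly.
  have wx0 : w x != 0 by rewrite wE.
  have dwV := is_deriveV wx0 dw.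
  have dE : is_derive x 1 (expR \o (fun y => - (w y)^-1))
     (expR (- (w x)^-1) * - (- w x ^- 2 *: ('X * (1 - 'X))^`().[x])).
    by apply: is_derive1_comp.
  have := is_deriveM (is_deriveM (is_derive_poly p x) (is_deriveX m dwV)) dE.
  move=> D; apply: (near_eq_is_derive _ (is_derive_eq D _)).
    near=> y.
    have y01 : 0 < y < 1.
      near: y; have : x \in `]0, 1[ by rewrite in_itv.
      by move/near_in_itvoo; apply: filterS => z; rewrite in_itv.
    by rewrite /bump y01 /= ?fctE /= ?exprfctE ?exprVn ?wE.
  rewrite /bump x01 /dbump ?fctE/= ?exprfctE ?mulrfctE ?exprfctE /=.
  rewrite -![GRing.scale _ _]/(_ * _) !wE.
  rewrite !hornerE /=.
  set d := ('X * (1 - 'X))^`().[x]; set e := expR _; set W := x * (1 - x).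
  rewrite -/W in w0.
  (* The exponent m - 1 produced by differentiating the power is truncated at m = 0, hence the
     separate case. *)
  case: m {HC D} => [|m].
    rewrite /= !mul0r !expr0 /W; move: w0; rewrite /W mulf_eq0 negb_or.
    by set y := 1 - x => /andP[x0 y0]; field; rewrite x0 y0.
  rewrite /= !exprVn; set k := m.+1%:R.
  rewrite -[m.+3]addn3 exprD exprS.
  have : W ^+ m != 0 by rewrite expf_neq0.
  set V := W ^+ m => V0.
  move: w0; rewrite /W mulf_eq0 negb_or.
  by set y := 1 - x => /andP[x0 y0]; field; rewrite V0 x0 y0.
move=> nx.
have z0 : bump (dbump p m) m.+2 x = 0 by rewrite /bump (negbTE nx).
rewrite z0.
have [/eqP ->|xn0] := boolP (x == 0).
  by apply: (@is_derive_quadratic_bound _ _ C) => y; case: (HC y).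
have [/eqP ->|xn1] := boolP (x == 1).
  by apply: (@is_derive_quadratic_bound _ _ C) => y; case: (HC y).
have D0 : is_derive x 1 (cst 0 : R -> R) (0 : R) by exact: is_derive_cst.
apply: (near_eq_is_derive _ D0).
move: nx; rewrite negb_and -!leNgt => /orP[x0|x1].
  have {}x0 : x < 0 by rewrite lt_neqAle xn0.
  near=> y; rewrite /bump ifF// [0 < y]le_gtF//.
  by near: y; apply: filterS (lt_nbhsl x0) => ? /ltW.
have {}x1 : 1 < x by rewrite lt_neqAle eq_sym xn1.
near=> y; rewrite /bump ifF// [y < 1]le_gtF ?andbF//.
by near: y; apply: filterS (lt_nbhsr x1) => ? /ltW.
Unshelve. all: by end_near. Qed.

Lemma test_fun_bump p m : test_fun (bump p m).
Proof.
split; last first.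
  exists 1 => x; case: ltrgt0P => [x0|x0|->]; rewrite /bump.
  - by rewrite x0/= => /ltW; rewrite leNgt => /negbTE ->.
  - by rewrite [0 < x]lt_gtF.
  - by rewrite ltxx.
move=> k x.
suff [q [l ->]] : exists q l, iter k (@derive1 R R) (bump p m) = bump q l.
  by case: (is_derive_bump q l x).
elim: k p m => [|k IH] p m; first by exists p, m.
rewrite iterSr (_ : derive1 (bump p m) = bump (dbump p m) m.+2); last first.
  apply/funext => y; have D := is_derive_bump p m y.
  by rewrite derive1E derive_val.
exact: IH.
Qed.

End Bump.

(** * Test functions: primitives, rescaling, integration by parts *)

Section Primitives.
Variable R : realType.
Local Notation mu := (@lebesgue_measure R).
Implicit Types (f g h phi psi : R -> R) (x y : R).

Definition vanishes_beyond M f := forall x, M < `|x| -> f x = 0.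

Lemma is_derive_continuous f df : (forall x, is_derive x 1 f (df x)) -> continuous f.
Proof. by move=> D x; apply/differentiable_continuous/derivable1_diffP; case: (D x). Qed.

Lemma is_derive_derive1 f df :
  (forall x, is_derive x 1 f (df x)) -> derive1 f = df.
Proof. by move=> D; apply/funext => x; rewrite derive1E; case: (D x). Qed.

Lemma vanishes_restrict M f :
  vanishes_beyond M f -> (EFin \o f) \_ `[- M, M] = EFin \o f.
Proof.
move=> H; apply/funext => x; rewrite patchE; case: ifPn => //= xM.
rewrite H// ltNge; apply: contra xM; rewrite ler_norml => xM.
by rewrite inE /= in_itv.
Qed.

Lemma vanishes_integrable M f : vanishes_beyond M f ->
  mu.-integrable `[- M, M] (EFin \o f) -> mu.-integrable setT (EFin \o f).
Proof.
by move=> H /(integrable_mkcond _ _).1; rewrite (vanishes_restrict H); exact.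
Qed.

Lemma continuous_itv_integrable f (a b : R) :
  continuous f -> mu.-integrable `[a, b] (EFin \o f).
Proof.
move=> cf; apply: continuous_compact_integrable; first exact: segment_compact.
exact: continuous_subspaceT.
Qed.

Lemma continuous_vanishes_integrable M f : continuous f -> vanishes_beyond M f ->
  mu.-integrable setT (EFin \o f).
Proof.
by move=> cf H; apply: (vanishes_integrable H); exact: continuous_itv_integrable.
Qed.

Lemma locally_integrable_mul M h phi : locally_integrable setT h ->
  continuous phi -> vanishes_beyond M phi ->
  mu.-integrable setT (EFin \o (fun x => h x * phi x)).
Proof.
move=> [mh _ ih] cphi H.
apply: (@vanishes_integrable M); first by move=> x xM; rewrite H// mulr0.
have mI : measurable (`[- M, M] : set R) by [].
have ihM : mu.-integrable `[- M, M] (EFin \o h).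
  apply/integrableP; split.
    by apply/measurable_realfun.measurable_EFinP; exact: measurable_funS mh.
  by apply: ih => //; exact: segment_compact.
suff : mu.-integrable `[- M, M] ((EFin \o h) \* (EFin \o phi))%E by [].
apply: integrableMl => //.
  by apply: measurable_funS (continuous_measurable_fun cphi).
have /compact_bounded[B [Br HB]] :
    compact (phi @` `[- M, M]).
  by apply: continuous_compact; [exact: continuous_subspaceT|exact: segment_compact].
by exists B; split=> // B' BB' y yM; apply: HB => //; exists y.
Qed.

Lemma Rintegral_derivative M f df : 0 < M ->
  (forall x, is_derive x 1 f (df x)) -> continuous df -> vanishes_beyond M df ->
  Rintegral mu setT df = f M - f (- M).
Proof.
move=> M0 D cdf H.
rewrite /Rintegral -[X in (\int[mu]_x X x)%E]/(EFin \o df) -(vanishes_restrict H).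
rewrite -integral_mkcond.
have cf := is_derive_continuous D.
rewrite (@continuous_FTC2 _ df f).
- by [].
- by rewrite gtrN.
- exact: continuous_subspaceT.
- split=> [x _||]; first by case: (D x).
    exact/cvg_at_right_filter/cf.
  exact/cvg_at_left_filter/cf.
- by move=> x _; rewrite (is_derive_derive1 D).
Qed.

Definition primitive f x := Rintegral mu `]-oo, x] f.

Lemma is_derive_primitive f M x : continuous f -> vanishes_beyond M f ->
  is_derive x 1 (primitive f) (f x).
Proof.
move=> cf H; have fi := continuous_vanishes_integrable cf H.
have [|||D1 D2] := @continuous_FTC1 _ f -oo%O x (x + 1) _ _ _ (cf x).
- by rewrite ltrDl.
- by apply: integrableS fi.
- by rewrite ltNyr.
by apply: DeriveDef; [exact: D1|rewrite -derive1E].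
Qed.

Lemma primitive_left f M x : vanishes_beyond M f -> 0 <= M -> x < - M ->
  primitive f x = 0.
Proof.
move=> H M0 xM.
have f0 (y : R) : y <= x -> f y = 0.
  move=> yx; apply: H; rewrite -normrN; apply: lt_le_trans (ler_norm _).
  by rewrite ltrNr; exact: le_lt_trans xM.
rewrite /primitive (@eq_Rintegral _ _ _ _ _ (cst 0)).
  by rewrite /Rintegral integral0.
by move=> y; rewrite inE/= in_itv/=; exact: f0.
Qed.

Lemma primitive_right f M x : continuous f -> vanishes_beyond M f -> 0 <= M -> M < x ->
  primitive f x = Rintegral mu setT f.
Proof.
move=> cf H M0 Mx.
have H' : vanishes_beyond x f by move=> y xy; apply: H; lra.
have D y : is_derive y 1 (primitive f) (f y) by apply: is_derive_primitive H.
rewrite (Rintegral_derivative (le_lt_trans M0 Mx) D cf H').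
by rewrite [primitive f (- x)](primitive_left H)// ?subr0// ltrN2.
Qed.

Lemma test_fun_continuous phi : test_fun phi -> continuous phi.
Proof.
move=> [D _] x; apply/differentiable_continuous/derivable1_diffP; exact: (D 0%N).
Qed.

Lemma test_fun_is_derive phi x : test_fun phi -> is_derive x 1 phi (derive1 phi x).
Proof. by move=> [D _]; rewrite derive1E; apply/derivableP/(D 0%N). Qed.

Lemma test_fun_vanishes phi : test_fun phi -> exists2 M, 0 < M & vanishes_beyond M phi.
Proof.
move=> [_ [M H]]; exists (Num.max M 1); first by rewrite lt_max ltr01 orbT.
by move=> x; rewrite gt_max => /andP[/H].
Qed.

Lemma test_fun_derive1 phi : test_fun phi -> test_fun (derive1 phi).
Proof.
move=> tphi; split=> [k x|].
  by rewrite -iterSr; exact: tphi.1.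
have [M M0 H] := test_fun_vanishes tphi; exists M => x xM.
rewrite derive1E (@near_eq_derive _ _ _ _ (cst 0)) ?derive_cst//.
have : open [set y : R | M < `|y|].
  apply: (@open_comp _ _ (fun y : R => `|y|) [set y | M < y]); last exact: open_gt.
  by move=> ? _; exact: norm_continuous.
rewrite openE => /(_ x xM); apply: filterS => y /= yM.
by rewrite H.
Qed.

(** A primitive is constant on each side of the support of [psi]; the zero mean makes the constant
    on the right vanish too. *)
Lemma test_fun_primitive psi : test_fun psi -> Rintegral mu setT psi = 0 ->
  test_fun (primitive psi) /\ derive1 (primitive psi) = psi.
Proof.
move=> tpsi I0.
have [M M0 H] := test_fun_vanishes tpsi.
have cpsi := test_fun_continuous tpsi.
have D x : is_derive x 1 (primitive psi) (psi x) by apply: is_derive_primitive H.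
have dE := is_derive_derive1 D.
split=> //; split=> [[|k] x|].
- by case: (D x).
- by rewrite iterSr dE; exact: tpsi.1.
exists M => x; rewrite lter_normr => /orP[xM|xM].
  by rewrite (primitive_right cpsi H)// ltW.
by rewrite (primitive_left H) ?ltW// ltrNr.
Qed.

Lemma is_derive1Ml f x c df :
  is_derive x 1 f df -> is_derive x 1 (fun y => c * f y) (c * df).
Proof. by move=> D; have := @is_deriveZ _ _ _ f c x 1 df D. Qed.

Lemma is_derive1_val f x df : is_derive x 1 f df -> derive1 f x = df.
Proof. by move=> D; rewrite derive1E derive_val. Qed.

Lemma test_fun_affine phi a k : k != 0 -> test_fun phi ->
  test_fun (fun x => phi ((x - a) * k)) /\
  derive1 (fun x => phi ((x - a) * k)) = (fun x => k * derive1 phi ((x - a) * k)).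
Proof.
move=> k0 tphi.
have Da x : is_derive x 1 (fun x : R => (x - a) * k) k.
  apply: is_derive_eq; rewrite -![GRing.scale _ _]/(_ * _).
  by rewrite mulr0 add0r subr0 mulr1.
have D psi x : test_fun psi ->
    is_derive x 1 (fun x => psi ((x - a) * k)) (k * derive1 psi ((x - a) * k)).
  move=> tpsi.
  have := @is_derive1_comp _ psi _ x _ _ (test_fun_is_derive _ tpsi) (Da x).
  by rewrite mulrC.
have it j psi : test_fun psi ->
    iter j (@derive1 R R) (fun x => psi ((x - a) * k)) =
    (fun x => k ^+ j * (iter j (@derive1 R R) psi) ((x - a) * k)).
  elim: j psi => [|j IH] psi tpsi; first by apply/funext => x; rewrite mul1r.
  have tj : test_fun (iter j (@derive1 R R) psi).
    by elim: (j) => //= i; exact: test_fun_derive1.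
  rewrite iterS IH//; apply/funext => x.
  have Dx := D _ x tj.
  by rewrite (is_derive1_val (is_derive1Ml _ Dx)) exprSr mulrA.
split; last by have := it 1%N _ tphi; rewrite expr1.
split=> [j x|].
  rewrite it//; have tj : test_fun (iter j (@derive1 R R) phi).
    by elim: (j) => //= i; exact: test_fun_derive1.
  by case: (is_derive1Ml (k ^+ j) (D _ x tj)).
have [M M0 H] := test_fun_vanishes tphi.
exists (M / `|k| + `|a|) => x xM; apply: H; rewrite normrM.
rewrite -ltr_pdivrMr ?normr_gt0//.
by have := lerB_dist x a; lra.
Qed.

Lemma test_funB phi psi : test_fun phi -> test_fun psi ->
  test_fun (fun x => phi x - psi x) /\
  derive1 (fun x => phi x - psi x) = (fun x => derive1 phi x - derive1 psi x).
Proof.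
have it j p q : test_fun p -> test_fun q -> iter j (@derive1 R R) (fun x => p x - q x) =
    (fun x => iter j (@derive1 R R) p x - iter j (@derive1 R R) q x).
  move=> tp tq; elim: j => // j IH; rewrite iterS IH; apply/funext => x.
  by rewrite derive1E deriveB; [rewrite -!derive1E|exact: tp.1|exact: tq.1].
move=> tp tq; split; last exact: (it 1%N).
split=> [j x|]; first by rewrite it//; apply: derivableB; [exact: tp.1|exact: tq.1].
have [M M0 H] := test_fun_vanishes tp; have [N N0 K] := test_fun_vanishes tq.
by exists (M + N) => x xM; rewrite H ?K ?subr0//; lra.
Qed.

Lemma test_funZ phi k : test_fun phi ->
  test_fun (fun x => k * phi x) /\
  derive1 (fun x => k * phi x) = (fun x => k * derive1 phi x).
Proof.
have it j p : test_fun p -> iter j (@derive1 R R) (fun x => k * p x) =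
    (fun x => k * iter j (@derive1 R R) p x).
  move=> tp; elim: j => // j IH; rewrite iterS IH; apply/funext => x.
  by apply/is_derive1_val/is_derive1Ml; rewrite iterS derive1E; apply/derivableP/tp.1.
move=> tp; split; last exact: (it 1%N).
split=> [j x|].
  by rewrite it//; case: (is_derive1Ml k (derivableP (tp.1 j x))).
have [M M0 H] := test_fun_vanishes tp.
by exists M => x xM; rewrite H ?mulr0.
Qed.

Lemma test_fun_IBP h dh phi : (forall x, is_derive x 1 h (dh x)) -> continuous dh ->
  test_fun phi ->
  Rintegral mu setT (fun x => h x * derive1 phi x) =
  - Rintegral mu setT (fun x => dh x * phi x).
Proof.
move=> Dh cdh tphi.
have [M M0 H] := test_fun_vanishes tphi.
have ch := is_derive_continuous Dh.
have cphi := test_fun_continuous tphi.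
have cdphi := test_fun_continuous (test_fun_derive1 tphi).
have [N N0 H'] := test_fun_vanishes (test_fun_derive1 tphi).
have D x : is_derive x 1 (fun x => h x * phi x) (h x * derive1 phi x + dh x * phi x).
  have Dp := test_fun_is_derive x tphi; have Dx := Dh x.
  apply: is_derive_eq; rewrite -![GRing.scale _ _]/(_ * _).
  by rewrite [phi x * _]mulrC.
have c1 : continuous (fun x => h x * derive1 phi x).
  by move=> x; apply: cvgM; [exact: ch|exact: cdphi].
have c2 : continuous (fun x => dh x * phi x).
  by move=> x; apply: cvgM; [exact: cdh|exact: cphi].
have v1 : vanishes_beyond (M + N) (fun x => h x * derive1 phi x).
  by move=> x xM; rewrite H' ?mulr0//; lra.
have v2 : vanishes_beyond (M + N) (fun x => dh x * phi x).
  by move=> x xM; rewrite H ?mulr0//; lra.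
have := @Rintegral_derivative (M + N) _ _ _ D.
rewrite [h (M + N) * _]mulrC [h (- (M + N)) * _]mulrC !H; last 2 first.
- by rewrite normrN ger0_norm; lra.
- by rewrite ger0_norm; lra.
rewrite !mul0r subr0 RintegralD//.
- move=> I; apply/eqP; rewrite -addr_eq0; apply/eqP; apply: I.
  + by lra.
  + by move=> x; apply: cvgD; [exact: c1|exact: c2].
  + by move=> x xM; rewrite v1// v2// addr0.
- exact: continuous_vanishes_integrable v1.
- exact: continuous_vanishes_integrable v2.
Qed.

End Primitives.

(** * Absolutely continuous representatives of weakly differentiable functions *)

Section DuBoisReymond.
Variable R : realType.
Local Notation mu := (@lebesgue_measure R).
Implicit Types (f g h phi psi : R -> R) (x y a b k : R).

Lemma L2fun_locally_integrable h : L2fun h -> locally_integrable setT h.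
Proof.
move=> [mh ih]; split=> //; first exact: openT.
move=> K _ cK; have mK : measurable (K : set R) by exact: compact_measurable.
have /integrableP[_] : mu.-integrable K (EFin \o h).
  have i1 : mu.-integrable K (EFin \o (fun x => 1 + h x ^+ 2)).
    suff : mu.-integrable K ((fun=> 1%:E) \+ (fun x => (h x ^+ 2)%:E))%E by [].
    apply: integrableD => //; last by apply: integrableS ih.
    by apply: (@continuous_compact_integrable _ (cst 1)) => //; exact/continuous_subspaceT/cst_continuous.
  apply: le_integrable i1 => //.
    by apply/measurable_EFinP; exact: measurable_funS mh.
  move=> x _; rewrite lee_fin [leRHS]ger0_norm ?addr_ge0 ?sqr_ge0//.
  by rewrite -[h x ^+ 2]real_normK ?num_real//; have := normr_ge0 (h x); nra.
by [].
Qed.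

Lemma primitive_eq0 f x : (forall y, y <= x -> f y = 0) -> primitive f x = 0.
Proof.
move=> f0; rewrite /primitive (@eq_Rintegral _ _ _ _ _ (cst 0)).
  by rewrite /Rintegral integral0.
by move=> y; rewrite inE/= in_itv/=; exact: f0.
Qed.

(** Normalized primitive of exp(-1/(x (1 - x))). Differences of rescaled copies of [S] approximate
    the indicator of an interval, and their derivatives are differences of one-sided mollifiers. *)
Lemma smooth_step : exists (S s : R -> R) (B : R),
  [/\ test_fun s /\ (forall x, 0 <= s x <= B),
      forall x, ~~ (0 < x < 1) -> s x = 0,
      forall x, is_derive x 1 S (s x),
      (forall x, x <= 0 -> S x = 0) /\ (forall x, 1 <= x -> S x = 1) &
      forall x, 0 <= S x <= 1].
Proof.
pose s : R -> R := bump 1 0.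
have ts : test_fun s by exact: test_fun_bump.
have cs := test_fun_continuous ts.
have sE x : 0 < x < 1 -> 0 < s x <= 1.
  move=> x01; rewrite /s /bump x01 hornerC expr0 divr1 mul1r expR_gt0/= -[leRHS]expR0.
  rewrite ler_expR oppr_le0 invr_ge0.
  by case/andP: x01 => x0 x1; rewrite mulr_ge0 ?subr_ge0// ltW.
have s0 x : ~~ (0 < x < 1) -> s x = 0 by rewrite /s /bump => /negbTE ->.
have sge0 x : 0 <= s x <= 1.
  by have [/sE/andP[/ltW -> ->]//|/s0 ->] := boolP (0 < x < 1); rewrite lexx ler01.
have V x : 1 <= x -> vanishes_beyond x s.
  move=> x1 y xy; apply: s0; apply/negP => /andP[y0 y1].
  by move: xy; rewrite gtr0_norm// ltNge (le_trans (ltW y1)).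
pose S := primitive s.
have DS x : is_derive x 1 S (s x) by apply: is_derive_primitive (V 1 _).
have S0 x : x <= 0 -> S x = 0.
  move=> x0; apply: primitive_eq0 => y yx; apply: s0.
  by rewrite [0 < y]le_gtF// (le_trans yx).
have S1 x : 1 <= x -> S x = S 1.
  suff H y : 1 <= y -> S y = Rintegral mu setT s by move=> x1; rewrite !H.
  move=> y1; rewrite (Rintegral_derivative (lt_le_trans ltr01 y1) DS cs (V _ y1)).
  by rewrite [S (- y)]S0 ?subr0// oppr_le0 (le_trans ler01).
have Smono : {homo S : x y / x <= y}.
  move=> x y xy; apply: (@ger0_derive1_le_cc _ S x y) => //.
  - by move=> z _; rewrite (is_derive_derive1 DS); case/andP: (sge0 z).
  - exact/continuous_subspaceT/(is_derive_continuous DS).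
  - by rewrite in_itv/= lexx.
  - by rewrite in_itv/= lexx andbT.
have S1_gt0 : 0 < S 1.
  have lt34 : (4^-1 : R) < 3 / 4 by lra.
  have [|c] := @MVT _ S s (4^-1) (3/4) lt34 (fun x _ => DS x).
    exact/continuous_subspaceT/(is_derive_continuous DS).
  rewrite in_itv/= => /andP[c1 c2] E.
  have /sE/andP[sc _] : 0 < c < 1 by lra.
  have : 0 < S (3 / 4) - S 4^-1 by rewrite E mulr_gt0// subr_gt0.
  rewrite subr_gt0 => H; apply: le_lt_trans (lt_le_trans H _).
    by rewrite -(S0 0)//; apply: Smono; rewrite invr_ge0.
  by apply: Smono; lra.
exists (fun x => (S 1)^-1 * S x), (fun x => (S 1)^-1 * s x), (S 1)^-1; split.
- split; first by case: (test_funZ (S 1)^-1 ts).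
  move=> x; case/andP: (sge0 x) => p1 p2.
  have S1V : 0 <= (S 1)^-1 by rewrite invr_ge0 ltW.
  by apply/andP; split; [exact: mulr_ge0|exact: ler_piMr].
- by move=> x /s0 ->; rewrite mulr0.
- by move=> x; apply: is_derive1Ml.
- split=> x Hx; first by rewrite (S0 x) ?mulr0.
  by rewrite (S1 x)// mulVf ?gt_eqF.
- move=> x; have S01 : 0 <= S x <= S 1.
    apply/andP; split.
      by have [/S0 ->//|/ltW x0] := leP x 0; rewrite -(S0 0)//; apply: Smono.
    by have [/S1 ->//|/ltW x1] := leP 1 x; apply: Smono.
  have S1V : 0 <= (S 1)^-1 by rewrite invr_ge0 ltW.
  case/andP: S01 => p1 p2; apply/andP; split; first exact: mulr_ge0.
  by rewrite mulrC ler_pdivrMr ?mul1r.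
Qed.

(** The kernel is at most k B and lives within 1/k of [a], so the error is at most 2 B times the
    average of |h - h(a)| over the ball of radius 1/k, which tends to 0 at a Lebesgue point. *)
Lemma mollifier_cvg h (s : R -> R) B a : locally_integrable setT h ->
  continuous s -> (forall x, 0 <= s x <= B) -> (forall x, ~~ (0 < x < 1) -> s x = 0) ->
  (forall k, 0 < k -> Rintegral mu setT (fun x => k * s ((x - a) * k)) = 1) ->
  lebesgue_pt h a ->
  Rintegral mu setT (fun x => h x * (n.+1%:R * s ((x - a) * n.+1%:R)))
    @[n --> \oo] --> h a.
Proof.
move=> lh cs sB s0 I1 La.
have B0 : 0 <= B by case/andP: (sB 0); exact: le_trans.
pose r (n : nat) : R := n.+1%:R^-1.
have r0 n : 0 < r n by rewrite invr_gt0.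
have La' : fine (davg h a (r n)) @[n --> \oo] --> (0 : R).
  move/cvge_at_rightP : La => /(_ r) La; apply: fine_cvg; apply: La; split=> //.
  exact: cvg_harmonic.
apply/cvgrPdist_lt => e e0.
have e' : 0 < e / (2 * B + 1) by rewrite divr_gt0// ltr_wpDl// mulr_ge0.
have Le : \forall n \near \oo, `|fine (davg h a (r n))| < e / (2 * B + 1).
  by move/cvgrPdist_lt : La' => /(_ _ e'); apply: filterS => n; rewrite sub0r normrN.
near=> n; rewrite distrC.
have : 2 * B * `|fine (davg h a (r n))| < e.
  have : `|fine (davg h a (r n))| < e / (2 * B + 1) by near: n.
  rewrite ltr_pdivlMr ?ltr_wpDl// ?mulr_ge0//.
  by have := normr_ge0 (fine (davg h a (r n))); nra.
apply: le_lt_trans.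
set k : R := n.+1%:R; have k0 : 0 < k by rewrite ltr0n.
pose t x := k * s ((x - a) * k).
have ct : continuous t.
  move=> x; apply: cvgM; first exact: cvg_cst.
  apply: (@continuous_comp _ _ _ (fun x => (x - a) * k) s); last exact: cs.
  by apply: cvgM; [apply: cvgB; [exact: cvg_id|exact: cvg_cst]|exact: cvg_cst].
have t0 x : ~~ (0 < x - a < k^-1) -> t x = 0.
  move=> H; rewrite /t s0 ?mulr0//; apply: contra H => /andP[p1 p2].
  by rewrite -(pmulr_lgt0 _ k0) p1/= -div1r ltr_pdivlMr.
have tball x : ~ ball a (r n) x -> t x = 0.
  move=> H; apply: t0; apply/negP => /andP[p1 p2]; apply: H.
  by rewrite /ball/= distrC gtr0_norm.
have vt : vanishes_beyond (`|a| + 1) t.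
  move=> x xM; apply: tball => /=; rewrite /ball/= => H.
  have : r n <= 1 by rewrite invf_le1 ?ler1n.
  have := ler_distD 0 x a; rewrite subr0 sub0r normrN distrC.
  by have := lerB_dist x a; rewrite distrC; lra.
have ib : mu.-integrable setT (EFin \o (fun x => h x * t x)).
  exact: locally_integrable_mul vt.
have it : mu.-integrable setT (EFin \o t) by exact: continuous_vanishes_integrable vt.
have iat : mu.-integrable setT (EFin \o (fun x => h a * t x)).
  suff : mu.-integrable setT (fun x => (h a)%:E * (t x)%:E)%E by [].
  exact: integrableZl.
have Eha : h a = Rintegral mu setT (fun x => h a * t x).
  by rewrite RintegralZl// /t I1// mulr1.
rewrite [X in `|_ - X|]Eha -RintegralB//.
have id : mu.-integrable setT (EFin \o (fun x => h x * t x - h a * t x)).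
  suff : mu.-integrable setT ((EFin \o (fun x => h x * t x)%R) \- (EFin \o (fun x => h a * t x)%R))%E by [].
  exact: integrableB.
apply: le_trans (le_normr_Rintegral measurableT id) _.
have mball : measurable (ball a (r n) : set R) by exact: measurable_ball.
have lh1 : locally_integrable setT (fun x => h x - h a).
  apply: locally_integrableB => //; split=> //; first exact: openT.
  move=> K _ cK; have mK : measurable (K : set R) by exact: compact_measurable.
  rewrite integral_cst//.
  by rewrite ltey_eq fin_numM// ge0_fin_numE//; exact: compact_finite_measure.
have ih1 : mu.-integrable (ball a (r n)) (EFin \o (fun x => h x - h a)).
  apply: (@integrableS _ _ _ mu `[a - r n, a + r n]) => //.
    by rewrite ball_itv; exact: subset_itv_oo_cc.
  apply/integrableP; split; last by case: lh1 => _ _; apply=> //; exact: segment_compact.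
  by apply/measurable_EFinP; case: lh1 => m _ _; exact: measurable_funS m.
have inh1 : mu.-integrable (ball a (r n)) (EFin \o (fun x => `|h x - h a|)).
  exact: (integrable_norm ih1).
have ikB : mu.-integrable (ball a (r n)) (EFin \o (fun x => (k * B) * `|h x - h a|)).
  suff : mu.-integrable (ball a (r n)) (fun x => (k * B)%:E * (`|h x - h a|)%:E)%E by [].
  exact: integrableZl.
have -> : 2 * B * `|fine (davg h a (r n))| =
    Rintegral mu (ball a (r n)) (fun x => (k * B) * `|h x - h a|).
  rewrite RintegralZl// /davg /iavg lebesgue_measure_ball ?ltW// inver mulrn_eq0/= gt_eqF//.
  rewrite /Rintegral fineM//=; last exact: (integrable_fin_num _ inh1).
  rewrite ger0_norm ?mulr_ge0 ?fine_ge0 ?integral_ge0 ?invr_ge0 ?mulrn_wge0 ?ltW//.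
  rewrite mulrA; congr (_ * _).
  by rewrite -[r n *+ 2]mulr_natr /r -/k; field; rewrite gt_eqF.
rewrite [leRHS]Rintegral_mkcond; apply: le_Rintegral => //.
- exact: (integrable_norm id).
- by rewrite -restrict_EFin; apply/(integrable_mkcond _ _).1.
move=> x _; rewrite patchE; case: ifPn => [_|].
  rewrite -mulrBl normrM mulrC ler_wpM2r//.
  have /andP[p1 p2] := sB ((x - a) * k).
  have tn : 0 <= t x by rewrite mulr_ge0// ltW.
  by rewrite (ger0_norm tn) /t ler_pM2l.
rewrite notin_setE => /tball ->; by rewrite !mulr0 subr0 normr0.
Unshelve. all: by end_near. Qed.

(** Absolute continuity in integral form: it needs no base point and makes sense for an [f] that is
    known only almost everywhere. *)
Definition antiderivative (F f : R -> R) :=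
  forall x y, x < y -> F y - F x = Rintegral mu `]x, y] f.

Lemma locally_integrable_itv f a b : locally_integrable setT f ->
  mu.-integrable `[a, b] (EFin \o f).
Proof.
move=> [mf _ lf]; apply/integrableP; split; last by apply: lf => //; exact: segment_compact.
by apply/measurable_EFinP; apply: measurable_funS mf.
Qed.

Lemma antiderivative_exists f c0 : locally_integrable setT f ->
  exists2 F, antiderivative F f & F 0 = c0.
Proof.
move=> lf.
pose F x := c0 + if 0 <= x then Rintegral mu `]0, x] f else - Rintegral mu `]x, 0] f.
exists F; last by rewrite /F lexx set_itvoc0 Rintegral_set0 addr0.
have add x y z : x <= y -> y <= z ->
    Rintegral mu `]x, z] f = Rintegral mu `]x, y] f + Rintegral mu `]y, z] f.
  move=> xy yz; apply/eqP; rewrite addrC -subr_eq; apply/eqP.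
  apply: Rintegral_itvB; rewrite ?bnd_simp//.
  by apply: integrableS (locally_integrable_itv x z lf) => //; exact: subset_itv_oc_cc.
move=> x y xy; rewrite /F opprD addrACA subrr add0r.
have [x0|x0] := leP 0 x.
  by rewrite (le_trans x0 (ltW xy)) (add 0 x y)// ?ltW// addrC addKr.
have [y0|y0] := leP 0 y.
  by rewrite opprK (add x 0 y)// ?ltW// addrC.
by rewrite (add x y 0) ?ltW// opprK addrC addrK.
Qed.

Lemma antiderivative_segment F f x y : locally_integrable setT f ->
  antiderivative F f -> x <= y -> F y = F x + Rintegral mu `[x, y] f.
Proof.
move=> lf AF; rewrite le_eqVlt => /predU1P[->|xy].
  by rewrite set_itv1 Rintegral_set1 addr0.
rewrite -Rintegral_itv_obnd_cbnd; last first.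
  by apply: integrableS (locally_integrable_itv x y lf) => //; exact: subset_itv_oc_cc.
by rewrite -AF// addrC subrK.
Qed.

Lemma antiderivative_continuous F f : locally_integrable setT f ->
  antiderivative F f -> continuous F.
Proof.
move=> lf AF x.
have xx : x - 1 < x + 1 by lra.
have := parameterized_integral_continuous (ltW xx) (locally_integrable_itv _ _ lf).
move=> /(continuous_within_itvP _ xx)[+ _ _] => /(_ x).
rewrite in_itv/= ltrBlDr ltrDl ltr01/= => /(_ isT) cx.
have : {for x, continuous (fun y => F (x - 1) + parameterized_integral mu (x - 1) y f)}.
  by apply: cvgD; [exact: cvg_cst|exact: cx].
rewrite /prop_for /continuous_at -(antiderivative_segment lf AF); last by lra.
apply: cvg_trans; apply: near_eq_cvg; near=> y.
rewrite (antiderivative_segment lf AF (_ : x - 1 <= y))//.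
by near: y; apply: filterS (lt_nbhsr (_ : x - 1 < x)) => [? /ltW//|]; lra.
Unshelve. all: by end_near. Qed.

Lemma antiderivative_is_derive F f x : locally_integrable setT f ->
  antiderivative F f -> lebesgue_pt f x -> is_derive x 1 F (f x).
Proof.
move=> lf AF Lx.
have [|||D1 D2] := @FTC1_lebesgue_pt _ f (BLeft (x - 1)) x (x + 1) _ _ _ Lx.
- by rewrite ltrDl.
- exact: locally_integrable_itv.
- by rewrite lte_fin; lra.
have D : is_derive x 1 (fun y => F (x - 1) + Rintegral mu `[x - 1, y] f) (f x).
  have Dc : is_derive x 1 (cst (F (x - 1)) : R -> R) (0 : R) by exact: is_derive_cst.
  have DI : is_derive x 1 (fun y => Rintegral mu `[x - 1, y] f) (f x).
    by apply: DeriveDef; [exact: D1|rewrite -derive1E].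
  by have := is_deriveD Dc DI; rewrite add0r.
apply: near_eq_is_derive D; near=> y.
rewrite -(antiderivative_segment lf AF)//.
by near: y; apply: filterS (lt_nbhsr (_ : x - 1 < x)) => [? /ltW//|]; lra.
Unshelve. all: by end_near. Qed.

Lemma antiderivative_continuous_is_derive F f x : continuous f ->
  antiderivative F f -> is_derive x 1 F (f x).
Proof.
move=> cf AF.
have mf : measurable_fun setT f by exact: continuous_measurable_fun.
apply: antiderivative_is_derive => //.
  split=> //; first exact: openT.
  move=> K _ cK; have mK : measurable (K : set R) by exact: compact_measurable.
  by have /integrableP[] := continuous_compact_integrable cK (continuous_subspaceT cf).
apply: (@continuous_lebesgue_pt _ _ _ setT) => //.
  by split=> //; exact: openT.
exact: cf.
Qed.

(** The test functions S((n+1)(x - a)) - S((n+1)(x - b)) tend to the indicator of ]a, b]. Their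
    derivatives are differences of mollifiers at the two Lebesgue points, which gives h(a) - h(b);
    dominated convergence handles the side of [dh]. *)
Lemma weak_deriv_lebesgue_pt h dh a b : locally_integrable setT h ->
  locally_integrable setT dh -> weak_deriv h dh -> a < b ->
  lebesgue_pt h a -> lebesgue_pt h b -> h b - h a = Rintegral mu `]a, b] dh.
Proof.
move=> lh ldh wd ab La Lb.
have [S [s [B [[ts sB] s0 DS [S0 S1] S01]]]] := smooth_step.
have cs := test_fun_continuous ts.
have Daff c k x : is_derive x 1 (fun x => S ((x - c) * k)) (k * s ((x - c) * k)).
  have Da : is_derive x 1 (fun x : R => (x - c) * k) k.
    apply: is_derive_eq; rewrite -![GRing.scale _ _]/(_ * _).
    by rewrite mulr0 add0r subr0 mulr1.
  by have := @is_derive1_comp _ S _ x _ _ (DS _) Da; rewrite mulrC.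
have I1 c k : 0 < k -> Rintegral mu setT (fun x => k * s ((x - c) * k)) = 1.
  move=> k0; set M := `|c| + 1 + k^-1.
  have k'0 : 0 < k^-1 by rewrite invr_gt0.
  have M0 : 0 < M by rewrite /M; have := normr_ge0 c; lra.
  rewrite (Rintegral_derivative M0 (Daff c k)).
  - rewrite S1 ?S0 ?subr0//.
      rewrite pmulr_lle0// /M; have := ler_norm c; have := ler_norm (- c).
      by rewrite normrN; lra.
    rewrite -ler_pdivrMr// div1r /M; have := ler_norm c; have := ler_norm (- c).
    by rewrite normrN; lra.
  - have [t1 t1'] := test_fun_affine c (lt0r_neq0 k0) ts.
    by case: (test_funZ k t1) => /test_fun_continuous.
  move=> x xM; rewrite s0 ?mulr0//; apply/negP => /andP[p1 p2].
  rewrite pmulr_lgt0// subr_gt0 in p1.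
  rewrite -ltr_pdivlMr// div1r in p2.
  move: xM; rewrite lter_normr; have := ler_norm c; have := ler_norm (- c).
  by rewrite normrN /M => ? ? /orP[]; lra.
pose phi (n : nat) x := S ((x - a) * n.+1%:R) - S ((x - b) * n.+1%:R).
have tphi n : test_fun (phi n) /\ derive1 (phi n) =
    (fun x => n.+1%:R * s ((x - a) * n.+1%:R) - n.+1%:R * s ((x - b) * n.+1%:R)).
  have dE : derive1 (phi n) =
    (fun x => n.+1%:R * s ((x - a) * n.+1%:R) - n.+1%:R * s ((x - b) * n.+1%:R)).
    by apply: is_derive_derive1 => x; exact: is_deriveB (Daff a _ x) (Daff b _ x).
  split=> //.
  have n0 : n.+1%:R != 0 :> R by rewrite pnatr_eq0.
  have t1 c : test_fun (fun x => n.+1%:R * s ((x - c) * n.+1%:R)).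
    by have [t1 _] := test_fun_affine c n0 ts; case: (test_funZ n.+1%:R t1).
  split=> [[|j] x|].
  - by case: (is_deriveB (Daff a n.+1%:R x) (Daff b n.+1%:R x)).
  - by rewrite iterSr dE; case: (test_funB (t1 a) (t1 b)) => + _; case.
  exists (`|a| + `|b| + 1) => x.
  have n1 : 1 <= n.+1%:R :> R by rewrite ler1n.
  have na := ler_norm a; have na' := ler_norm (- a); have nb := ler_norm b; have nb' := ler_norm (- b).
  rewrite normrN in na'; rewrite normrN in nb'.
  have pa := normr_ge0 a; have pb := normr_ge0 b.
  rewrite lter_normr => /orP[xM|xM].
    by rewrite /phi !S1 ?subrr//; nra.
  by rewrite /phi !S0 ?subrr// pmulr_lle0//; lra.
have mphi n : measurable_fun setT (phi n).
  apply: continuous_measurable_fun; apply: test_fun_continuous.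
  exact: (proj1 (tphi n)).
have L1 : Rintegral mu setT (fun x => h x * derive1 (phi n) x) @[n --> \oo] --> h a - h b.
  rewrite (_ : (fun n : nat => _) = (fun n : nat =>
    Rintegral mu setT (fun x => h x * (n.+1%:R * s ((x - a) * n.+1%:R))) -
    Rintegral mu setT (fun x => h x * (n.+1%:R * s ((x - b) * n.+1%:R))))).
    by apply: cvgB; apply: mollifier_cvg => //; exact: I1.
  apply/funext => n; rewrite (tphi n).2 -RintegralB//; first by apply: eq_Rintegral => x _; rewrite mulrBr.
  - have n0 : n.+1%:R != 0 :> R by rewrite pnatr_eq0.
    have [t1 _] := test_fun_affine a n0 ts; have [t2 _] := test_funZ n.+1%:R t1.
    have [M _ vM] := test_fun_vanishes t2.
    exact: locally_integrable_mul lh (test_fun_continuous t2) vM.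
  - have n0 : n.+1%:R != 0 :> R by rewrite pnatr_eq0.
    have [t1 _] := test_fun_affine b n0 ts; have [t2 _] := test_funZ n.+1%:R t1.
    have [M _ vM] := test_fun_vanishes t2.
    exact: locally_integrable_mul lh (test_fun_continuous t2) vM.
have L2 : Rintegral mu setT (fun x => dh x * phi n x) @[n --> \oo] --> Rintegral mu `]a, b] dh.
  pose fl x := ((dh \_ `]a, b]) x)%:E.
  have il : mu.-integrable setT fl.
    have -> : fl = (EFin \o dh) \_ `]a, b] by rewrite restrict_EFin.
    apply/(integrable_mkcond _ _).1 => //.
    by apply: integrableS (locally_integrable_itv a b ldh) => //; exact: subset_itv_oc_cc.
  (* The ramps have width at most 1, so every [phi n] lives in [a, b + 1]. *)
  have [|||||_ _ L] := @dominated_convergence _ _ _ mu setT measurableT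
      (fun n x => (dh x * phi n x)%:E) fl (fun x => (((fun y => `|dh y|) \_ `[a, b + 1]) x)%:E).
  - move=> n; apply/measurable_EFinP; apply: measurable_funM; first by case: ldh.
    exact: mphi.
  - exact: measurable_int il.
  - apply: aeW => x _; apply: cvg_near_cst.
    have ev c : c < x -> \forall n \near \oo, S ((x - c) * n.+1%:R) = 1.
      move=> cx; near=> n; apply: S1.
      have : (x - c)^-1 <= n%:R by near: n; exact: nbhs_infty_ger.
      have xc0 : 0 < x - c by rewrite subr_gt0.
      rewrite -div1r ler_pdivrMr// mulrC => H; apply: (le_trans H).
      by rewrite ler_pM2l// ler_nat.
    have ev0 c n : x <= c -> S ((x - c) * n.+1%:R) = 0.
      by move=> xc; rewrite S0// pmulr_lle0// subr_le0.
    rewrite /fl patchE; case: ifPn; rewrite ?inE ?notin_setE /= in_itv/=.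
      move=> /andP[ax xb]; apply: filterS (ev _ ax) => n E1.
      by rewrite /phi E1 ev0// subr0 mulr1.
    move/negP; rewrite negb_and -leNgt -ltNge => /orP[xa|bx].
      by apply: nearW => n; rewrite /phi !ev0// ?subrr ?mulr0// (le_trans xa)// ltW.
    apply: filterS2 (ev _ (lt_trans ab bx)) (ev _ bx) => n E1 E2.
    by rewrite /phi E1 E2 subrr mulr0.
  - have -> : (fun x => (((fun y => `|dh y|) \_ `[a, b + 1]) x)%:E) =
      (EFin \o (fun y => `|dh y|)) \_ `[a, b + 1] by rewrite restrict_EFin.
    apply/(integrable_mkcond _ _).1 => //.
    exact: (integrable_norm (locally_integrable_itv a (b + 1) ldh)).
  - apply: aeW => x n _; rewrite lee_fin patchE; case: ifPn; rewrite ?inE ?notin_setE /= in_itv/=.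
      move=> _; rewrite normrM ler_piMr//.
      have /andP[p1 p2] := S01 ((x - a) * n.+1%:R).
      have /andP[p3 p4] := S01 ((x - b) * n.+1%:R).
      by rewrite /phi ler_norml; apply/andP; split; lra.
    have n1 : 1 <= n.+1%:R :> R by rewrite ler1n.
    move/negP; rewrite negb_and -!ltNge => /orP[xa|bx].
      by rewrite /phi !S0 ?subrr ?mulr0 ?normr0// pmulr_lle0//; lra.
    by rewrite /phi !S1 ?subrr ?mulr0 ?normr0//; nra.
  rewrite [X in _ --> X]Rintegral_mkcond.
  rewrite -(fineK (integrable_fin_num measurableT il)) in L.
  exact: fine_cvg L.
have L2N : (- (fun n : nat => Rintegral mu setT (fun x => dh x * phi n x))) x @[x --> \oo] -->
    - Rintegral mu `]a, b] dh by exact: cvgN.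
have E : (fun n : nat => Rintegral mu setT (fun x => h x * derive1 (phi n) x)) =
   - (fun n : nat => Rintegral mu setT (fun x => dh x * phi n x)).
  by apply/funext => n; rewrite wd//; exact: (tphi n).1.
rewrite E in L1.
by rewrite -[RHS]opprK -(cvg_unique _ L1 L2N) ?opprB//; exact: norm_hausdorff.
Unshelve. all: by end_near. Qed.

(** Almost every point is a Lebesgue point of [h]: one of them fixes the additive constant, and the
    increment formula gives agreement at all the others. *)
Lemma weak_deriv_antiderivative h dh : locally_integrable setT h ->
  locally_integrable setT dh -> weak_deriv h dh ->
  exists2 F, antiderivative F dh & {ae mu, forall x, h x = F x}.
Proof.
move=> lh ldh wd.
have [F0 AF0 _] := antiderivative_exists 0 ldh.
have aeL := lebesgue_differentiation lh.
have [c Lc] : exists c, lebesgue_pt h c.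
  have PF : ProperFilter (almost_everywhere mu).
    apply: ae_properfilter_algebraOfSetsType.
    have : (0 < mu `]-oo, +oo[%classic)%E by rewrite lebesgue_measure_itv/= ltry.
    by rewrite set_itvNyy.
  exact: (@filter_ex _ _ PF).
exists (fun x => F0 x + (h c - F0 c)).
  by move=> x y xy; rewrite -AF0// opprD addrACA subrr addr0.
apply: (filterS _ aeL); first exact: (ae_filter_ringOfSetsType mu).
move=> x Lx.
have [xc|xc|->] := ltgtP x c.
- have := weak_deriv_lebesgue_pt lh ldh wd xc Lx Lc; rewrite -AF0// => E.
  by lra.
- have := weak_deriv_lebesgue_pt lh ldh wd xc Lc Lx; rewrite -AF0// => E.
  by lra.
- by lra.
Qed.

Lemma locally_integrable_continuous f : continuous f -> locally_integrable setT f.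
Proof.
move=> cf; split; [exact: continuous_measurable_fun|exact: openT|].
move=> K _ cK; have mK : measurable (K : set R) by exact: compact_measurable.
by have /integrableP[] := continuous_compact_integrable cK (continuous_subspaceT cf).
Qed.

Lemma locally_integrable_mul_test h phi : locally_integrable setT h ->
  test_fun phi -> mu.-integrable setT (EFin \o (fun x => h x * phi x)).
Proof.
move=> lh tp; have [M _ v] := test_fun_vanishes tp.
exact: locally_integrable_mul lh (test_fun_continuous tp) v.
Qed.

(* Every test function is a multiple of a fixed mass-one one plus a derivative of a test function. *)
Lemma weak_deriv_of_second_order f m : locally_integrable setT f ->
  locally_integrable setT m ->
  (forall phi, test_fun phi -> Rintegral mu setT (fun x => f x * derive1 (derive1 phi) x) =
     - Rintegral mu setT (fun x => m x * derive1 phi x)) ->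
  exists k, weak_deriv f (fun x => m x - k).
Proof.
move=> lf lm H.
have [S [rho [B [[trho _] s0 DS [S0 S1] _]]]] := smooth_step.
have I1 : Rintegral mu setT rho = 1.
  rewrite (Rintegral_derivative ltr01 DS (test_fun_continuous trho)).
    by rewrite S1// S0 ?oppr_le0// subr0.
  by move=> x x1; apply: s0; apply/negP => /andP[p1 p2]; move: x1; rewrite gtr0_norm//; lra.
have i1 phi : test_fun phi -> mu.-integrable setT (EFin \o phi).
  move=> tp; have [M _ v] := test_fun_vanishes tp.
  exact: continuous_vanishes_integrable (test_fun_continuous tp) v.
(* The value forced by taking [rho] itself as the test function. *)
pose k := Rintegral mu setT (fun x => f x * derive1 rho x)
  + Rintegral mu setT (fun x => m x * rho x).
exists k => psi tpsi.
set c := Rintegral mu setT psi.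
have [tc dc] := test_funZ c trho.
have [tchi dchi] := test_funB tpsi tc.
have ichi : Rintegral mu setT (fun x => psi x - c * rho x) = 0.
  rewrite RintegralB//; [|exact: i1|exact: i1].
  by rewrite RintegralZl ?I1 ?mulr1 ?subrr//; exact: i1.
have [tphi dphi] := test_fun_primitive tchi ichi.
have := H _ tphi; rewrite dphi dchi dc.
have td := test_fun_derive1 trho; have tdpsi := test_fun_derive1 tpsi.
have iZ g phi (e : R) : locally_integrable setT g -> test_fun phi ->
    Rintegral mu setT (fun x => g x * (e * phi x)) = e * Rintegral mu setT (fun x => g x * phi x).
  move=> lg tp; rewrite -RintegralZl//; last exact: locally_integrable_mul_test.
  by apply: eq_Rintegral => x _; rewrite mulrCA.
have iB g phi phi' : locally_integrable setT g -> test_fun phi -> test_fun phi' ->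
    Rintegral mu setT (fun x => g x * (phi x - phi' x)) =
    Rintegral mu setT (fun x => g x * phi x) - Rintegral mu setT (fun x => g x * phi' x).
  move=> lg tp tp'; rewrite -RintegralB//; [|exact: locally_integrable_mul_test|exact: locally_integrable_mul_test].
  by apply: eq_Rintegral => x _; rewrite mulrBr.
have [tcd _] := test_funZ c td.
rewrite (iB f (derive1 psi) (fun x => c * derive1 rho x))//.
rewrite (iB m psi (fun x => c * rho x))// !iZ// => E.
have -> : Rintegral mu setT (fun x => (m x - k) * psi x) =
    Rintegral mu setT (fun x => m x * psi x) - k * c.
  rewrite /c -RintegralZl//; last exact: i1.
  rewrite -RintegralB//; [|exact: locally_integrable_mul_test|].
    by apply: eq_Rintegral => x _; rewrite mulrBl.
  have [tk _] := test_funZ k tpsi; exact: i1.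
have ar (x y z t : R) : x - c * y = - (z - c * t) -> x = - (z - (y + t) * c).
  by move=> Ex; rewrite -[LHS](subrK (c * y)) Ex; ring.
exact: ar.
Qed.

End DuBoisReymond.

(** * Differentiation along curves *)

Section CurveDifferentiability.
Variables (R : realType) (n : nat).
Local Notation V := ('cV[R]_n).
Implicit Types (F G : V -> R) (u v k : V).

Lemma near_forall (T : topologicalType) (I : finType) (P : I -> T -> Prop) (x : T) :
  (forall i, \forall y \near x, P i y) -> \forall y \near x, forall i, P i y.
Proof. by move=> H; exact: (@filter_forall _ _ (fun i => P i) (nbhs x) _ H). Qed.

Lemma is_derive_line (F : V -> R) (a v : V) (t : R) :
  derivable F (a + t *: v) v -> is_derive t 1 (fun s : R => F (a + s *: v)) ('D_v F (a + t *: v)).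
Proof.
move=> D.
have E : (fun h : R => h^-1 *: (((fun s : R => F (a + s *: v)) \o shift t) (h *: (1 : R)) - F (a + t *: v)))
   = (fun h : R => h^-1 *: ((F \o shift (a + t *: v)) (h *: v) - F (a + t *: v))).
  apply/funext => h /=; congr (_ *: (F _ - _)).
  by rewrite [h *: 1]mulr1 scalerDl addrCA.
apply: DeriveDef; first by rewrite /derivable E.
by rewrite /derive E.
Qed.

Lemma MVT_from0 (f df : R -> R) (s : R) :
  (forall t : R, `|t| <= `|s| -> is_derive t 1 f (df t)) ->
  exists2 c, `|c| <= `|s| & f s - f 0 = df c * s.
Proof.
move=> D.
have cf t : `|t| <= `|s| -> {for t, continuous f}.
  by move=> /D Dt; apply/differentiable_continuous/derivable1_diffP; case: Dt.
have [s0|s0] := leP 0 s.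
  have [t|t|c] := @MVT_segment _ f df 0 s s0.
  - rewrite in_itv/= => /andP[t0 ts]; apply: D.
    by rewrite !ger0_norm ?(ltW t0) ?(ltW ts).
  - apply: continuous_in_subspaceT => x; rewrite inE/= in_itv/= => /andP[t0 ts].
    by apply: cf; rewrite !ger0_norm.
  - rewrite in_itv/= => /andP[c0 cs] ->; exists c; last by rewrite subr0.
    by rewrite !ger0_norm.
have [t|t|c] := @MVT_segment _ f df s 0 (ltW s0).
- rewrite in_itv/= => /andP[ts t0]; apply: D.
  by rewrite !ler0_norm ?lerN2 ?(ltW t0) ?(ltW ts) ?(ltW s0).
- apply: continuous_in_subspaceT => x; rewrite inE/= in_itv/= => /andP[ts t0].
  by apply: cf; rewrite !ler0_norm ?lerN2 ?(ltW s0).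
- rewrite in_itv/= => /andP[cs c0]; rewrite sub0r mulrN => E; exists c.
    by rewrite !ler0_norm ?lerN2 ?(ltW s0).
  by rewrite -opprB E opprK.
Qed.

Lemma mx_entry_le m p (M : 'M[R]_(m, p)) i j : `|M i j| <= `|M|.
Proof. by rewrite [leRHS]/Num.Def.normr/= mx_normrE; exact: (le_bigmax _ _ (i, j)). Qed.

Lemma mx_norm_le m p (M : 'M[R]_(m, p)) (c : R) :
  0 <= c -> (forall i j, `|M i j| <= c) -> `|M| <= c.
Proof.
move=> c0 H; rewrite [leLHS]/Num.Def.normr/= mx_normrE.
by apply: bigmax_le => // -[i j] _; exact: H.
Qed.

(** Telescoping along the coordinate axes, with the mean value theorem on each segment. The norm is
    the maximum norm, so all intermediate points stay within |k| of [u]; each of the n segments may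
    spend e / (n + 1). *)
Lemma partials_increment F (u : V) (e : R) :
  (\forall w \near u, forall j, derivable F w (ebasis R j)) ->
  (forall j, {for u, continuous ('D_(ebasis R j) F)}) -> 0 < e ->
  \forall k \near (0 : V),
    `|F (u + k) - F u - \sum_j 'D_(ebasis R j) F u * k j 0| <= e * `|k|.
Proof.
move=> dF cF e0.
have e'0 : 0 < e / n.+1%:R by rewrite divr_gt0.
have : \forall w \near u, (forall j, derivable F w (ebasis R j)) /\
    (forall j, `|'D_(ebasis R j) F w - 'D_(ebasis R j) F u| <= e / n.+1%:R).
  have H2 : \forall w \near u, forall j,
      `|'D_(ebasis R j) F w - 'D_(ebasis R j) F u| <= e / n.+1%:R.
    apply: near_forall => j.
    by have /cvgrPdist_le/(_ _ e'0) := cF j; apply: filterS => w; rewrite distrC.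
  exact: filterI.
move=> /nbhs_ballP[d /= d0 H]; near=> k.
have kd : `|k| < d.
  by near: k; apply/nbhs_ballP; exists d => //= y; rewrite -ball_normE /= sub0r normrN.
pose kk (j : nat) : V := \col_i (if (i < j)%N then k i 0 else 0).
have step j : (j <= n)%N -> `|F (u + kk j) - F u -
     \sum_(i < n | (i < j)%N) 'D_(ebasis R i) F u * k i 0| <= j%:R * (e / n.+1%:R * `|k|).
  elim: j => [_|j IH jn].
    rewrite big_pred0// (_ : kk 0%N = 0) ?addr0 ?subrr ?subr0 ?normr0 ?mul0r//.
    by apply/matrixP => i j; rewrite !mxE.
  pose J := Ordinal jn.
  have EkS : kk j.+1 = kk j + k J 0 *: ebasis R J.
    apply/matrixP => i i'; rewrite ord1 !mxE ltnS leq_eqVlt -val_eqE /= eqxx andbT.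
    by case: eqP => [/= iJ|_]; rewrite /= ?addr0 ?mulr0 ?addr0// -iJ ltnn add0r mulr1;
      congr (k _ _); apply/val_inj.
  have near_w (t : R) : `|t| <= `|k J 0| -> ball u d (u + kk j + t *: ebasis R J).
    move=> tk; rewrite -ball_normE /ball_/= -addrA opprD addNKr normrN.
    apply: le_lt_trans kd; apply: mx_norm_le => // i i'; rewrite ord1 !mxE eqxx andbT.
    have [->|_] := eqVneq i J; first by rewrite ltnn add0r mulr1 (le_trans tk)// mx_entry_le.
    by rewrite mulr0 addr0; case: ifP => _; rewrite ?normr0// mx_entry_le.
  have [|c ck E] := @MVT_from0 (fun s => F (u + kk j + s *: ebasis R J))
      (fun s => 'D_(ebasis R J) F (u + kk j + s *: ebasis R J)) (k J 0).
    by move=> t /near_w /H[+ _] => /(_ J); exact: is_derive_line.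
  rewrite scale0r addr0 -addrA -EkS in E.
  rewrite (bigD1 J)//= (eq_bigl (fun i : 'I_n => (i < j)%N)); last first.
    move=> i; rewrite ltnS leq_eqVlt -val_eqE /=.
    by case: (ltngtP i j).
  have IHj := IH (ltnW jn); rewrite -[j.+1%:R]natr1 mulrDl mul1r.
  apply: le_trans (lerD IHj (_ :
    `|('D_(ebasis R J) F (u + kk j + c *: ebasis R J) - 'D_(ebasis R J) F u) * k J 0| <= _)).
    apply: le_trans (ler_normD _ _); rewrite mulrBl -E le_eqVlt; apply/orP; left.
    by apply/eqP; congr `|_|; lra.
  rewrite normrM ler_pM// ?mx_entry_le//.
  by have [_ /(_ J)] := H _ (near_w _ ck).
have En : \sum_(i < n | (i < n)%N) 'D_(ebasis R i) F u * k i 0 =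
    \sum_i 'D_(ebasis R i) F u * k i 0 by apply: eq_bigl => i; rewrite ltn_ord.
have := step n (leqnn n); rewrite En.
rewrite (_ : kk n = k); last by apply/matrixP => i j; rewrite ord1 !mxE ltn_ord.
move=> /le_trans; apply; rewrite mulrA ler_wpM2r// mulrCA ler_piMr ?(ltW e0)//.
by rewrite ler_pdivrMr// mul1r ler_nat.
Unshelve. all: by end_near. Qed.

Lemma cvg_sum_real (T : Type) (F : set_system T) (FF : Filter F) (I : Type) (r : seq I)
    (P : pred I) (f : I -> T -> R) (a : I -> R) :
  (forall i, P i -> f i x @[x --> F] --> a i) ->
  \sum_(i <- r | P i) f i x @[x --> F] --> \sum_(i <- r | P i) a i.
Proof.
move=> H; elim: r => [|i r IH].
  by rewrite big_nil; under eq_fun do rewrite big_nil; exact: cvg_cst.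
rewrite big_cons; under eq_fun do rewrite big_cons.
by case: ifPn => [Pi|_] //; apply: cvgD => //; exact: H.
Qed.

(* Stated for an abstract filter, in practice [nbhs us]: the derivative of [F] along any curve
   is given by the row vector [G], both having limits at [us]. *)
Definition curve_diff (N : set_system V) (us : V) F (G : V -> 'rV[R]_n) :=
  [/\ F u @[u --> N] --> F us, (forall j, G u 0 j @[u --> N] --> G us 0 j) &
      \forall u \near N, forall (gam : R -> V) x, gam x = u -> derivable gam x 1 ->
        is_derive x 1 (F \o gam) ((G u *m derive1 gam x) 0 0)].

Lemma chain_rule_partials F (gam : R -> V) (x : R) :
  (\forall w \near gam x, forall j, derivable F w (ebasis R j)) ->
  (forall j, {for gam x, continuous ('D_(ebasis R j) F)}) ->
  derivable gam x 1 ->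
  is_derive x 1 (F \o gam) ((grad_row F (gam x) *m derive1 gam x) 0 0).
Proof.
move=> dF cF dgam.
set u := gam x; set g := derive1 gam x.
have qg : h^-1 *: (gam (h + x) - u) @[h --> 0^'] --> g.
  rewrite /g derive1E; have := dgam; rewrite /derivable /derive.
  by under eq_fun do rewrite /= [_ *: 1]mulr1.
have cgam : {for x, continuous gam}.
  have /derivable1_diffP dd := dgam.
  exact: differentiable_continuous dd.
have L : h^-1 *: (((F \o gam) \o shift x) (h *: (1 : R)) - (F \o gam) x) @[h --> 0^'] -->
    ((grad_row F u *m g) 0 0).
  apply/cvgrPdist_le => e e0.
  (* Half of [e] goes to the convergence of the difference quotients of [gam]. The other half bounds
     the nonlinear remainder, since these quotients are eventually below |g| + 1. *)
  pose D := 2 * (`|g| + 1); have D0 : 0 < D by rewrite mulr_gt0// ltr_wpDl.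
  have eD : 0 < e / D by rewrite divr_gt0.
  have Lg : \sum_j 'D_(ebasis R j) F u * (h^-1 *: (gam (h + x) - u)) j 0 @[h --> 0^'] -->
      (grad_row F u *m g) 0 0.
    rewrite mxE; apply: cvg_sum_real => j _.
    rewrite mxE; apply: cvgM; first exact: cvg_cst.
    exact: (cvg_comp _ _ qg (@coord_continuous _ _ _ j 0 g)).
  have shx : h + x @[h --> 0^'] --> x.
    rewrite -[X in _ --> X]add0r; apply: cvgD; last exact: cvg_cst.
    by move=> A A0; exact: cvg_within A0.
  have inc : \forall h \near 0^', `|F (gam (h + x)) - F u -
       \sum_j 'D_(ebasis R j) F u * (gam (h + x) - u) j 0| <= (e / D) * `|gam (h + x) - u|.
    have ck : gam (h + x) - u @[h --> 0^'] --> (0 : V).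
      rewrite -(subrr u); apply: cvgB; last exact: cvg_cst.
      exact: (cvg_comp _ _ shx cgam).
    have : \forall h \near 0^', `|F (gam x + (gam (h + x) - u)) - F (gam x) -
       \sum_j 'D_(ebasis R j) F (gam x) * (gam (h + x) - u) j 0| <=
       (e / D) * `|gam (h + x) - u| := ck _ (partials_increment dF cF eD).
    by apply: filterS => h /=; rewrite addrCA subrr addr0.
  have bd : \forall h \near 0^', `|h^-1 *: (gam (h + x) - u)| <= `|g| + 1.
    have /cvgrPdist_le/(_ _ ltr01) := qg; apply: filterS => h H.
    rewrite -[X in `|X|](subKr g); rewrite (le_trans (ler_normB _ _))// lerD2l//.
  have /cvgrPdist_le/(_ (e / 2)) := Lg; rewrite divr_gt0// => /(_ isT) close.
  near=> h.
  have h0 : h != 0 by near: h; exact: nbhs_dnbhs_neq.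
  rewrite /= [h *: 1]mulr1 -/u.
  rewrite -(subrKA (\sum_j 'D_(ebasis R j) F u * (h^-1 *: (gam (h + x) - u)) j 0)).
  rewrite (le_trans (ler_normD _ _))// [leRHS](splitr e) lerD//.
    by near: h.
  have -> : \sum_j 'D_(ebasis R j) F u * (h^-1 *: (gam (h + x) - u)) j 0 =
     h^-1 *: (\sum_j 'D_(ebasis R j) F u * (gam (h + x) - u) j 0).
    by rewrite scaler_sumr; apply: eq_bigr => j _; rewrite mxE mulrCA.
  rewrite distrC -scalerBr.
  have HZ : `|F (gam (h + x)) - F u - \sum_j 'D_(ebasis R j) F u * (gam (h + x) - u) j 0|
     <= (e / D) * `|gam (h + x) - u| by near: h.
  rewrite normrZ normfV ler_pdivrMl ?normr_gt0//.
  apply: (le_trans HZ).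
  have : `|h^-1 *: (gam (h + x) - u)| <= `|g| + 1 by near: h.
  rewrite normrZ normfV ler_pdivrMl ?normr_gt0// => Hb.
  rewrite (le_trans (ler_wpM2l (ltW eD) Hb))// mulrCA ler_wpM2l//.
  have -> // : e / D * (`|g| + 1) = e / 2.
  by rewrite /D; field; rewrite gt_eqF// ltr_wpDl.
apply: DeriveDef; last exact/cvg_lim.
by apply/cvg_ex; eexists; exact: L.
Unshelve. all: by end_near. Qed.

Section Closure.
Variables (N : set_system V) (FN : Filter N) (us : V).

Lemma curve_diff_cst c : curve_diff N us (fun=> c) (fun=> 0).
Proof.
split=> /=.
  exact: cvg_cst.
  by move=> j; exact: cvg_cst.
apply: nearW => u gam x _ _; rewrite mul0mx mxE.
have := @is_derive_cst _ _ _ (c : R) x (1 : R); exact.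
Qed.

Lemma curve_diffD F G (f g : V -> 'rV[R]_n) : curve_diff N us F f -> curve_diff N us G g ->
  curve_diff N us (fun u => F u + G u) (fun u => f u + g u).
Proof.
move=> [cF cF' dF] [cG cG' dG]; split=> /=; first exact: cvgD.
  by move=> j; rewrite mxE; under eq_fun do rewrite mxE; apply: cvgD; [exact: cF'|exact: cG'].
apply: filterS2 dF dG => u dFu dGu gam x gx dgam.
by rewrite mulmxDl mxE; have := is_deriveD (dFu _ _ gx dgam) (dGu _ _ gx dgam).
Qed.

Lemma curve_diffM F G (f g : V -> 'rV[R]_n) : curve_diff N us F f -> curve_diff N us G g ->
  curve_diff N us (fun u => F u * G u) (fun u => F u *: g u + G u *: f u).
Proof.
move=> [cF cF' dF] [cG cG' dG]; split=> /=; first exact: cvgM.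
  move=> j; rewrite !mxE; under eq_fun do rewrite !mxE.
  apply: cvgD; apply: cvgM => //.
apply: filterS2 dF dG => u dFu dGu gam x gx dgam.
rewrite mulmxDl -!scalemxAl !mxE -gx.
have := is_deriveM (dFu _ _ gx dgam) (dGu _ _ gx dgam).
by rewrite -gx /= !mxE.
Qed.

Lemma curve_diffV F (f : V -> 'rV[R]_n) : F us != 0 -> curve_diff N us F f ->
  curve_diff N us (fun u => (F u)^-1) (fun u => (- (F u) ^- 2) *: f u).
Proof.
move=> Fu0 [cF cF' dF]; split=> /=; first exact: cvgV.
  move=> j; rewrite mxE; under eq_fun do rewrite mxE.
  apply: cvgM; last exact: cF'.
  apply: cvgN; apply: cvgV; first by rewrite expf_neq0.
  by rewrite expr2; under eq_fun do rewrite expr2; exact: cvgM.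
have F0 : \forall u \near N, F u != 0.
  have /cvgrPdist_lt/(_ `|F us|) := cF; rewrite normr_gt0 => /(_ Fu0).
  by apply: filterS => u; apply: contraTneq => ->; rewrite subr0 ltxx.
apply: filterS2 dF F0 => u dFu Fn0 gam x gx dgam.
have Fx : (F \o gam) x != 0 by rewrite /= gx.
have := is_deriveV Fx (dFu _ _ gx dgam); rewrite /= gx => D.
by rewrite -scalemxAl [X in is_derive _ _ _ X]mxE.
Qed.

(** Hiding the gradient leaves a class closed under sums, products and inverses, hence under
    determinants and adjugates. *)
Definition curve_C1 F := exists f : V -> 'rV[R]_n, curve_diff N us F f.

Lemma curve_C1_sum (I : Type) (r : seq I) (P : pred I) (F : I -> V -> R) :
  (forall i, P i -> curve_C1 (F i)) -> curve_C1 (fun u => \sum_(i <- r | P i) F i u).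
Proof.
move=> H; elim: r => [|i r [G IH]].
  by exists (fun=> 0 : 'rV[R]_n); under eq_fun do rewrite big_nil; exact: curve_diff_cst.
have [Pi|nPi] := boolP (P i); last first.
  by exists G; under eq_fun do rewrite big_cons (negbTE nPi).
under eq_fun do rewrite big_cons Pi.
by have [g D] := H i Pi; eexists; exact: curve_diffD D IH.
Qed.

Lemma curve_C1_prod (I : Type) (r : seq I) (P : pred I) (F : I -> V -> R) :
  (forall i, P i -> curve_C1 (F i)) -> curve_C1 (fun u => \prod_(i <- r | P i) F i u).
Proof.
move=> H; elim: r => [|i r [G IH]].
  by exists (fun=> 0 : 'rV[R]_n); under eq_fun do rewrite big_nil; exact: curve_diff_cst.
have [Pi|nPi] := boolP (P i); last first.
  by exists G; under eq_fun do rewrite big_cons (negbTE nPi).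
under eq_fun do rewrite big_cons Pi.
by have [g D] := H i Pi; eexists; exact: curve_diffM D IH.
Qed.

Lemma curve_C1M F G : curve_C1 F -> curve_C1 G -> curve_C1 (fun u => F u * G u).
Proof. by move=> [f D] [g E]; eexists; exact: curve_diffM D E. Qed.

Lemma curve_C1V F : F us != 0 -> curve_C1 F -> curve_C1 (fun u => (F u)^-1).
Proof. by move=> F0 [f D]; eexists; exact: curve_diffV F0 D. Qed.

Lemma curve_C1_cst c : curve_C1 (fun=> c).
Proof. by eexists; exact: curve_diff_cst. Qed.

Definition curve_C1mx m p (M : V -> 'M[R]_(m, p)) :=
  forall i j, curve_C1 (fun u => M u i j).

Lemma curve_C1mx_mul m p q (M : V -> 'M[R]_(m, p)) (M' : V -> 'M[R]_(p, q)) :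
  curve_C1mx M -> curve_C1mx M' -> curve_C1mx (fun u => M u *m M' u).
Proof.
move=> cM cN i j; under eq_fun do rewrite mxE.
by apply: curve_C1_sum => k _; exact: curve_C1M.
Qed.

Lemma curve_C1mx_tr m p (M : V -> 'M[R]_(m, p)) :
  curve_C1mx M -> curve_C1mx (fun u => (M u)^T).
Proof. by move=> cM i j; under eq_fun do rewrite mxE. Qed.

Lemma curve_C1_det p (M : V -> 'M[R]_p) : curve_C1mx M -> curve_C1 (fun u => \det (M u)).
Proof.
move=> cM; rewrite /determinant; apply: curve_C1_sum => s _.
by apply: curve_C1M; [exact: curve_C1_cst|apply: curve_C1_prod => i _].
Qed.

Lemma curve_C1mx_adj p (M : V -> 'M[R]_p) : curve_C1mx M -> curve_C1mx (fun u => \adj (M u)).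
Proof.
move=> cM i j; under eq_fun do rewrite mxE /cofactor.
apply: curve_C1M; first exact: curve_C1_cst.
by apply: curve_C1_det => k l; under eq_fun do rewrite !mxE.
Qed.

End Closure.

End CurveDifferentiability.

(** * Kalman matrices, compensators and Finsler's lemma *)

Section Frobenius.
Variable R : realType.

(** The Frobenius norm comes from the trace pairing, so the real and imaginary columns of a complex
    vector simply add up in the energies. The maximum norm of the library is kept for topology. *)
Definition sqnorm m p (X : 'M[R]_(m, p)) : R := \tr (X^T *m X).
Definition fnorm m p (X : 'M[R]_(m, p)) : R := Num.sqrt (sqnorm X).

Lemma mxtrace_trmul m p (X Y : 'M[R]_(m, p)) : \tr (X^T *m Y) = \sum_i \sum_j X i j * Y i j.
Proof.
rewrite /mxtrace exchange_big /=; apply: eq_bigr => j _; rewrite mxE.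
by apply: eq_bigr => i _; rewrite mxE.
Qed.

Lemma sqnormE m p (X : 'M[R]_(m, p)) : sqnorm X = \sum_i \sum_j X i j ^+ 2.
Proof. by rewrite /sqnorm mxtrace_trmul. Qed.

Lemma sqnorm_ge0 m p (X : 'M[R]_(m, p)) : 0 <= sqnorm X.
Proof. by rewrite sqnormE; do 2 (apply: sumr_ge0 => ? _); exact: sqr_ge0. Qed.

Lemma sqnorm_eq0 m p (X : 'M[R]_(m, p)) : (sqnorm X == 0) = (X == 0).
Proof.
apply/eqP/eqP => [|->]; last by rewrite /sqnorm mulmx0 mxtrace0.
rewrite sqnormE => /eqP; rewrite psumr_eq0 => [/allP H|i _]; last first.
  by apply: sumr_ge0 => j _; exact: sqr_ge0.
apply/matrixP => i j; rewrite mxE; have /implyP/(_ isT) := H i (mem_index_enum i).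
rewrite psumr_eq0 => [/allP/(_ j (mem_index_enum j))|k _]; last exact: sqr_ge0.
by rewrite sqrf_eq0 => /eqP.
Qed.

Lemma fnorm_ge0 m p (X : 'M[R]_(m, p)) : 0 <= fnorm X.
Proof. exact: sqrtr_ge0. Qed.

Lemma fnorm_sq m p (X : 'M[R]_(m, p)) : fnorm X ^+ 2 = sqnorm X.
Proof. by rewrite sqr_sqrtr ?sqnorm_ge0. Qed.

(** Lagrange's identity: the difference of the two sides is half the sum of the squares (a_i b_j -
    a_j b_i)^2. *)
Lemma sum_CS (I : finType) (a b : I -> R) :
  (\sum_i a i * b i) ^+ 2 <= (\sum_i a i ^+ 2) * (\sum_i b i ^+ 2).
Proof.
have : 0 <= \sum_i \sum_j (a i * b j - a j * b i) ^+ 2.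
  by do 2 (apply: sumr_ge0 => ? _); exact: sqr_ge0.
have e1 : \sum_i \sum_j a i ^+ 2 * b j ^+ 2 = (\sum_i a i ^+ 2) * (\sum_i b i ^+ 2).
  by rewrite mulr_suml; apply: eq_bigr => i _; rewrite mulr_sumr.
have e2 : \sum_i \sum_j a j ^+ 2 * b i ^+ 2 = (\sum_i a i ^+ 2) * (\sum_i b i ^+ 2).
  by rewrite exchange_big.
have e3 : \sum_i \sum_j (a i * b i) * (a j * b j) = (\sum_i a i * b i) ^+ 2.
  by rewrite expr2 mulr_suml; apply: eq_bigr => i _; rewrite mulr_sumr.
have -> : \sum_i \sum_j (a i * b j - a j * b i) ^+ 2 =
    \sum_i \sum_j a i ^+ 2 * b j ^+ 2 + \sum_i \sum_j a j ^+ 2 * b i ^+ 2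
    - (\sum_i \sum_j (a i * b i) * (a j * b j) + \sum_i \sum_j (a i * b i) * (a j * b j)).
  rewrite -!big_split -sumrB; apply: eq_bigr => i _ /=.
  by rewrite -!big_split -sumrB; apply: eq_bigr => j _ /=; ring.
by rewrite e1 e2 e3; lra.
Qed.

Lemma mxtrace_CS m p (X Y : 'M[R]_(m, p)) : `|\tr (X^T *m Y)| <= fnorm X * fnorm Y.
Proof.
rewrite -ler_sqr ?nnegrE ?mulr_ge0 ?fnorm_ge0// real_normK ?num_real//.
rewrite exprMn !fnorm_sq !sqnormE mxtrace_trmul !pair_big /=.
exact: (sum_CS (fun k : 'I_m * 'I_p => X k.1 k.2) (fun k => Y k.1 k.2)).
Qed.

Lemma fnorm_mul m p q (M : 'M[R]_(m, p)) (X : 'M[R]_(p, q)) :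
  fnorm (M *m X) <= fnorm M * fnorm X.
Proof.
rewrite -ler_sqr ?nnegrE ?mulr_ge0 ?fnorm_ge0// exprMn !fnorm_sq !sqnormE.
rewrite mulr_suml; apply: ler_sum => i _.
rewrite [X in _ <= _ * X]exchange_big mulr_sumr; apply: ler_sum => j _.
by rewrite mxE; exact: sum_CS.
Qed.

Lemma sqnorm_mul m p q (M : 'M[R]_(m, p)) (X : 'M[R]_(p, q)) :
  sqnorm (M *m X) <= sqnorm M * sqnorm X.
Proof.
by rewrite -!fnorm_sq -exprMn ler_sqr ?nnegrE ?mulr_ge0 ?fnorm_ge0// fnorm_mul.
Qed.

Lemma bilinear_bound m p q (M : 'M[R]_(m, p)) (X : 'M[R]_(m, q)) (Y : 'M[R]_(p, q)) :
  `|\tr (X^T *m M *m Y)| <= fnorm M * fnorm X * fnorm Y.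
Proof.
rewrite -mulmxA (le_trans (mxtrace_CS _ _))// mulrAC mulrC ler_wpM2r ?fnorm_ge0//.
exact: fnorm_mul.
Qed.

Lemma fnorm_le m p (M : 'M[R]_(m, p)) (d : R) : 0 <= d ->
  (forall i j, `|M i j| <= d) -> fnorm M <= (m * p)%:R * d.
Proof.
move=> d0 H; rewrite -ler_sqr ?nnegrE ?mulr_ge0 ?fnorm_ge0// fnorm_sq sqnormE.
apply: le_trans (_ : \sum_(i < m) \sum_(j < p) d ^+ 2 <= _).
  apply: ler_sum => i _; apply: ler_sum => j _.
  by rewrite -real_normK ?num_real// ler_sqr ?nnegrE.
under eq_bigr do rewrite sumr_const card_ord.
rewrite sumr_const card_ord -mulrnA mulnC -[X in X <= _]mulr_natl exprMn ler_wpM2r ?sqr_ge0//.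
by rewrite -natrX ler_nat; case: (m * p)%N => // k; rewrite leq_pmulr.
Qed.

Lemma fnormD m p (X Y : 'M[R]_(m, p)) : fnorm (X + Y) <= fnorm X + fnorm Y.
Proof.
rewrite -ler_sqr ?nnegrE ?addr_ge0 ?fnorm_ge0// sqrrD !fnorm_sq.
have -> : sqnorm (X + Y) = sqnorm X + \tr (X^T *m Y) *+ 2 + sqnorm Y.
  have DT : (X + Y)^T = X^T + Y^T by rewrite linearD.
  rewrite /sqnorm DT mulmxDl !mulmxDr !mxtraceD.
  by rewrite -[\tr (Y^T *m X)]mxtrace_tr trmx_mul trmxK mulr2n; ring.
rewrite lerD2r lerD2l lerMn2r /=; apply: le_trans (ler_norm _) (mxtrace_CS _ _).
Qed.

Lemma fnormZ m p (c : R) (X : 'M[R]_(m, p)) : fnorm (c *: X) = `|c| * fnorm X.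
Proof.
apply/eqP; rewrite -(eqrXn2 (_ : 0 < 2)%N) ?mulr_ge0 ?fnorm_ge0//.
rewrite exprMn !fnorm_sq real_normK ?num_real// !sqnormE mulr_sumr; apply/eqP.
apply: eq_bigr => i _; rewrite mulr_sumr; apply: eq_bigr => j _.
by rewrite mxE exprMn.
Qed.

Lemma mxtrace_cols m p (M : 'M[R]_m) (X : 'M[R]_(m, p)) :
  \tr (X^T *m M *m X) = \sum_c ((col c X)^T *m M *m col c X) 0 0.
Proof.
rewrite /mxtrace; apply: eq_bigr => c _.
rewrite !mxE; apply: eq_bigr => i _; rewrite !mxE; congr (_ * _).
by apply: eq_bigr => k _; rewrite !mxE.
Qed.

Lemma sqnorm_cols m p (X : 'M[R]_(m, p)) : sqnorm X = \sum_c sqnorm (col c X).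
Proof.
rewrite sqnormE exchange_big /=; apply: eq_bigr => c _; rewrite sqnormE.
by apply: eq_bigr => i _; rewrite big_ord1 mxE.
Qed.

End Frobenius.

(** * Observability, normalized symmetrizers and the compensating matrix *)

Section Krylov.
Variables (R : realType) (n' : nat).
Local Notation n := n'.+1.
Implicit Types (A : 'M[R]_n) (B : 'rV[R]_n) (L : 'cV[R]_n).

Lemma spec_list_size A s : spec_list A s -> size s = n.
Proof.
by move=> [_ /(congr1 (fun p : {poly R} => size p))]; rewrite size_char_poly size_prod_XsubC => -[].
Qed.

Lemma spec_list_uniq A s t : spec_list A s -> spec_list A t -> s = t.
Proof.
move=> [ss Es] [st Et]; apply: le_sorted_eq => //.
by apply: prod_XsubC_eq; rewrite -Es -Et.
Qed.

Lemma split_annihilates A s (v : 'cV[R]_n) : spec_list A s ->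
  (\prod_(x <- s) (A - x%:M)) *m v = 0.
Proof.
move=> [_ Es]; have := Cayley_Hamilton A; rewrite Es rmorph_prod /=.
under eq_bigr do rewrite rmorphB /= horner_mx_X horner_mx_C.
by move=> ->; rewrite mul0mx.
Qed.

(** When the factors are applied one after the other, the last nonzero vector is an eigenvector; [P]
    records the invariant subspace in which the search takes place. Since the spectrum is real, no
    complex eigenvector has to be considered. *)
Lemma eigenvector_of_product A (s : seq R) (P : 'cV[R]_n -> Prop) (v : 'cV[R]_n) :
  (forall x w, P w -> P ((A - x%:M) *m w)) -> P v -> v != 0 ->
  (\prod_(x <- s) (A - x%:M)) *m v = 0 ->
  exists x w, [/\ P w, w != 0 & A *m w = x *: w].
Proof.
move=> cP; elim/last_ind: s v => [|s x IH] v Pv v0.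
  by rewrite big_nil mul1mx => E; rewrite E eqxx in v0.
rewrite -cats1 big_cat big_seq1 /= -mulmxE -mulmxA.
have [E _|n0] := eqVneq ((A - x%:M) *m v) 0.
  exists x, v; split=> //; move/eqP: E.
  by rewrite mulmxBl subr_eq0 mul_scalar_mx => /eqP.
by move=> E; apply: IH n0 E; exact: cP.
Qed.

(** The coefficients are those of the remainder of X^k modulo the characteristic polynomial. *)
Lemma power_reduction A k : exists c : 'I_n -> R, A ^+ k = \sum_i c i *: A ^+ i.
Proof.
have mon : char_poly A \is monic by exact: char_poly_monic.
pose r := 'X^k %% char_poly A.
have szr : (size r <= n)%N.
  by have := ltn_modp 'X^k (char_poly A); rewrite size_char_poly monic_neq0// ltnS.
exists (fun i => r`_i).
have -> : A ^+ k = horner_mx A r.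
  rewrite -[A ^+ k](_ : horner_mx A 'X^k = _); last by rewrite rmorphXn /= horner_mx_X.
  rewrite {1}(divp_eq 'X^k (char_poly A)) rmorphD rmorphM /= Cayley_Hamilton.
  by rewrite mulr0 add0r.
have {1}-> : r = \sum_(i < n) r`_i *: 'X^i.
  rewrite -poly_def; apply/polyP => i; rewrite coef_poly.
  by case: ltnP => // ni; rewrite nth_default// (leq_trans szr).
rewrite rmorph_sum /=; apply: eq_bigr => i _.
by rewrite linearZ /= rmorphXn /= horner_mx_X.
Qed.

(** Kalman's observability matrix of the pair (A, B). *)
Definition obsmx A B : 'M[R]_n := \matrix_(k < n) (B *m A ^+ k).

Lemma obsmx_mul0 A B (v : 'cV[R]_n) : obsmx A B *m v = 0 -> forall k, B *m A ^+ k *m v = 0.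
Proof.
move=> H k; have H' (i : 'I_n) : B *m A ^+ i *m v = 0.
  have : row i (obsmx A B *m v) = 0 by rewrite H row0.
  by rewrite row_mul rowK.
have [c ->] := power_reduction A k.
rewrite mulmx_sumr mulmx_suml big1// => i _.
by rewrite -scalemxAr -scalemxAl H' scaler0.
Qed.

(* Popov-Belevitch-Hautus test *)
Lemma obsmx_unit A B s : spec_list A s ->
  (forall (m : R) (v : 'cV[R]_n), v != 0 -> A *m v = m *: v -> B *m v != 0) ->
  obsmx A B \in unitmx.
Proof.
move=> sA H; rewrite unitmxE unitfE -det_tr; apply/negP => /det0P[v v0].
move=> /(congr1 trmx); rewrite trmx_mul trmxK trmx0 => E.
have vT0 : v^T != 0 by rewrite -trmx0 (inj_eq trmx_inj).
have [||x [w [Pw w0 Aw]]] := @eigenvector_of_product A s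
    (fun w => forall k, B *m A ^+ k *m w = 0) v^T _ _ vT0 (split_annihilates _ sA).
- move=> x w Pw k; rewrite mulmxBl mulmxBr mulmxA -[_ *m A]mulmxA mulmxE -exprSr Pw.
  by rewrite mul_scalar_mx -scalemxAr Pw scaler0 subr0.
- exact: obsmx_mul0.
by have := H _ _ w0 Aw; rewrite -[B]mulmx1 (Pw 0%N) eqxx.
Qed.

(** If y B is symmetric and nonzero, with y = A0 L, then y is a multiple c of B^T. Semidefiniteness
    makes c positive, so dividing [A0] by c keeps it positive definite. *)
Lemma symmetrizer_normalize (A0 : 'M[R]_n) A B L : posdef_mx A0 -> symmetric_mx (A0 *m A) ->
  possemidef_mx (A0 *m (L *m B)) -> \rank (A0 *m (L *m B)) = 1%N ->
  exists A1 : 'M[R]_n, [/\ posdef_mx A1, symmetric_mx (A1 *m A) & A1 *m L = B^T].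
Proof.
move=> [sA0 pA0] sA0A [sP pP] rk.
pose y := A0 *m L; rewrite mulmxA -/y in sP pP rk.
have yB0 : y *m B != 0 by apply/eqP => E; rewrite E mxrank0 in rk.
have [j Bj] : exists j, B 0 j != 0.
  have B0 : B != 0 by apply: contraNneq yB0 => ->; rewrite mulmx0.
  by move/rV0Pn: B0.
have sym z i k : symmetric_mx (z *m B) -> z i 0 * B 0 k = z k 0 * B 0 i.
  move=> /(congr1 (fun M : 'M[R]_n => M k i)).
  by rewrite /= !mxE !big_ord1.
have yE i k : y i 0 * B 0 k = y k 0 * B 0 i by exact: sym.
pose c := y j 0 / B 0 j.
have ycB i : y i 0 = c * B 0 i.
  by rewrite /c mulrAC -yE mulfK.
have c0 : c != 0.
  apply: contraNneq yB0 => E; apply/eqP/matrixP => i k.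
  by rewrite !mxE big_ord1 ycB E !mul0r.
have cpos : 0 < c.
  rewrite lt_neqAle eq_sym c0 /=.
  have := pP (delta_mx j 0); rewrite trmx_delta -rowE -colE !mxE big_ord1 ycB -mulrA.
  by rewrite pmulr_lge0// -expr2 exprn_even_gt0.
exists (c^-1 *: A0); split.
- split; first by rewrite /symmetric_mx linearZ /= sA0.
  move=> v v0; rewrite -scalemxAr -scalemxAl mxE mulr_gt0 ?invr_gt0//; exact: pA0.
- by rewrite /symmetric_mx -scalemxAl linearZ /= sA0A.
- apply/matrixP => i k; by rewrite ord1 -scalemxAl -/y [LHS]mxE ycB mulKf// mxE.
Qed.

(** Symmetry of A0 and of A0 A means A^T A0 = A0 A, so [A0] moves through the powers of A^T. The
    identity shows [A0] as the solution of a linear system and carries invertibility from one Krylov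
    matrix to the other. *)
Lemma obsmx_symmetrizer (A0 : 'M[R]_n) A B L : symmetric_mx A0 ->
  symmetric_mx (A0 *m A) -> A0 *m L = B^T -> obsmx A^T L^T *m A0 = obsmx A B.
Proof.
move=> sA0 sA0A A0L; apply/row_matrixP => k; rewrite row_mul !rowK.
have AT : A^T *m A0 = A0 *m A by rewrite -[RHS]sA0A trmx_mul sA0.
have E j : A^T ^+ j *m A0 = A0 *m A ^+ j.
  elim: j => [|j IH]; first by rewrite !expr0 mul1mx mulmx1.
  by rewrite exprSr -mulmxE -mulmxA AT mulmxA IH -mulmxA mulmxE -exprSr.
rewrite -mulmxA E mulmxA; congr (_ *m _).
by rewrite -[L^T *m A0]trmxK trmx_mul trmxK sA0 A0L trmxK.
Qed.

Lemma sqnorm_cv (u : 'cV[R]_n) : sqnorm u = \sum_i u i 0 ^+ 2.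
Proof. by rewrite sqnormE; apply: eq_bigr => i _; rewrite big_ord1. Qed.

Definition qform (M : 'M[R]_n) (u : 'cV[R]_n) : R := (u^T *m M *m u) 0 0.

Lemma qformD M N u : qform (M + N) u = qform M u + qform N u.
Proof. by rewrite /qform mulmxDr mulmxDl mxE. Qed.

Lemma qformZ c M u : qform (c *: M) u = c * qform M u.
Proof. by rewrite /qform -scalemxAr -scalemxAl mxE. Qed.

Lemma qform_rank1 (x y : 'rV[R]_n) u : qform (x^T *m y) u = (x *m u) 0 0 * (y *m u) 0 0.
Proof.
rewrite /qform mulmxA -mulmxA mxE big_ord1; congr (_ * _).
by rewrite -[u^T *m x^T]trmx_mul mxE.
Qed.

(* Kawashima's compensating matrix, built by induction on the Krylov order [k]. *)
Lemma compensator_step A B k (e : R) : 0 < e -> exists (K : 'M[R]_n) (N : R),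
  [/\ K^T = - K, 0 <= N & forall u, \sum_(j < k.+1) (B *m A ^+ j *m u) 0 0 ^+ 2
     - e * (B *m A ^+ k.+1 *m u) 0 0 ^+ 2 <= qform (K *m A) u + N * (B *m u) 0 0 ^+ 2].
Proof.
pose b j (u : 'cV[R]_n) : R := (B *m A ^+ j *m u) 0 0.
elim: k e => [|k IH] e e0.
  exists 0, 1; split; rewrite ?trmx0 ?oppr0// => u.
  have q0 : qform 0 u = 0 by rewrite /qform mulmx0 mul0mx mxE.
  rewrite big_ord1 expr0 mulmx1 mul0mx q0 add0r mul1r.
  by rewrite gerBl mulr_ge0 ?sqr_ge0// ltW.
(* Multiplied by [m], the induction hypothesis loses exactly one b_(k+1)^2. The form of 2 T A
   supplies two of them: one repays this loss, the other is the new term of the sum. The part 1/e of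
   [m] pays for the cross term b_k b_(k+2). *)
pose m := 1 + e^-1; have m0 : 0 < m by rewrite addr_gt0// invr_gt0.
have m'0 : 0 < m^-1 by rewrite invr_gt0.
have [K [N [sK N0 HK]]] := IH _ m'0.
pose x := B *m A ^+ k.+1; pose y := B *m A ^+ k.
pose T := x^T *m y - y^T *m x.
exists (2 *: T + m *: K), (m * N); split.
- have TT : T^T = - T by rewrite /T linearB /= !trmx_mul !trmxK opprB.
  by rewrite linearD /= !linearZ /= TT sK !scalerN -opprD.
- by rewrite mulr_ge0// ltW.
move=> u.
have ET : qform (T *m A) u = b k.+1 u ^+ 2 - b k u * b k.+2 u.
  rewrite /T mulmxBl -!mulmxA -scaleN1r qformD qformZ !qform_rank1 mulN1r.
  by rewrite -[A ^+ k *m A]exprSr -[A ^+ k.+1 *m A]exprSr expr2.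
rewrite mulmxDl -!scalemxAl qformD !qformZ ET -/(b k.+2 u).
rewrite big_ord_recr /= -/(b k.+1 u) -/(b k.+2 u).
have := HK u; set S := \sum_(_ < _) _; rewrite -/(b k.+1 u) => H.
have Sb : b k u ^+ 2 <= S.
  by rewrite /S big_ord_recr /= -/(b k u) lerDr sumr_ge0// => j _; exact: sqr_ge0.
have S0 : 0 <= S by rewrite (le_trans _ Sb)// sqr_ge0.
have H2 : m * S - b k.+1 u ^+ 2 <= m * qform (K *m A) u + m * (N * (B *m u) 0 0 ^+ 2).
  by rewrite -[b k.+1 u ^+ 2](mulVKf (lt0r_neq0 m0)) -mulrBr -mulrDr ler_pM2l.
(* Young: [2 b_k b_(k+2) <= b_k^2 / e + e b_(k+2)^2] *)
have Y : 2 * (b k u * b k.+2 u) <= e^-1 * b k u ^+ 2 + e * b k.+2 u ^+ 2.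
  rewrite -subr_ge0.
  have -> : e^-1 * b k u ^+ 2 + e * b k.+2 u ^+ 2 - 2 * (b k u * b k.+2 u) =
     e^-1 * (b k u - e * b k.+2 u) ^+ 2 by field; rewrite gt_eqF.
  by rewrite mulr_ge0 ?sqr_ge0 ?invr_ge0 ?ltW.
have Se : e^-1 * b k u ^+ 2 <= e^-1 * S by rewrite ler_pM2l ?invr_gt0.
rewrite /m mulrDl mul1r in H2; rewrite -mulrA /m.
by lra.
Qed.

(** Invertibility of the observability matrix bounds |u|^2 by the Krylov sum S. The leftover term in
    B A^n u is then bounded by S as well, and [e] is chosen to make it at most S / 2. *)
Lemma compensator A B : obsmx A B \in unitmx -> exists (K : 'M[R]_n) (N c : R),
  [/\ K^T = - K, 0 <= N, 0 < c & forall u : 'cV[R]_n,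
     c * sqnorm u <= qform (K *m A) u + N * (B *m u) 0 0 ^+ 2].
Proof.
move=> uO; pose C0 := sqnorm (invmx (obsmx A B)); pose D := sqnorm (B *m A ^+ n).
have C0_ge0 : 0 <= C0 by exact: sqnorm_ge0.
have D_ge0 : 0 <= D by exact: sqnorm_ge0.
pose e := (2 * (C0 * D + 1))^-1.
have CD : 0 < C0 * D + 1 by rewrite ltr_wpDl// mulr_ge0.
have e0 : 0 < e by rewrite invr_gt0 mulr_gt0.
have [K [N [sK N0 HK]]] := compensator_step A B n' e0.
exists K, N, (2 * (C0 + 1))^-1; split=> //.
  by rewrite invr_gt0 mulr_gt0// ltr_wpDl.
move=> u; apply: le_trans (HK u).
set S := \sum_(_ < _) _.
have ES : S = sqnorm (obsmx A B *m u).
  rewrite sqnorm_cv; apply: eq_bigr => k _; congr (_ ^+ 2).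
  by rewrite [RHS]mxE [LHS]mxE; apply: eq_bigr => j _; rewrite [obsmx _ _ _ _]mxE.
have H1 : sqnorm u <= C0 * S.
  by rewrite ES -{1}[u](mulKmx uO) mulmxA -mulmxA sqnorm_mul.
have H2 : (B *m A ^+ n *m u) 0 0 ^+ 2 <= D * sqnorm u.
  by have := sqnorm_mul (B *m A ^+ n) u; rewrite sqnormE !big_ord1.
have S0 : 0 <= S by rewrite ES sqnorm_ge0.
have u0 := sqnorm_ge0 u.
have H3 : e * (B *m A ^+ n *m u) 0 0 ^+ 2 <= S / 2.
  rewrite /e invfM mulrC mulrA ler_pdivrMr//.
  have H4 : (B *m A ^+ n *m u) 0 0 ^+ 2 <= D * (C0 * S) by rewrite (le_trans H2)// ler_wpM2l.
  by rewrite mulrDr mulr1; lra.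
rewrite mulrC ler_pdivrMr ?mulr_gt0 ?ltr_wpDl//.
set X := e * _ in H3 *.
have H5 : (S / 2) * (2 * (C0 + 1)) <= (S - X) * (2 * (C0 + 1)).
  by rewrite ler_pM2r ?mulr_gt0 ?ltr_wpDl//; lra.
by apply: le_trans H5; lra.
Qed.

End Krylov.

(** * Rank-one deflation, quadratic forms and Finsler's lemma *)

Section SpectralAlgebra.
Variables (R : realType) (n' : nat).
Local Notation n := n'.+1.
Implicit Types (A S G : 'M[R]_n) (B l : 'rV[R]_n) (r u v w : 'cV[R]_n).

(** A kernel vector v satisfies l v = 0 and A v = a v. As B is a single row, the combination (B v) r
    - (B r) v lies in ker B and in the eigenspace, so it vanishes; applying [l] gives B v = 0, which
    is excluded for an eigenvector. *)
Lemma deflated_unit A B (a : R) r l : A *m r = a *: r -> l *m A = a *: l -> l *m r = 1%:M ->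
  (forall (m : R) v, v != 0 -> A *m v = m *: v -> B *m v != 0) ->
  A - a%:M + r *m l \in unitmx.
Proof.
move=> Ar lA lr H; rewrite unitmxE unitfE -det_tr; apply/negP => /det0P[v v0].
move=> /(congr1 trmx); rewrite trmx_mul trmxK trmx0.
have : v^T != 0 by rewrite -trmx0 (inj_eq trmx_inj).
move: (v^T) => {v0} {}v v0.
rewrite mulmxDl mulmxBl mul_scalar_mx -mulmxA => E.
have lv : l *m v = 0.
  have := congr1 (mulmx l) E; rewrite mulmx0 mulmxDr mulmxBr [l *m (A *m v)]mulmxA lA.
  by rewrite -scalemxAl -scalemxAr subrr add0r [l *m (r *m _)]mulmxA lr mul1mx.
have Av : A *m v = a *: v.
  by move: E; rewrite lv mulmx0 addr0 => /eqP; rewrite subr_eq0 => /eqP.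
pose z := (B *m v) 0 0 *: r - (B *m r) 0 0 *: v.
have Bz : B *m z = 0.
  rewrite mulmxBr -!scalemxAr; apply/matrixP => i j; rewrite !ord1 !mxE.
  by rewrite mulrC subrr.
have z0 : z = 0.
  have Az : A *m z = a *: z.
    by rewrite mulmxBr -!scalemxAr Ar Av scalerBr !scalerA ![a * _]mulrC.
  by apply/eqP; apply/negP => /negP z0; have := H _ _ z0 Az; rewrite Bz eqxx.
have : (B *m v) 0 0 = 0.
  have := congr1 (fun M => (l *m M) 0 0) z0.
  by rewrite /z mulmxBr -!scalemxAr lr lv mulmx0 scaler0 subr0 !mxE eqxx mulr1.
move=> Bv; have := H _ _ v0 Av; suff -> : B *m v = 0 by rewrite eqxx.
by apply/matrixP => i j; rewrite !ord1 Bv mxE.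
Qed.

Lemma symmetric_bilinear S u v : symmetric_mx S -> (u^T *m S *m v) 0 0 = (v^T *m S *m u) 0 0.
Proof.
by move=> sS; rewrite -[u^T *m S *m v]trmxK [in LHS]mxE !trmx_mul trmxK sS mulmxA.
Qed.

Lemma addmxE m p (X Y : 'M[R]_(m, p)) i j : (X + Y) i j = X i j + Y i j.
Proof. by rewrite mxE. Qed.

Lemma scalemxE m p (c : R) (X : 'M[R]_(m, p)) i j : (c *: X) i j = c * X i j.
Proof. by rewrite mxE. Qed.

Lemma trmxZ m p (c : R) (X : 'M[R]_(m, p)) : (c *: X)^T = c *: X^T.
Proof. by rewrite linearZ. Qed.

Lemma qform0r S : qform S 0 = 0.
Proof. by rewrite /qform mulmx0 mxE. Qed.

Lemma qformZr S (c : R) u : qform S (c *: u) = c ^+ 2 * qform S u.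
Proof. by rewrite /qform trmxZ -scalemxAr -!scalemxAl !scalemxE mulrA. Qed.

Lemma qform_add S u v : qform S (u + v) =
  qform S u + (u^T *m S *m v) 0 0 + (v^T *m S *m u) 0 0 + qform S v.
Proof.
have E : (u + v)^T = u^T + v^T by rewrite linearD.
by rewrite /qform E !mulmxDl !mulmxDr !addmxE; ring.
Qed.

Lemma qform_line S u v (t : R) : symmetric_mx S ->
  qform S (u + t *: v) = qform S u + 2 * t * (u^T *m S *m v) 0 0 + t ^+ 2 * qform S v.
Proof.
move=> sS; rewrite qform_add -!scalemxAr trmxZ -!scalemxAl qformZr !scalemxE.
by rewrite (symmetric_bilinear v u sS); ring.
Qed.

Lemma qform_CS S u v : posdef_mx S -> ((u^T *m S *m v) 0 0) ^+ 2 <= qform S u * qform S v.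
Proof.
move=> [sS pS]; have [->|v0] := eqVneq v 0.
  by rewrite mulmx0 [X in X ^+ 2]mxE expr0n qform0r mulr0.
have qv : 0 < qform S v by exact: pS.
set b := (_ *m v) 0 0.
have q0 w : 0 <= qform S w.
  have [->|w0] := eqVneq w 0; first by rewrite /qform mulmx0 mxE.
  by apply/ltW/pS.
have := q0 (u + (- b / qform S v) *: v); rewrite qform_line// -/b => H.
rewrite -ler_pdivrMr// -subr_ge0; apply: le_trans H _.
by rewrite le_eqVlt; apply/orP; left; apply/eqP; field; rewrite gt_eqF.
Qed.

Lemma qform_bound S u : `|qform S u| <= fnorm S * sqnorm u.
Proof.
have := bilinear_bound S u u; rewrite -mulrA -expr2 fnorm_sq /qform.
by rewrite /mxtrace big_ord1.
Qed.

Lemma posdef_unit S : posdef_mx S -> S \in unitmx.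
Proof.
move=> [sS pS]; rewrite unitmxE unitfE; apply/negP => /det0P[v v0 vS].
have vT0 : v^T != 0 by rewrite -trmx0 (inj_eq trmx_inj).
by have := pS _ vT0; rewrite trmxK vS mul0mx mxE ltxx.
Qed.

(** Cauchy-Schwarz for the form S between u and S^-1 u reads |u|^4 <= (u, S u) (u, S^-1 u), and the
    last factor is at most the norm of S^-1 times |u|^2; no compactness of the sphere enters. *)
Lemma posdef_coercive S : posdef_mx S -> exists2 c, 0 < c & forall u, c * sqnorm u <= qform S u.
Proof.
move=> pS; have uS := posdef_unit pS.
exists (fnorm (invmx S) + 1)^-1; first by rewrite invr_gt0 ltr_wpDl ?fnorm_ge0.
move=> u; have [->|u0] := eqVneq u 0.
  by rewrite /qform mulmx0 mxE /sqnorm mulmx0 mxtrace0 mulr0.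
have su : 0 < sqnorm u by rewrite lt_neqAle eq_sym sqnorm_eq0 u0 sqnorm_ge0.
have f0 := fnorm_ge0 (invmx S).
rewrite mulrC ler_pdivrMr ?ltr_wpDl//.
have := qform_CS u (invmx S *m u) pS.
have -> : (u^T *m S *m (invmx S *m u)) 0 0 = sqnorm u.
  by rewrite mulmxA mulmxK// /sqnorm /mxtrace big_ord1.
have -> : qform S (invmx S *m u) = qform (invmx S) u.
  have sS : S^T = S by case: pS.
  by rewrite /qform trmx_mul trmx_inv sS -!mulmxA mulKVmx.
move=> H; have qu : 0 < qform S u by case: pS => _; apply.
have H2 : sqnorm u ^+ 2 <= qform S u * (fnorm (invmx S) * sqnorm u).
  apply: le_trans H _; rewrite ler_pM2l//; apply: le_trans (ler_norm _) (qform_bound _ _).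
rewrite expr2 mulrA ler_pM2r// in H2; apply: le_trans H2 _.
by rewrite ler_pM2l// lerDl.
Qed.

(* Finsler's lemma for [ker A = span r] *)
Lemma finsler A S G r l : A *m r = 0 -> l *m r = 1%:M ->
  A + r *m l \in unitmx -> posdef_mx S -> 0 < qform G r ->
  exists M c : R, [/\ 0 <= M, 0 < c &
    forall u, c * sqnorm u <= qform G u + M * qform S (A *m u)].
Proof.
move=> Ar lr uN pS g0.
have [s0 s0_gt0 Hs] := posdef_coercive pS.
set g := qform G r in g0.
set rho := fnorm r; set gam := fnorm G; set N := A + r *m l.
set k := sqnorm (invmx N).
have rho0 : 0 <= rho by exact: fnorm_ge0.
have gam0 : 0 <= gam by exact: fnorm_ge0.
have k0 : 0 <= k by exact: sqnorm_ge0.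
(* In u = t r + y with l y = 0, Young's inequality gives half of g t^2 to the cross terms at the
   cost of the first summand; [gam] bounds the form at y, and the final 1 leaves |y|^2 for
   coercivity. *)
pose C' := 2 * gam ^+ 2 * rho ^+ 2 / g + gam + 1.
have C'0 : 0 < C'.
  have c1 : 0 <= 2 * gam ^+ 2 * rho ^+ 2 / g.
    by rewrite divr_ge0 ?(ltW g0)// !mulr_ge0 ?sqr_ge0.
  by rewrite /C' ltr_wpDl// addr_ge0.
pose c := (4 * rho ^+ 2 / g + 2)^-1.
have c0 : 0 < c by rewrite invr_gt0 ltr_wpDl// divr_ge0 ?(ltW g0)// mulr_ge0 ?sqr_ge0.
exists (C' * (k + 1) / s0), c; split=> //.
  apply: divr_ge0; last exact: ltW.
  by apply: mulr_ge0; [exact: ltW|exact: addr_ge0].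
move=> u; set t := (l *m u) 0 0; set y := u - t *: r.
have uE : u = t *: r + y by rewrite addrC subrK.
have ly : l *m y = 0.
  rewrite mulmxBr -scalemxAr lr; apply/matrixP => i j.
  by rewrite !ord1 !mxE eqxx mulr1 -/t [X in X - _](_ : _ = t) ?subrr// /t mxE.
have yE : y = invmx N *m (A *m u).
  have -> : A *m u = N *m y.
    by rewrite uE mulmxDr -scalemxAr Ar scaler0 add0r mulmxDl -mulmxA ly mulmx0 addr0.
  by rewrite mulKmx.
have Hy : sqnorm y <= k * sqnorm (A *m u) by rewrite yE sqnorm_mul.
have HS := Hs (A *m u).
have a0 := sqnorm_ge0 (A *m u).
have Y0 := fnorm_ge0 y; have Y2 := fnorm_sq y.
set Y := fnorm y in Y0 Y2.
have HG : t ^+ 2 * g - 2 * gam * rho * `|t| * Y - gam * Y ^+ 2 <= qform G u.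
  have -> : qform G u = t ^+ 2 * g + t * ((r^T *m G *m y) 0 0 + (y^T *m G *m r) 0 0) + qform G y.
    by rewrite {1}uE qform_add -scalemxAr trmxZ -!scalemxAl qformZr !scalemxE -/g; ring.
  have b1 : `|(r^T *m G *m y) 0 0| <= gam * rho * Y.
    by have := bilinear_bound G r y; rewrite /mxtrace big_ord1.
  have b2 : `|(y^T *m G *m r) 0 0| <= gam * rho * Y.
    by have := bilinear_bound G y r; rewrite /mxtrace big_ord1 mulrAC.
  have b3 := qform_bound G y; rewrite -Y2 in b3.
  have : `|t * ((r^T *m G *m y) 0 0 + (y^T *m G *m r) 0 0)| <= `|t| * (2 * (gam * rho * Y)).
    rewrite normrM ler_wpM2l// (le_trans (ler_normD _ _))//; lra.
  rewrite ler_norml => /andP[b4 _]; move: b3; rewrite ler_norml => /andP[b3 _].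
  by rewrite -/gam in b3; lra.
have HG2 : t ^+ 2 * g / 2 - (C' - 1) * Y ^+ 2 <= qform G u.
  apply: le_trans HG; rewrite -subr_ge0.
  have -> : t ^+ 2 * g - 2 * gam * rho * `|t| * Y - gam * Y ^+ 2 -
     (t ^+ 2 * g / 2 - (C' - 1) * Y ^+ 2) =
     (2 * g)^-1 * (g * `|t| - 2 * gam * rho * Y) ^+ 2.
    by rewrite /C' -[t ^+ 2]real_normK ?num_real//; field; rewrite gt_eqF.
  by rewrite mulr_ge0 ?sqr_ge0 ?invr_ge0// mulr_ge0// ltW.
have HM : C' * Y ^+ 2 <= C' * (k + 1) / s0 * qform S (A *m u).
  rewrite -[X in _ <= X]mulrA -mulrA ler_pM2l// Y2.
  apply: le_trans (_ : (k + 1) * sqnorm (A *m u) <= _).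
    by apply: le_trans Hy _; rewrite mulrDl lerDl mul1r.
  by rewrite ler_pM2l ?ltr_wpDl// mulrC ler_pdivlMr// mulrC.
have Hu : sqnorm u <= 2 * rho ^+ 2 * t ^+ 2 + 2 * Y ^+ 2.
  have := fnormD (t *: r) y; rewrite -uE fnormZ -/rho -/Y => H.
  rewrite -fnorm_sq; have := fnorm_ge0 u; have T0 := normr_ge0 t.
  rewrite -[t ^+ 2]real_normK ?num_real//.
  have P0 : 0 <= `|t| * rho by rewrite mulr_ge0.
  set F := fnorm u in H *; move: H P0; rewrite -mulrA -[rho ^+ 2 * _]exprMn [rho * `|t|]mulrC.
  set P := `|t| * rho => H P0 F0.
  have : F ^+ 2 <= (P + Y) ^+ 2 by rewrite ler_sqr ?nnegrE ?addr_ge0.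
  have := sqr_ge0 (P - Y); rewrite sqrrB sqrrD; lra.
have Hc : c * sqnorm u <= t ^+ 2 * g / 2 + Y ^+ 2.
  rewrite /c mulrC ler_pdivrMr; last by rewrite -invr_gt0.
  apply: le_trans Hu _.
  have -> : (t ^+ 2 * g / 2 + Y ^+ 2) * (4 * rho ^+ 2 / g + 2) =
     2 * rho ^+ 2 * t ^+ 2 + 2 * Y ^+ 2 + (g * t ^+ 2 + 4 * rho ^+ 2 / g * Y ^+ 2).
    by field; rewrite gt_eqF.
  rewrite lerDl addr_ge0//; first by rewrite mulr_ge0 ?sqr_ge0// ltW.
  by rewrite mulr_ge0 ?sqr_ge0// divr_ge0 ?(ltW g0)// mulr_ge0 ?sqr_ge0.
by lra.
Qed.

End SpectralAlgebra.

(** * Continuity of the spectrum *)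

Section SpectrumContinuity.
Variables (R : realType) (n' : nat).
Local Notation n := n'.+1.

Lemma spec_list_bound (A : 'M[R]_n) s x : spec_list A s -> x \in s -> `|x| <= n%:R * `|A|.
Proof.
move=> [_ Es] xs; have : root (char_poly A) x by rewrite Es root_prod_XsubC.
rewrite -eigenvalue_root_char => /eigenvalueP[v vA v0].
have nv : 0 < `|v| by rewrite normr_gt0.
rewrite -(ler_pM2r nv) -normrZ -vA; apply: mx_norm_le => [|i j].
  by rewrite !mulr_ge0.
rewrite mxE (le_trans (ler_norm_sum _ _ _))//.
apply: le_trans (_ : \sum_(k < n) `|v| * `|A| <= _).
  by apply: ler_sum => k _; rewrite normrM ler_pM// mx_entry_le.
by rewrite sumr_const card_ord -[X in X <= _]mulr_natl mulrA mulrAC.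
Qed.

Lemma char_poly_eval (A : 'M[R]_n) x : (char_poly A).[x] = \det (x%:M - A).
Proof.
rewrite -horner_evalE -det_map_mx; congr (\det _); apply/matrixP => i j.
by rewrite !mxE /= rmorphB rmorphMn /= /horner_eval hornerX !hornerC.
Qed.

Lemma cvg_prod_real (T : Type) (F : set_system T) (FF : Filter F) (I : Type) (r : seq I)
    (P : pred I) (f : I -> T -> R) (a : I -> R) :
  (forall i, P i -> f i x @[x --> F] --> a i) ->
  \prod_(i <- r | P i) f i x @[x --> F] --> \prod_(i <- r | P i) a i.
Proof.
move=> H; elim: r => [|i r IH].
  by rewrite big_nil; under eq_fun do rewrite big_nil; exact: cvg_cst.
rewrite big_cons; under eq_fun do rewrite big_cons.
by case: ifPn => [Pi|_] //; apply: cvgM => //; exact: H.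
Qed.

Lemma cvg_det (T : Type) (F : set_system T) (FF : Filter F) p (M : T -> 'M[R]_p) (M0 : 'M[R]_p) :
  (forall i j, M t i j @[t --> F] --> M0 i j) -> \det (M t) @[t --> F] --> \det M0.
Proof.
move=> H; rewrite /determinant; apply: cvg_sum_real => s _.
by apply: cvgM; [exact: cvg_cst|apply: cvg_prod_real => i _].
Qed.

Lemma poly_eq_eval (p q : {poly R}) : (forall x, p.[x] = q.[x]) -> p = q.
Proof.
move=> H; apply/eqP; rewrite -subr_eq0; apply/eqP.
apply: (@roots_geq_poly_eq0 _ _ [seq i%:R | i <- iota 0 (size (p - q))]).
- by apply/allP => x _; rewrite /root hornerD hornerN H subrr.
- rewrite map_inj_uniq ?iota_uniq// => i j /eqP; by rewrite eqr_nat => /eqP.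
- by rewrite size_map size_iota.
Qed.

Lemma fmap_ultra (T T' : Type) (U : set_system T) (f : T -> T') :
  UltraFilter U -> UltraFilter (f @ U).
Proof.
move=> UU; have PU : ProperFilter U by exact: ultra_proper.
constructor => [|G PG UG]; first exact: fmap_proper_filter.
apply/seteqP; split=> [A GA|]; last exact: UG.
have [//|UC] := in_ultra_setVsetC (f @^-1` A) UU.
have [y []//] := @filter_ex _ _ PG _ (filterI GA (UG (~` A) UC)).
Qed.

(* Roots stay bounded, so they converge along any ultrafilter; the limit list is the sorted root list. *)
Lemma spec_list_cvg (T : Type) (F : set_system T) (FF : Filter F)
    (M : T -> 'M[R]_n) (M0 : 'M[R]_n) (s : T -> seq R) (s0 : seq R) :
  (forall i j, M t i j @[t --> F] --> M0 i j) ->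
  (\forall t \near F, spec_list (M t) (s t)) -> spec_list M0 s0 ->
  forall i, (i < n)%N -> (s t)`_i @[t --> F] --> s0`_i.
Proof.
move=> cM Hs H0 i ni; apply/cvgrPdist_lt => e e0; apply: contrapT => nbad.
pose bad := [set t | e <= `|s0`_i - (s t)`_i|].
(* If convergence failed, [F] restricted to the bad set would be proper and contained in an
   ultrafilter. Along it all roots converge, to the sorted roots of [M0], which the bad set
   forbids. *)
have PW : ProperFilter (within bad F).
  apply: Build_ProperFilter_ex => B WB; apply: contrapT => nB; apply: nbad.
  have {}WB : \forall t \near F, bad t -> B t := WB.
  apply: filterS WB => t Bt; rewrite ltNge; apply/negP => bt.
  by apply: nB; exists t; exact: Bt.
have [U [UU FU]] := ultraFilterLemma PW.
have UF : F `<=` U by move=> B FB; apply: FU; apply: filterS FB => t.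
have wb : within bad F bad := @filterE _ F FF (fun t => bad t -> bad t) (fun t b => b).
have Ubad : U bad by exact: FU wb.
have PU : ProperFilter U by exact: ultra_proper.
have near1 : \forall t \near F, `|M t| <= `|M0| + 1.
  have : \forall t \near F, forall ij : 'I_n * 'I_n, `|M0 ij.1 ij.2 - M t ij.1 ij.2| <= 1.
    apply: (@filter_forall _ _ (fun ij t => `|M0 ij.1 ij.2 - M t ij.1 ij.2| <= 1) F FF) => ij.
    by have /cvgrPdist_le/(_ _ ltr01) := cM ij.1 ij.2.
  apply: filterS => t Ht; apply: mx_norm_le => [|k j]; first by rewrite addr_ge0.
  rewrite -[M t k j](subKr (M0 k j)) (le_trans (ler_normB _ _))// lerD ?mx_entry_le//.
  exact: (Ht (k, j)).
pose C := n%:R * (`|M0| + 1).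
have lim_ex (j : nat) : exists y : R, (j < n)%N -> (s t)`_j @[t --> U] --> y.
  have [jn|] := boolP (j < n)%N; last by exists 0.
  have UA : U [set t | `[- C, C]%classic ((s t)`_j)].
    apply: UF; apply: filterS2 Hs near1 => t Hst Mt /=; rewrite in_itv/= -ler_norml.
    apply: (le_trans (spec_list_bound Hst _)); first by rewrite mem_nth// (spec_list_size Hst).
    by rewrite ler_wpM2l.
  have := @segment_compact R (- C) C; rewrite compact_ultra.
  move=> /(_ ((fun t => (s t)`_j) @ U)) cpt.
  have [|y [_ yl]] := cpt _ UA; last by exists y.
  exact: fmap_ultra.
have [tau Htau] := choice lim_ex.
have Hdet x : \det (x%:M - M t) @[t --> U] --> \det (x%:M - M0).
  apply: cvg_det => k j; rewrite !mxE; under eq_fun do rewrite !mxE.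
  by apply: cvgB; [exact: cvg_cst|move=> B /cM /UF].
have Eeval x : \prod_(j < n) (x - tau j) = (char_poly M0).[x].
  have L : \prod_(j < n) (x - (s t)`_j) @[t --> U] --> \prod_(j < n) (x - tau j).
    by apply: cvg_prod_real => j _; apply: cvgB; [exact: cvg_cst|exact: Htau].
  rewrite char_poly_eval.
  apply: (cvg_unique _ L) => //.
  apply: cvg_trans (Hdet x); apply: near_eq_cvg; apply: UF; apply: filterS Hs => t Hst.
  rewrite -char_poly_eval; have [_ ->] := Hst; rewrite horner_prod.
  rewrite (big_nth 0) (spec_list_size Hst) big_mkord.
  by apply: eq_bigr => j _; rewrite hornerXsubC.
(* Equal values at all points identify the polynomials, hence the limits with their multiplicities;
   the order passes to the limit. *)
have Htl : spec_list M0 (mkseq tau n).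
  split; last first.
    apply: poly_eq_eval => x; rewrite -Eeval horner_prod [RHS](big_nth 0) size_mkseq big_mkord.
    by apply: eq_bigr => j _; rewrite nth_mkseq// hornerXsubC.
  apply/(sortedP 0) => j; rewrite size_mkseq => jn; rewrite !nth_mkseq ?(ltnW jn)//.
  have le2 : \forall t \near U, (s t)`_j <= (s t)`_j.+1.
    apply: UF; apply: filterS Hs => t Hst; have [/(sortedP 0) so _] := Hst.
    by apply: so; rewrite (spec_list_size Hst).
  have A1 := Htau _ (ltnW jn); have A2 := Htau _ jn.
  rewrite leNgt; apply/negP => lt; pose d := (tau j - tau j.+1) / 2.
  have d0 : 0 < d by rewrite divr_gt0// subr_gt0.
  move/cvgrPdist_lt/(_ _ d0) : A1 => A1; move/cvgrPdist_lt/(_ _ d0) : A2 => A2.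
  have [t [/= [/= h1 h2] h3]] := @filter_ex _ _ PU _ (filterI (filterI A1 A2) le2).
  by move: h1 h2 h3; rewrite /d !ltr_norml => /andP[? ?] /andP[? ?] ?; lra.
have Ei : tau i = s0`_i by rewrite (spec_list_uniq H0 Htl) nth_mkseq.
have := Htau i ni; rewrite Ei => /cvgrPdist_lt/(_ _ e0) Ugood.
have [t [/= b g]] := @filter_ex _ _ PU _ (filterI Ubad Ugood).
by move: (le_lt_trans b g); rewrite ltxx.
Qed.

Lemma spec_list_det (A : 'M[R]_n) s : spec_list A s -> (forall i, (i < n)%N -> s`_i != 0) ->
  A \in unitmx.
Proof.
move=> Hs H; rewrite unitmxE unitfE; apply/negP => /eqP d0.
have : (char_poly A).[0] = 0.
  by rewrite char_poly_eval raddf0 sub0r -scaleN1r detZ d0 mulr0.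
have [_ ->] := Hs; rewrite horner_prod => /eqP; rewrite prodf_seq_eq0 => /hasP[x xs /=].
rewrite hornerXsubC sub0r oppr_eq0 => /eqP x0.
by have := H (index x s); rewrite -(spec_list_size Hs) index_mem xs nth_index// x0 eqxx => /(_ isT).
Qed.

End SpectrumContinuity.

(** * The Lyapunov function *)

Section MatrixDerivative.
Variable R : realType.

Lemma oppmxE m p (X : 'M[R]_(m, p)) i j : (- X) i j = - X i j.
Proof. by rewrite mxE. Qed.

Definition mx_derive m p (x : R) (F : R -> 'M[R]_(m, p)) (dF : 'M[R]_(m, p)) :=
  forall i j, is_derive x 1 (fun y => F y i j) (dF i j).

Lemma is_derive_big_sum (I : Type) (r : seq I) (P : pred I) (f : I -> R -> R) (df : I -> R) (x : R) :
  (forall i, P i -> is_derive x 1 (f i) (df i)) ->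
  is_derive x 1 (fun y => \sum_(i <- r | P i) f i y) (\sum_(i <- r | P i) df i).
Proof.
move=> H; elim: r => [|i r IH].
  by rewrite big_nil; under eq_fun do rewrite big_nil; exact: is_derive_cst.
have [Pi|nPi] := boolP (P i); last first.
  by rewrite big_cons (negbTE nPi); under eq_fun do rewrite big_cons (negbTE nPi).
rewrite big_cons Pi; under eq_fun do rewrite big_cons Pi.
exact: is_deriveD (H i Pi) IH.
Qed.

Lemma is_derive_mulR (f g : R -> R) (x df dg : R) : is_derive x 1 f df ->
  is_derive x 1 g dg -> is_derive x 1 (fun y => f y * g y) (df * g x + f x * dg).
Proof.
move=> Df Dg; have := is_deriveM Df Dg; rewrite -![GRing.scale _ _]/(_ * _).
by rewrite addrC [g x * _]mulrC.
Qed.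

Lemma mx_derive_mul m p q x (F : R -> 'M[R]_(m, p)) (G : R -> 'M[R]_(p, q)) dF dG :
  mx_derive x F dF -> mx_derive x G dG ->
  mx_derive x (fun y => F y *m G y) (dF *m G x + F x *m dG).
Proof.
move=> DF DG i j; rewrite !mxE -big_split /=; under eq_fun do rewrite mxE.
by apply: is_derive_big_sum => k _; apply: is_derive_mulR.
Qed.

Lemma mx_derive_cst m p x (M : 'M[R]_(m, p)) : mx_derive x (fun=> M) 0.
Proof. by move=> i j; rewrite mxE; exact: is_derive_cst. Qed.

Lemma mx_deriveD m p x (F G : R -> 'M[R]_(m, p)) dF dG :
  mx_derive x F dF -> mx_derive x G dG -> mx_derive x (fun y => F y + G y) (dF + dG).
Proof. by move=> DF DG i j; rewrite mxE; under eq_fun do rewrite mxE; exact: is_deriveD. Qed.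

Lemma mx_deriveN m p x (F : R -> 'M[R]_(m, p)) dF :
  mx_derive x F dF -> mx_derive x (fun y => - F y) (- dF).
Proof. by move=> DF i j; rewrite mxE; under eq_fun do rewrite mxE; exact: is_deriveN. Qed.

Lemma mx_derive_tr m p x (F : R -> 'M[R]_(m, p)) dF :
  mx_derive x F dF -> mx_derive x (fun y => (F y)^T) dF^T.
Proof. by move=> DF i j; rewrite mxE; under eq_fun do rewrite mxE. Qed.

Lemma mx_derive_scale m p (x : R) (f : R -> R) (F : R -> 'M[R]_(m, p)) (df : R) dF :
  is_derive x 1 f df -> mx_derive x F dF ->
  mx_derive x (fun y => f y *: F y) (df *: F x + f x *: dF).
Proof.
move=> Df DF i j; rewrite !mxE; under eq_fun do rewrite mxE.
exact: is_derive_mulR.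
Qed.

Lemma mx_derive_trace m x (F : R -> 'M[R]_m) dF :
  mx_derive x F dF -> is_derive x 1 (fun y => \tr (F y)) (\tr dF).
Proof. by move=> DF; apply: is_derive_big_sum => i _; exact: DF. Qed.

Lemma mx_derive_uniq m p x (F : R -> 'M[R]_(m, p)) dF dG :
  mx_derive x F dF -> mx_derive x F dG -> dF = dG.
Proof.
move=> DF DG; apply/matrixP => i j; have D1 := DF i j; have D2 := DG i j.
by rewrite -(@derive_val _ _ _ _ _ _ _ D1) (@derive_val _ _ _ _ _ _ _ D2).
Qed.

Lemma mx_derive_ext m p x (F G : R -> 'M[R]_(m, p)) dF :
  F =1 G -> mx_derive x F dF -> mx_derive x G dF.
Proof. by move=> /funext ->. Qed.

End MatrixDerivative.

(* [w u q s be] are the norms of [W u q s] and [B u]; [X_i], [Y_i], [Z_i] are the quadratic forms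
   in the derivatives of [Psi0], [Psi1], [Psi2]. *)
Lemma dissipation_scalar (R : realFieldType) (a v h e Cz Ck dl m N k w u q s be X0 X1 X2 X3 Y0 Y1 Y2 Z0 Z1 Z2 : R) :
  0 <= a -> 0 <= v <= dl -> 0 < h -> 0 < e -> 0 < k -> 0 < m ->
  dl <= 2^-1 -> m * N <= 4^-1 -> 0 <= m * Ck <= e -> m * Ck ^+ 2 <= k / 2 ->
  dl * Cz ^+ 2 / (2 * h) <= 4^-1 -> dl <= m * k / 4 ->
  0 <= w -> 0 <= u -> 0 <= q -> 0 <= s -> 0 <= be ->
  e * w ^+ 2 <= X0 -> h * w ^+ 2 <= X1 -> X2 <= Cz * (w * s) -> X3 <= dl * (u * s) ->
  e * u ^+ 2 <= Y0 -> `|Y1| <= be * s -> Y2 <= dl * u ^+ 2 ->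
  `|Z0| <= Ck * (u * w) -> k * u ^+ 2 <= Z1 + N * be ^+ 2 -> `|Z2| <= Ck * (u * q) ->
  (- a * X0 - v / 2 * X1 - s ^+ 2 - q ^+ 2 + v * X2 + X3)
  + 2^-1 * (- a * Y0 - be ^+ 2 - Y1 + Y2) + m * (- a * Z0 - Z1 - Z2)
  <= - (m * k / 2 * u ^+ 2 + 2^-1 * q ^+ 2 + 4^-1 * s ^+ 2).
Proof.
move=> a0 /andP[v0 vd] h0 e0 k0 m0 d2 mN /andP[mC0 mCe] mC2 dz dk w0 u0 q0 s0 be0
  X0e X1h X2C X3d Y0e Y1b Y2d Z0C Z1k Z2C.
(* The budget: [X2], [X3] and [Y1] each take s^2 / 4 out of s^2; [Y1] and [Z1] each take be^2 / 4
   out of be^2 / 2; [Z2] takes half of q^2. Out of m k u^2, a quarter goes to [Z2] and at most a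
   quarter to the two terms of size dl u^2 / 2. The terms in [a] are jointly nonnegative because m
   Ck <= e. *)
have d0 : 0 <= dl by exact: le_trans vd.
have Ha : 0 <= a * (X0 + 2^-1 * Y0 + m * Z0).
  apply: mulr_ge0 => //.
  have Zl : - (m * Ck * (u * w)) <= m * Z0.
    by rewrite -mulrA -mulrN ler_pM2l// lerNl; apply: le_trans Z0C; rewrite -normrN ler_norm.
  have Zm : m * Ck * (u * w) <= e * (u * w) by rewrite ler_wpM2r// mulr_ge0.
  have : 0 <= e * (w ^+ 2 + 2^-1 * u ^+ 2 - u * w).
    apply: mulr_ge0; first exact: ltW.
    have -> : w ^+ 2 + 2^-1 * u ^+ 2 - u * w = (w - u / 2) ^+ 2 + (u / 2) ^+ 2 by field.
    by rewrite addr_ge0 ?sqr_ge0.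
  by lra.
have Hv : v * X2 <= v / 2 * X1 + 4^-1 * s ^+ 2.
  have v1 : v * X2 <= v * (Cz * (w * s)) by rewrite ler_wpM2l.
  have v2 : v / 2 * (h * w ^+ 2) <= v / 2 * X1 by rewrite ler_wpM2l// divr_ge0.
  have v3 : v * Cz ^+ 2 / (2 * h) * s ^+ 2 <= 4^-1 * s ^+ 2.
    rewrite ler_wpM2r ?sqr_ge0//; apply: le_trans dz; rewrite -!(mulrA _ (Cz ^+ 2)) ler_wpM2r//.
    by rewrite mulr_ge0 ?sqr_ge0// invr_ge0 mulr_ge0// ltW.
  have : 0 <= v / (2 * h) * (h * w - Cz * s) ^+ 2.
    by rewrite mulr_ge0 ?sqr_ge0// divr_ge0// mulr_ge0// ltW.
  have -> : v / (2 * h) * (h * w - Cz * s) ^+ 2 = v / 2 * (h * w ^+ 2) - v * (Cz * (w * s))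
     + v * Cz ^+ 2 / (2 * h) * s ^+ 2 by field; rewrite gt_eqF.
  by lra.
have HX3 : X3 <= dl / 2 * u ^+ 2 + 4^-1 * s ^+ 2.
  have d1 : dl / 2 * s ^+ 2 <= 4^-1 * s ^+ 2 by rewrite ler_wpM2r ?sqr_ge0//; lra.
  have : 0 <= dl / 2 * (u - s) ^+ 2 by rewrite mulr_ge0 ?sqr_ge0// divr_ge0.
  have -> : dl / 2 * (u - s) ^+ 2 = dl / 2 * u ^+ 2 - dl * (u * s) + dl / 2 * s ^+ 2 by field.
  by lra.
have HY1 : - Y1 <= 2^-1 * be ^+ 2 + 2^-1 * s ^+ 2.
  have y1 : - Y1 <= be * s by apply: le_trans Y1b; rewrite -normrN ler_norm.
  have : 0 <= 2^-1 * (be - s) ^+ 2 by rewrite mulr_ge0 ?sqr_ge0.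
  have -> : 2^-1 * (be - s) ^+ 2 = 2^-1 * be ^+ 2 - be * s + 2^-1 * s ^+ 2 by field.
  by lra.
have HZ1 : - (m * Z1) <= 4^-1 * be ^+ 2 - m * k * u ^+ 2.
  have n1 : m * N * be ^+ 2 <= 4^-1 * be ^+ 2 by rewrite ler_wpM2r ?sqr_ge0.
  have : m * (k * u ^+ 2) <= m * (Z1 + N * be ^+ 2) by rewrite ler_wpM2l// ltW.
  by rewrite mulrDr; lra.
have HZ2 : - (m * Z2) <= 2^-1 * q ^+ 2 + m * k / 4 * u ^+ 2.
  have z1 : - (m * Z2) <= m * (Ck * (u * q)).
    by rewrite -mulrN ler_wpM2l ?(ltW m0)//; apply: le_trans Z2C; rewrite -normrN ler_norm.
  have z2 : m * (m * Ck ^+ 2) / 2 * u ^+ 2 <= m * (k / 2) / 2 * u ^+ 2.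
    by rewrite ler_wpM2r ?sqr_ge0// ler_wpM2r// ler_wpM2l// ltW.
  have : 0 <= 2^-1 * (q - m * Ck * u) ^+ 2 by rewrite mulr_ge0 ?sqr_ge0.
  have -> : 2^-1 * (q - m * Ck * u) ^+ 2 = 2^-1 * q ^+ 2 - m * (Ck * (u * q)) +
    m * (m * Ck ^+ 2) / 2 * u ^+ 2 by field.
  by lra.
have du : dl * u ^+ 2 <= m * k / 4 * u ^+ 2 by rewrite ler_wpM2r ?sqr_ge0.
by lra.
Qed.

Section Lyapunov.
Variables (R : realType) (n' : nat).
Local Notation n := n'.+1.

(* Complex vectors are stored as real [n x 2] matrices [Re | Im]; multiplication by
   [a + i b] is right multiplication by [lam a b]. *)
Definition Jmx : 'M[R]_2 := \matrix_(i, j) (if i == j then 0 else if i == 0 then 1 else - 1).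
Definition lam (a b : R) : 'M[R]_2 := a%:M + b *: Jmx.

Lemma Jmx_tr : Jmx^T = - Jmx.
Proof.
apply/matrixP => i j; rewrite !mxE eq_sym; case: (eqVneq i j) => [|ij]; first by rewrite oppr0.
by move: i j ij => [[|[|//]] ?] [[|[|//]] ?] //= _; rewrite ?opprK.
Qed.

Lemma Jmx_unitary : Jmx *m Jmx^T = 1%:M.
Proof.
rewrite Jmx_tr; apply/matrixP => i j; rewrite !mxE !big_ord_recl big_ord0 !mxE.
by move: i j => [[|[|//]] ?] [[|[|//]] ?] /=; rewrite ?(mulr0, mul0r, oppr0, addr0, add0r, mulrNN, mulr1, mul1r, opprK).
Qed.

Lemma trace_sym_J (M : 'M[R]_2) : M^T = M -> \tr (M *m Jmx) = 0.
Proof.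
move=> sM; have : \tr (M *m Jmx) = - \tr (M *m Jmx).
  by rewrite -[LHS]mxtrace_tr trmx_mul Jmx_tr sM mulNmx raddfN /= mxtrace_mulC.
by move=> /eqP; rewrite -addr_eq0 -mulr2n mulrn_eq0 => /eqP.
Qed.

Variables (A S : R -> 'M[R]_n) (B : R -> 'rV[R]_n) (Ah Sh : R -> 'M[R]_n) (Bh : R -> 'rV[R]_n).
Variables (al v : R -> R) (L : 'cV[R]_n) (M : R) (K : 'M[R]_n) (a b : R).
Variables (W u : R -> 'M[R]_(n, 2)) (q s : R -> 'rV[R]_2).

Hypothesis dA : forall x, mx_derive x A (v x *: Ah x).
Hypothesis dS : forall x, mx_derive x S (v x *: Sh x).
Hypothesis dB : forall x, mx_derive x B (v x *: Bh x).
Hypothesis dal : forall x : R, is_derive x 1 al (- v x).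
Hypothesis symS : forall x, (S x)^T = S x.
Hypothesis symSA : forall x, (S x *m A x)^T = S x *m A x.
Hypothesis SL : forall x, S x *m L = (B x)^T.
Hypothesis skewK : K^T = - K.
Hypothesis dW : forall x, mx_derive x W (u x).
Hypothesis dq : forall x, mx_derive x q (s x + B x *m u x).
Hypothesis ds : forall x, mx_derive x s (q x).
Hypothesis eq1 : forall x, W x *m lam a b + A x *m u x + L *m q x = 0.

(* The correction [M al A] uses that [al] vanishes at the sonic point while [al_x = - v] does not:
   differentiating it yields the Finsler term [M v (A0 A A)] in [Hmx]. *)
Definition Emx x := S x + (M * al x) *: (S x *m A x).
Definition Hmx x := - (Sh x *m A x + S x *m Ah x) + M *: (S x *m A x *m A x)
  - (M * al x) *: (Sh x *m A x *m A x + S x *m Ah x *m A x + S x *m A x *m Ah x).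
(** Derivative, divided by [v], of the row B + M al B A that couples [W] to [s] in [Psi0]. In the
    same normalization (E A)_x = - v H, with E and H standing for [Emx] and [Hmx]. *)
Definition Zmx x : 'rV[R]_n := Bh x - M *: (B x *m A x)
  + (M * al x) *: (Bh x *m A x + B x *m Ah x).

(** Since q = s_x, the second term trades the coupling of W with q for one of u with s. The third
    cancels the main part (B u) s of the latter and produces - |q|^2 - |s|^2. *)
Definition Psi0 x := 2^-1 * \tr ((W x)^T *m (Emx x *m A x) *m W x)
  + \tr ((W x)^T *m (B x + (M * al x) *: (B x *m A x))^T *m s x) - \tr ((q x)^T *m s x).
Definition Psi1 x := 2^-1 * \tr ((u x)^T *m (S x *m A x) *m u x).
Definition Psi2 x := b / 2 * \tr ((W x)^T *m K *m W x *m Jmx).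

Lemma SA_comm x : S x *m A x = (A x)^T *m S x.
Proof. by rewrite -[LHS]symSA trmx_mul symS. Qed.

Lemma Emx_sym x : (Emx x)^T = Emx x.
Proof. by rewrite linearD linearZ /= symS symSA. Qed.

Lemma EmxA_sym x : (Emx x *m A x)^T = Emx x *m A x.
Proof.
rewrite /Emx mulmxDl -scalemxAl linearD linearZ /= symSA; congr (_ + _ *: _).
by rewrite trmx_mul symSA mulmxA -SA_comm.
Qed.

Lemma Emx_L x : Emx x *m L = (B x + (M * al x) *: (B x *m A x))^T.
Proof.
rewrite /Emx mulmxDl -scalemxAl SL linearD linearZ /= trmx_mul; congr (_ + _ *: _).
by rewrite SA_comm -mulmxA SL.
Qed.

(** A symmetric real form pairs X with i X in zero real part, so only the real part of the
    eigenvalue enters the energies. *)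
Lemma trace_lam (P : 'M[R]_n) (X : 'M[R]_(n, 2)) : P^T = P ->
  \tr (X^T *m P *m X *m lam a b) = a * \tr (X^T *m P *m X).
Proof.
move=> sP; rewrite mulmxDr mul_mx_scalar -scalemxAr mxtraceD !mxtraceZ.
by rewrite trace_sym_J ?mulr0 ?addr0// !trmx_mul trmxK sP mulmxA.
Qed.

Lemma is_derive_Psi0 (x : R) : is_derive x 1 Psi0
  (- a * \tr ((W x)^T *m Emx x *m W x) - v x / 2 * \tr ((W x)^T *m Hmx x *m W x)
   - sqnorm (s x) - sqnorm (q x) + v x * \tr ((W x)^T *m (Zmx x)^T *m s x)
   + M * al x * \tr ((u x)^T *m (B x *m A x)^T *m s x)).
Proof.
have dMal : is_derive x 1 (fun y => M * al y) (M * - v x) by exact: is_derive1Ml.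
have dE : mx_derive x Emx (v x *: Sh x + (- (M * v x)) *: (S x *m A x)
    + (M * al x) *: (v x *: (Sh x *m A x + S x *m Ah x))).
  have := mx_deriveD (dS x) (mx_derive_scale dMal (mx_derive_mul (dS x) (dA x))).
  congr mx_derive; rewrite -?scalemxAl -?scalemxAr; apply/matrixP => i j.
  by rewrite !(addmxE, oppmxE, scalemxE); ring.
have dC : mx_derive x (fun y => B y + (M * al y) *: (B y *m A y)) (v x *: Zmx x).
  have := mx_deriveD (dB x) (mx_derive_scale dMal (mx_derive_mul (dB x) (dA x))).
  congr mx_derive; rewrite /Zmx -?scalemxAl -?scalemxAr; apply/matrixP => i j.
  by rewrite !(addmxE, oppmxE, scalemxE); ring.
set C := (fun y => _) in dC.
have D1 := mx_derive_trace (mx_derive_mul (mx_derive_mul (mx_derive_tr (dW x)) (mx_derive_mul dE (dA x))) (dW x)).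
have D2 := mx_derive_trace (mx_derive_mul (mx_derive_mul (mx_derive_tr (dW x)) (mx_derive_tr dC)) (ds x)).
have D3 := mx_derive_trace (mx_derive_mul (mx_derive_tr (dq x)) (ds x)).
have := is_deriveB (is_deriveD (is_derive1Ml 2^-1 D1) D2) D3.
move=> D; apply: (is_derive_eq D) => {D D1 D2 D3}.
have EH : (v x *: Sh x + (- (M * v x)) *: (S x *m A x)
    + (M * al x) *: (v x *: (Sh x *m A x + S x *m Ah x))) *m A x + Emx x *m (v x *: Ah x)
    = - v x *: Hmx x.
  rewrite /Hmx /Emx !mulmxDl -?scalemxAl -?scalemxAr !mulmxDl -?scalemxAl ?mulmxDl.
  by apply/matrixP => i j; rewrite !(addmxE, oppmxE, scalemxE); ring.
have EAu : \tr ((W x)^T *m (Emx x *m A x) *m u x) =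
    - a * \tr ((W x)^T *m Emx x *m W x) - \tr ((W x)^T *m (C x)^T *m q x).
  have Au : A x *m u x = - (W x *m lam a b + L *m q x).
    by apply/eqP; rewrite -addr_eq0 addrA [A x *m u x + _]addrC eq1.
  rewrite -!mulmxA Au !mulmxN raddfN /= (mulmxDr (Emx x)) (mulmxDr (W x)^T) mxtraceD opprD.
  have T1 : \tr ((W x)^T *m (Emx x *m (W x *m lam a b))) = a * \tr ((W x)^T *m (Emx x *m W x)).
    by rewrite 2!mulmxA trace_lam ?Emx_sym// mulmxA.
  by rewrite T1 mulNr [Emx x *m (L *m _)]mulmxA Emx_L.
have uW : \tr ((u x)^T *m (Emx x *m A x) *m W x) = \tr ((W x)^T *m (Emx x *m A x) *m u x).
  by rewrite -[LHS]mxtrace_tr !trmx_mul trmxK -trmx_mul EmxA_sym mulmxA.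
have CE : \tr ((u x)^T *m (C x)^T *m s x) = \tr ((u x)^T *m (B x)^T *m s x)
    + M * al x * \tr ((u x)^T *m (B x *m A x)^T *m s x).
  by rewrite /C linearD linearZ /= mulmxDr mulmxDl mxtraceD -scalemxAr -scalemxAl mxtraceZ.
have sBu : (s x + B x *m u x)^T = (s x)^T + (u x)^T *m (B x)^T by rewrite linearD /= trmx_mul.
have vZ : (v x *: Zmx x)^T = v x *: (Zmx x)^T by rewrite linearZ.
cbv beta; rewrite EH sBu vZ; clear - EAu uW CE; move: EAu uW CE; clearbody C.
have -> : sqnorm (s x) = \tr ((s x)^T *m s x) by [].
have -> : sqnorm (q x) = \tr ((q x)^T *m q x) by [].
move: (C x) (Emx x) (Hmx x) (Zmx x) (A x) (B x) (al x) (v x) (W x) (u x) (s x) (q x).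
move=> Cx E H Z A' B' al' v' W' u' s' q' EAu uW CE.
rewrite !mulmxDl !mxtraceD -!scalemxAr -!scalemxAl !mxtraceZ uW EAu CE.
by field.
Qed.

(** The eigenvalue equation is differentiated here, which requires a classical derivative of [u].
    Its term L q_x = L (s + B u) gives |B u|^2 because S L = B^T. *)
Lemma is_derive_Psi1 (x : R) du : mx_derive x u du -> is_derive x 1 Psi1
  (- a * \tr ((u x)^T *m S x *m u x) - sqnorm (B x *m u x) - \tr ((B x *m u x)^T *m s x)
   + v x * \tr ((u x)^T *m (2^-1 *: (Sh x *m A x - S x *m Ah x)) *m u x)).
Proof.
move=> Du.
have D1 := mx_derive_trace (mx_derive_mul (mx_derive_mul (mx_derive_tr Du) (mx_derive_mul (dS x) (dA x))) Du).
apply: (is_derive_eq (is_derive1Ml 2^-1 D1)) => {D1}.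
have Adu : A x *m du = - (u x *m lam a b + v x *: (Ah x *m u x) + L *m (s x + B x *m u x)).
  have D := mx_deriveD (mx_deriveD (mx_derive_mul (dW x) (mx_derive_cst x (lam a b)))
    (mx_derive_mul (dA x) Du)) (mx_derive_mul (mx_derive_cst x L) (dq x)).
  have D0 := mx_derive_ext (fun y => esym (eq1 y)) (mx_derive_cst x 0).
  have := mx_derive_uniq D D0; rewrite mulmx0 addr0 mul0mx add0r -scalemxAl.
  move=> E; apply/eqP; rewrite -addr_eq0 -E; apply/eqP.
  by move: (A x *m du) (u x *m _) (v x *: _) (L *m _) => P1 P2 P3 P4; apply/matrixP => i j; rewrite !addmxE; ring.
have uSA : \tr (du^T *m (S x *m A x) *m u x) = \tr ((u x)^T *m (S x *m A x) *m du).
  by rewrite -[LHS]mxtrace_tr !trmx_mul trmxK -trmx_mul symSA mulmxA.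
have E1 : \tr ((u x)^T *m (S x *m A x) *m du) = - a * \tr ((u x)^T *m S x *m u x)
    - v x * \tr ((u x)^T *m (S x *m Ah x) *m u x) - sqnorm (B x *m u x)
    - \tr ((B x *m u x)^T *m s x).
  rewrite -!mulmxA Adu !mulmxN raddfN /= !(mulmxDr (S x)) !(mulmxDr (u x)^T) !mxtraceD.
  have T1 : \tr ((u x)^T *m (S x *m (u x *m lam a b))) = a * \tr ((u x)^T *m (S x *m u x)).
    by rewrite 2!mulmxA trace_lam ?symS// mulmxA.
  have T2 : (S x *m (L *m (s x + B x *m u x))) = (B x)^T *m (s x + B x *m u x).
    by rewrite mulmxA SL.
  rewrite T1 T2 -!scalemxAr mxtraceZ mulmxDr mulmxDr mxtraceD.
  rewrite /sqnorm trmx_mul !mulmxA; ring.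
rewrite !mulmxDl !mulmxDr !mulmxDl !mxtraceD uSA E1 -?scalemxAr -?scalemxAl -?scalemxAr -?scalemxAl !mxtraceZ.
rewrite mulmxBr mulmxBl raddfB /= -!mulmxA; by field.
Qed.

(** Paired with u^T K, the integrated equation contains b tr(u^T K W J), an exact derivative because
    [K] and [Jmx] are both skew. The compensator thus acts one derivative lower than usual and never
    differentiates [u]. *)
Lemma is_derive_Psi2 (x : R) : is_derive x 1 Psi2
  (- a * \tr ((u x)^T *m K *m W x) - \tr ((u x)^T *m (K *m A x) *m u x)
   - \tr ((u x)^T *m (K *m L) *m q x)).
Proof.
have D1 := mx_derive_trace (mx_derive_mul (mx_derive_mul (mx_derive_mul (mx_derive_tr (dW x))
  (mx_derive_cst x K)) (dW x)) (mx_derive_cst x Jmx)).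
apply: (is_derive_eq (is_derive1Ml (b / 2) D1)) => {D1}.
have uWJ : \tr ((W x)^T *m K *m u x *m Jmx) = \tr ((u x)^T *m K *m W x *m Jmx).
  rewrite -[LHS]mxtrace_tr !trmx_mul trmxK Jmx_tr skewK ?(mulNmx, mulmxN, opprK).
  by rewrite mxtrace_mulC -!mulmxA.
rewrite !mulmx0 !addr0 mulmxDl mxtraceD uWJ.
have := congr1 (fun X => \tr ((u x)^T *m K *m X)) (eq1 x).
rewrite mulmx0 mxtrace0 (mulmxDr ((u x)^T *m K)) (mulmxDr ((u x)^T *m K)) !mxtraceD.
rewrite [(u x)^T *m K *m (W x *m _)]mulmxA /lam mulmxDr mul_mx_scalar -scalemxAr mxtraceD !mxtraceZ.
rewrite !mulmxA => E; apply/eqP; rewrite -subr_eq0 -E; apply/eqP; by field.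
Qed.


Definition Psi m x := Psi0 x + 2^-1 * Psi1 x + m * Psi2 x.

(** Purely numerical constraints, kept apart from the bounds on the coefficients so that the
    constants are fixed before any profile is given. *)
Definition dissipative (dl h e Cz Ck N k m : R) :=
  [/\ [/\ 0 < h, 0 < e, 0 < k & 0 < m], dl <= 2^-1,
   [/\ m * N <= 4^-1, 0 <= m * Ck <= e & m * Ck ^+ 2 <= k / 2],
   dl * Cz ^+ 2 / (2 * h) <= 4^-1 & dl <= m * k / 4].

(** Stated at one point: with constant functions as coefficients, the same predicate can be checked
    at a frozen state and direction. *)
Definition coefficient_bounds (dl h e Cz Ck N k : R) x :=
  [/\ 0 <= v x <= dl,
   [/\ forall X : 'cV[R]_n, h * sqnorm X <= qform (Hmx x) X,
       forall X : 'cV[R]_n, e * sqnorm X <= qform (Emx x) X,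
       forall X : 'cV[R]_n, e * sqnorm X <= qform (S x) X &
       forall X : 'cV[R]_n, k * sqnorm X <= qform (K *m A x) X + N * sqnorm (B x *m X)],
   [/\ fnorm (Zmx x) <= Cz, fnorm (M * al x *: (B x *m A x)) <= dl &
       v x * fnorm (2^-1 *: (Sh x *m A x - S x *m Ah x)) <= dl] &
   fnorm K <= Ck /\ fnorm (K *m L) <= Ck].

Lemma sqnorm_tr m p (X : 'M[R]_(m, p)) : sqnorm X^T = sqnorm X.
Proof. by rewrite /sqnorm trmxK mxtrace_mulC. Qed.

Lemma trace_ge (c : R) (P : 'M[R]_n) (X : 'M[R]_(n, 2)) :
  (forall Y : 'cV[R]_n, c * sqnorm Y <= qform P Y) -> c * sqnorm X <= \tr (X^T *m P *m X).
Proof.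
move=> H; rewrite mxtrace_cols sqnorm_cols mulr_sumr ler_sum// => i _; exact: H.
Qed.

Lemma Psi_dissipation (dl h e Cz Ck N k m x : R) du :
  0 <= a -> dissipative dl h e Cz Ck N k m -> coefficient_bounds dl h e Cz Ck N k x ->
  mx_derive x u du ->
  exists2 D, is_derive x 1 (Psi m) D &
    D <= - (m * k / 2 * sqnorm (u x) + 2^-1 * sqnorm (q x) + 4^-1 * sqnorm (s x)).
Proof.
move=> a0 [[h0 e0 k0 m0] d2 [mN mC mC2] dz dk] [vd [HH HE HS HK] [HZ HB HSh] [HK1 HK2]] Du.
have D0 := is_derive_Psi0 x; have D1 := is_derive_Psi1 Du; have D2 := is_derive_Psi2 x.
eexists; first exact: is_deriveD (is_deriveD D0 (is_derive1Ml 2^-1 D1)) (is_derive1Ml m D2).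
rewrite -!fnorm_sq.
have d0 : 0 <= dl by case/andP: vd => v0; exact: le_trans.
have bb m1 m2 p (P : 'M[R]_(m1, m2)) (X : 'M[R]_(m1, p)) (Y : 'M[R]_(m2, p)) c :
    fnorm P <= c -> `|\tr (X^T *m P *m Y)| <= c * (fnorm X * fnorm Y).
  move=> Pc; apply: (le_trans (bilinear_bound _ _ _)); rewrite -mulrA ler_wpM2r//.
  by rewrite mulr_ge0 ?fnorm_ge0.
have ub m1 m2 p (P : 'M[R]_(m1, m2)) (X : 'M[R]_(m1, p)) (Y : 'M[R]_(m2, p)) c :
    fnorm P <= c -> \tr (X^T *m P *m Y) <= c * (fnorm X * fnorm Y).
  by move=> /(bb _ _ _ P X Y); apply: le_trans; exact: ler_norm.
have ft m1 m2 (P : 'M[R]_(m1, m2)) : fnorm P^T = fnorm P by rewrite /fnorm sqnorm_tr.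
apply: (@dissipation_scalar _ a (v x) h e Cz Ck dl m N k (fnorm (W x)) (fnorm (u x)) (fnorm (q x))
  (fnorm (s x)) (fnorm (B x *m u x))); rewrite ?fnorm_ge0 ?fnorm_sq//.
- exact: trace_ge.
- exact: trace_ge.
- by apply: ub; rewrite ft.
- have -> : M * al x * \tr ((u x)^T *m (B x *m A x)^T *m s x) =
      \tr ((u x)^T *m (M * al x *: (B x *m A x))^T *m s x).
    by rewrite trmxZ -scalemxAr -scalemxAl mxtraceZ.
  by apply: ub; rewrite ft.
- exact: trace_ge.
- exact: mxtrace_CS.
- have vP (P : 'M[R]_n) : v x * \tr ((u x)^T *m P *m u x) = \tr ((u x)^T *m (v x *: P) *m u x).
    by rewrite -scalemxAr -scalemxAl mxtraceZ.
  rewrite vP -fnorm_sq expr2; apply: ub; rewrite fnormZ ger0_norm//.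
  by case/andP: vd.
- exact: bb.
- have := @trace_ge k (K *m A x + N *: ((B x)^T *m B x)) (u x).
  rewrite mulmxDr mulmxDl mxtraceD -scalemxAr -scalemxAl mxtraceZ /sqnorm trmx_mul !mulmxA; apply.
  move=> Y; apply: (le_trans (HK Y)); rewrite qformD qformZ lerD2l.
  by rewrite /sqnorm /qform trace_mx11 trmx_mul !mulmxA.
- exact: bb.
Qed.

Lemma mx_derive_continuous m p (F : R -> 'M[R]_(m, p)) dF :
  (forall x, mx_derive x F (dF x)) -> forall i j, continuous (fun x => F x i j).
Proof.
move=> H i j x; apply: differentiable_continuous; apply/derivable1_diffP.
by have D := H x i j; exact: ex_derive.
Qed.

Lemma continuous_bilinear_trace m p r (P : R -> 'M[R]_(m, p)) (X : R -> 'M[R]_(m, r)) (Y : R -> 'M[R]_(p, r)) :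
  (forall i j, continuous (fun x => P x i j)) ->
  (forall i j, continuous (fun x => X x i j)) -> (forall i j, continuous (fun x => Y x i j)) ->
  continuous (fun x => \tr ((X x)^T *m P x *m Y x)).
Proof.
move=> cP cX cY x; apply: cvg_sum_real => i _ /=; rewrite mxE; under eq_fun do rewrite mxE.
apply: cvg_sum_real => j _; apply: cvgM; last exact: cY.
rewrite mxE; under eq_fun do rewrite mxE; apply: cvg_sum_real => k _.
by apply: cvgM; [rewrite mxE; under eq_fun do rewrite mxE; exact: cX|exact: cP].
Qed.

Lemma continuous_mulmx m p r (X : R -> 'M[R]_(m, p)) (Y : R -> 'M[R]_(p, r)) :
  (forall i j, continuous (fun x => X x i j)) -> (forall i j, continuous (fun x => Y x i j)) ->
  forall i j, continuous (fun x => (X x *m Y x) i j).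
Proof.
move=> cX cY i j x; rewrite /continuous_at mxE; under eq_fun do rewrite mxE.
by apply: cvg_sum_real => k _; apply: cvgM; [exact: cX|exact: cY].
Qed.

Lemma Psi_continuous m : (forall i j, continuous (fun x => u x i j)) -> continuous (Psi m).
Proof.
move=> cu; have cS := mx_derive_continuous dS; have cA := mx_derive_continuous dA.
have cSA := continuous_mulmx cS cA.
have D0 x : {for x, continuous Psi0}.
  by apply: differentiable_continuous; apply/derivable1_diffP; have D := is_derive_Psi0 x; exact: ex_derive.
have D2 x : {for x, continuous Psi2}.
  by apply: differentiable_continuous; apply/derivable1_diffP; have D := is_derive_Psi2 x; exact: ex_derive.
move=> x; apply: cvgD; first (apply: cvgD; first exact: D0).
  by apply: cvgM; [exact: cvg_cst|]; apply: cvgM; [exact: cvg_cst|]; exact: continuous_bilinear_trace.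
by apply: cvgM; [exact: cvg_cst|exact: D2].
Qed.

Lemma Psi_bound m (c : R) : (forall x, fnorm (Emx x *m A x) <= c) ->
  (forall x, fnorm (B x + (M * al x) *: (B x *m A x)) <= c) -> (forall x, fnorm (S x *m A x) <= c) ->
  exists2 P, 0 <= P & forall x, `|Psi m x| <= P * (sqnorm (W x) + sqnorm (u x) + sqnorm (q x) + sqnorm (s x)).
Proof.
move=> b1 b2 b3.
have c0 : 0 <= c by apply: le_trans (b1 0); rewrite fnorm_ge0.
have bb m1 m2 p (P : 'M[R]_(m1, m2)) (X : 'M[R]_(m1, p)) (Y : 'M[R]_(m2, p)) d :
    fnorm P <= d -> `|\tr (X^T *m P *m Y)| <= d * (sqnorm X + sqnorm Y).
  move=> Pd; apply: (le_trans (bilinear_bound _ _ _)); rewrite -mulrA.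
  apply: ler_pM => //; rewrite ?mulr_ge0 ?fnorm_ge0// -!fnorm_sq.
  have := sqr_ge0 (fnorm X - fnorm Y); have := sqr_ge0 (fnorm X + fnorm Y).
  rewrite sqrrB sqrrD => ? ?; nra.
have ft m1 m2 (P : 'M[R]_(m1, m2)) : fnorm P^T = fnorm P by rewrite /fnorm sqnorm_tr.
pose d := `|m| * (`|b / 2| * fnorm K); have d0 : 0 <= d by rewrite !mulr_ge0 ?fnorm_ge0.
exists (2 * c + 2 * d + fnorm (1%:M : 'M[R]_1)); first by rewrite !addr_ge0 ?mulr_ge0 ?fnorm_ge0.
move=> x.
have JW : sqnorm (W x *m Jmx) = sqnorm (W x).
  rewrite /sqnorm trmx_mul mulmxA -[Jmx^T *m _ *m _]mulmxA mxtrace_mulC mulmxA.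
  by rewrite !mulmxA Jmx_unitary mul1mx.
have h1 := bb _ _ _ _ (W x) (W x) _ (b1 x).
have h3 := bb _ _ _ _ (u x) (u x) _ (b3 x).
have := bb _ _ _ (B x + (M * al x) *: (B x *m A x))^T (W x) (s x) c; rewrite ft => /(_ (b2 x)) h2.
have h4 := bb _ _ _ 1%:M (q x) (s x) _ (lexx _).
have := bb _ _ _ K (W x) (W x *m Jmx) _ (lexx _); rewrite mulmxA JW => h5.
have h6 : `|m * Psi2 x| <= d * (sqnorm (W x) + sqnorm (W x)).
  rewrite normrM /Psi2 normrM /d -!mulrA ler_wpM2l//; rewrite ler_wpM2l//.
have h7 : `|Psi m x| <= 2^-1 * `|\tr ((W x)^T *m (Emx x *m A x) *m W x)|
    + `|\tr ((W x)^T *m (B x + (M * al x) *: (B x *m A x))^T *m s x)| + `|\tr ((q x)^T *m s x)|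
    + 2^-1 * (2^-1 * `|\tr ((u x)^T *m (S x *m A x) *m u x)|) + `|m * Psi2 x|.
  rewrite /Psi /Psi0 /Psi1; apply: (le_trans (ler_normD _ _)); rewrite lerD2r.
  apply: (le_trans (ler_normD _ _)); rewrite !normrM [`|2^-1|]ger0_norm ?invr_ge0// lerD2r.
  apply: (le_trans (ler_normB _ _)); rewrite lerD2r.
  by apply: (le_trans (ler_normD _ _)); rewrite normrM [`|2^-1|]ger0_norm ?invr_ge0.
rewrite mulmx1 in h4; apply: (le_trans h7) => {h7}.
have := sqnorm_ge0 (W x); have := sqnorm_ge0 (u x); have := sqnorm_ge0 (q x); have := sqnorm_ge0 (s x).
have := fnorm_ge0 (1%:M : 'M[R]_1).
move: h1 h2 h3 h4 h6; move: (fnorm 1%:M) (sqnorm (W x)) (sqnorm (u x)) (sqnorm (q x)) (sqnorm (s x)).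
move: `|_| `|_| `|_| `|_| `|_| => x1 x2 x3 x4 x5 f w u' q' s' h1 h2 h3 h4 h6 f0 s0 q0 u0 w0.
have := mulr_ge0 f0 w0; have := mulr_ge0 f0 u0.
have := mulr_ge0 c0 w0; have := mulr_ge0 c0 u0; have := mulr_ge0 c0 q0; have := mulr_ge0 c0 s0.
have := mulr_ge0 d0 w0; have := mulr_ge0 d0 u0; have := mulr_ge0 d0 q0; have := mulr_ge0 d0 s0.
by lra.
Qed.

End Lyapunov.

(** * Monotone functions dominated by integrable ones *)

Section MonotoneIntegrable.
Variable R : realType.
Local Notation mu := (@lebesgue_measure R).

(** The two sides of [x0] are treated separately and glued by continuity; this absorbs the
    derivative of u that may be missing at the sonic point. *)
Lemma nonincreasing_off_point (P D : R -> R) (x0 : R) : continuous P ->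
  (forall x, x != x0 -> is_derive x 1 P (D x)) -> (forall x, x != x0 -> D x <= 0) ->
  forall x y, x <= y -> P y <= P x.
Proof.
move=> cP dP D0.
have step x y : x <= y -> (x0 <= x) || (y <= x0) -> P y <= P x.
  move=> xy xy0.
  have neq z : z \in `]x, y[ -> z != x0.
    rewrite in_itv/= => /andP[xz zy]; case/orP: xy0 => h.
      by rewrite gt_eqF// (le_lt_trans h).
    by rewrite lt_eqF// (lt_le_trans zy).
  apply: (@ler0_derive1_le_cc _ P x y) => //.
  - by move=> z zxy; have := dP z (neq z zxy) => ?; exact: ex_derive.
  - move=> z zxy; have D1 := dP z (neq z zxy); rewrite derive1E (@derive_val _ _ _ _ _ _ _ D1).
    exact: D0 (neq z zxy).
  - exact: continuous_subspaceT.
  - by rewrite in_itv/= lexx xy.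
  - by rewrite in_itv/= lexx xy.
move=> x y xy; have [h|h] := leP x0 x; first by apply: step; rewrite ?h.
have [h'|h'] := leP y x0; first by apply: step; rewrite ?h' ?orbT.
by apply: (@le_trans _ _ (P x0)); apply: step; rewrite ?lexx ?orbT// ltW.
Qed.

(** A length k with c k larger than the integral of |g| is contradictory. The left end may depend on
    k, which serves intervals growing in either direction. *)
Lemma integrable_not_bounded_below (g : R -> R) (c : R) (y : R -> R) : mu.-integrable setT (EFin \o g) ->
  0 < c -> (forall k, 0 < k -> {ae mu, forall x, x \in `[y k, (y k + k)%R] -> c <= g x}) -> False.
Proof.
move=> ig c0 H.
have /integrableP[mg fing] := ig.
have : (\int[mu]_x `|(EFin \o g) x| \is a fin_num)%E by rewrite ge0_fin_numE// integral_ge0.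
set I := (\int[mu]_x _)%E => fI.
have I0 : 0 <= fine I by rewrite fine_ge0// integral_ge0.
pose k := (fine I + 1) / c; have k0 : 0 < k by rewrite divr_gt0// ltr_wpDl.
have mI : measurable (`[y k, (y k + k)%R] : set R) by [].
have : (\int[mu]_(x in `[y k, (y k + k)%R]) (cst c%:E) x <= I)%E.
  apply: (@le_trans _ _ (\int[mu]_(x in `[y k, (y k + k)%R]) `|(EFin \o g) x|)%E); last first.
    apply: ge0_subset_integral => //; exact: measurableT_comp.
  apply: ae_ge0_le_integral => //.
  - by move=> x _; rewrite lee_fin ltW.
  - by apply: measurableT_comp => //; exact: measurable_funTS.
  - apply: (filterS _ (H k k0)); first exact: (ae_filter_ringOfSetsType mu).
    move=> x Hx xI /=.
    rewrite lee_fin; apply: le_trans (ler_norm _); apply: Hx; by rewrite inE.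
have -> : (\int[mu]_(x in `[y k, (y k + k)%R]) (cst c%:E) x = c%:E * mu `[y k, (y k + k)%R])%E.
  by exact: (integral_cst mu mI).
rewrite lebesgue_measure_itv/= lte_fin ltrDl k0 -EFinD addrAC subrr add0r.
rewrite -(fineK fI) -EFinM lee_fin /k mulrC divfK ?gt_eqF//.
by rewrite gerDl ler10.
Qed.

(** A positive value of [P] at x1 persists to the left of x1 and a negative one to the right, both
    against integrability of [g]. Hence [P] vanishes identically, so does its derivative, and 0 <= G
    <= - D = 0. *)
Lemma dissipation_vanishes (P D G g : R -> R) (x0 : R) : continuous P ->
  (forall x, x != x0 -> is_derive x 1 P (D x)) ->
  (forall x, 0 <= G x) -> (forall x, x != x0 -> D x <= - G x) ->
  mu.-integrable setT (EFin \o g) -> {ae mu, forall x, `|P x| <= g x} ->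
  forall x, x != x0 -> G x = 0.
Proof.
move=> cP dP G0 DG ig Pg.
have mono := nonincreasing_off_point cP dP (fun x h => le_trans (DG x h) (eqbRL (oppr_le0 _) (G0 x))).
have P0 x1 : P x1 = 0.
  apply/eqP; rewrite eq_le; apply/andP; split; rewrite leNgt; apply/negP => Px1.
    apply: (@integrable_not_bounded_below g (P x1) (fun k => x1 - k) ig Px1) => k k0.
    apply: (filterS _ Pg); first exact: (ae_filter_ringOfSetsType mu).
  move=> x Hx; rewrite in_itv/= subrK => /andP[_ xx1].
    by apply: le_trans Hx; apply: le_trans (ler_norm _); exact: mono.
  have Px1' : 0 < - P x1 by rewrite oppr_gt0.
  apply: (@integrable_not_bounded_below g (- P x1) (fun k => x1) ig Px1') => k k0.
  apply: (filterS _ Pg); first exact: (ae_filter_ringOfSetsType mu).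
  move=> x Hx; rewrite in_itv/= => /andP[xx1 _].
  by apply: le_trans Hx; rewrite -normrN; apply: le_trans (ler_norm _); rewrite lerN2; exact: mono.
move=> x xx0; have Dx := dP x xx0.
have PE : P = cst 0 by apply/funext => z; exact: P0.
have D0 : D x = 0 by rewrite -(@derive_val _ _ _ _ _ _ _ Dx) PE derive_cst.
apply/eqP; rewrite eq_le G0 andbT; have := DG x xx0; by rewrite D0 oppr_ge0.
Qed.

End MonotoneIntegrable.

(** * Regularity of eigenfunctions *)

Section EigenfunctionRegularity.
Variable R : realType.
Local Notation mu := (@lebesgue_measure R).

Lemma ae_imply (P Q : R -> Prop) : (forall x, P x -> Q x) ->
  {ae mu, forall x, P x} -> {ae mu, forall x, Q x}.
Proof. by move=> PQ; apply: filterS PQ; exact: (ae_filter_ringOfSetsType mu). Qed.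

Lemma ae_imply2 (P Q S : R -> Prop) : (forall x, P x -> Q x -> S x) ->
  {ae mu, forall x, P x} -> {ae mu, forall x, Q x} -> {ae mu, forall x, S x}.
Proof. by move=> PQ; apply: filterS2 PQ; exact: (ae_filter_ringOfSetsType mu). Qed.

Lemma ae_forall_fin (I : finType) (P : I -> R -> Prop) : (forall i, {ae mu, forall x, P i x}) ->
  {ae mu, forall x, forall i, P i x}.
Proof. by move=> H; apply: filter_forall => //; exact: (ae_filter_ringOfSetsType mu). Qed.

Lemma ae_eq_continuous (f g : R -> R) : continuous f -> continuous g ->
  {ae mu, forall x, f x = g x} -> f =1 g.
Proof.
move=> cf cg fg x; apply/eqP; apply: contrapT => /negP fgx.
have : \forall y \near x, f y - g y != 0.
  have cfg : f y - g y @[y --> x] --> f x - g x by apply: cvgB; [exact: cf|exact: cg].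
  have /cvgrPdist_lt/(_ `|f x - g x|) := cfg; rewrite normr_gt0 subr_eq0 => /(_ fgx).
  by apply: filterS => y; apply: contraTneq => ->; rewrite subr0 ltxx.
move=> /nbhs_ballP[e /= e0 He].
have [N [mN N0 HN]] := fg.
have : (mu (`](x - e)%R, (x + e)%R[%classic : set R) <= mu N)%E.
  apply: le_measure; rewrite ?inE//.
  move=> y /=; rewrite in_itv/= => /andP[y1 y2]; apply: HN => /= E.
  have /He : ball x e y by rewrite /ball/= ltr_distlC y1 y2.
  by rewrite /= E subrr eqxx.
rewrite N0 lebesgue_measure_itv/= lte_fin ifT; last by lra.
by rewrite -EFinD lee_fin; lra.
Qed.

Lemma locally_integrable_cmul (c h : R -> R) : continuous c -> locally_integrable setT h ->
  locally_integrable setT (fun x => c x * h x).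
Proof.
move=> cc [mh _ lh]; have mc : measurable_fun setT c by exact: continuous_measurable_fun.
split; [exact: measurable_funM|exact: openT|].
move=> K _ cK; have mK : measurable (K : set R) by exact: compact_measurable.
have ih : mu.-integrable K (EFin \o h).
  apply/integrableP; split; last exact: lh.
  by apply/measurable_realfun.measurable_EFinP; exact: measurable_funS mh.
have : mu.-integrable K ((EFin \o c) \* (EFin \o h))%E.
  apply: integrableMr => //.
    by apply: measurable_funS mc.
  have /compact_bounded[B [Br HB]] : compact (c @` K).
    by apply: continuous_compact => //; exact: continuous_subspaceT.
  by exists B; split=> // B' BB' y yM; apply: HB => //; exists y.
by move=> /integrableP[].
Qed.

Lemma locally_integrable_bigsum (I : Type) (r : seq I) (h : I -> R -> R) :
  (forall i, locally_integrable setT (h i)) ->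
  locally_integrable setT (fun x => \sum_(i <- r) h i x).
Proof.
move=> H; elim: r => [|i r IH].
  by under eq_fun do rewrite big_nil; exact/locally_integrable_continuous/cst_continuous.
by under eq_fun do rewrite big_cons; exact: locally_integrableD.
Qed.

Lemma locally_integrable_mulmx m p r (C : R -> 'M[R]_(m, p)) (X : R -> 'M[R]_(p, r)) :
  (forall i j, continuous (fun x => C x i j)) ->
  (forall i j, locally_integrable setT (fun x => X x i j)) ->
  forall i j, locally_integrable setT (fun x => (C x *m X x) i j).
Proof.
move=> cC lX i j; under eq_fun do rewrite mxE.
by apply: locally_integrable_bigsum => k; exact: locally_integrable_cmul.
Qed.

Lemma weak_deriv_balance (V m : R -> R) : locally_integrable setT V -> locally_integrable setT m ->
  (forall phi, test_fun phi ->
     Rintegral mu setT (fun x => m x * phi x - V x * derive1 phi x) = 0) ->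
  weak_deriv V (fun x => - m x).
Proof.
move=> lV lm H phi tphi; have := H _ tphi.
rewrite RintegralB//; [|exact: locally_integrable_mul_test|
  apply: locally_integrable_mul_test => //; exact: test_fun_derive1].
move=> /eqP; rewrite subr_eq0 => /eqP <-.
rewrite -[LHS]opprK; congr (- _); rewrite -mulN1r -RintegralZl//; last exact: locally_integrable_mul_test.
by apply: eq_Rintegral => x _; rewrite mulN1r mulNr.
Qed.

Lemma antiderivative_ae (F f g : R -> R) : locally_integrable setT f -> locally_integrable setT g ->
  {ae mu, forall x, f x = g x} ->
  antiderivative F f -> antiderivative F g.
Proof.
move=> [mf _ _] [mg _ _] fg AF x y xy; rewrite (AF x y xy) /Rintegral; congr fine.
apply: ae_eq_integral => //.
- by apply/measurable_realfun.measurable_EFinP; exact: measurable_funS mf.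
- by apply/measurable_realfun.measurable_EFinP; exact: measurable_funS mg.
- by apply: ae_imply fg => z -> _.
Qed.

End EigenfunctionRegularity.

Section EigenfunctionMatrix.
Variables (R : realType) (n' : nat).
Local Notation n := n'.+1.
Local Notation mu := (@lebesgue_measure R).

Definition complex_mx m (x y : 'cV[R]_m) : 'M[R]_(m, 2) :=
  \matrix_(i, c) (if c == 0 then x i 0 else y i 0).

Definition complex_row (x y : R) : 'rV[R]_2 := \row_c (if c == 0 then x else y).

Lemma ord2_cases (c : 'I_2) : c = 0 \/ c = 1.
Proof. by case: c => [[|[|//]] ?]; [left|right]; apply: val_inj. Qed.

Lemma mulmx_complex m (C : 'M[R]_(m, n)) (x y : 'cV[R]_n) i c :
  (C *m complex_mx x y) i c = if c == 0 then (C *m x) i 0 else (C *m y) i 0.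
Proof.
rewrite !mxE; case: ifP => c0; apply: eq_bigr => j _; by rewrite mxE c0.
Qed.

Lemma complex_lam m (x y : 'cV[R]_m) a b i c : (complex_mx x y *m lam a b) i c =
  if c == 0 then a * x i 0 - b * y i 0 else a * y i 0 + b * x i 0.
Proof.
rewrite !mxE !big_ord_recl big_ord0 !mxE addr0.
by have [->|->] := ord2_cases c; rewrite /= ?mulr1n ?mulr0n ?(mulr0, mulr1, add0r, addr0, mulrN1, mulrN); ring.
Qed.

(** The conjugate over the squared modulus. *)
Definition lam_inv (a b : R) : 'M[R]_2 := (a ^+ 2 + b ^+ 2)^-1 *: lam a (- b).

Lemma lamK a b : a != 0 \/ b != 0 -> lam a b *m lam_inv a b = 1%:M.
Proof.
move=> ab; have N0 : a ^+ 2 + b ^+ 2 != 0.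
  by rewrite paddr_eq0 ?sqr_ge0// !sqrf_eq0 negb_and; case: ab => ->; rewrite ?orbT.
have JJ : Jmx R *m Jmx R = - 1%:M by rewrite -[LHS]opprK -mulmxN -Jmx_tr Jmx_unitary.
rewrite /lam_inv -scalemxAr /lam mulmxDl !mulmxDr -!scalemxAl -!scalemxAr JJ.
rewrite -!scalar_mxM !mul_scalar_mx !mul_mx_scalar.
apply/matrixP => i j; rewrite !(scalemxE, addmxE, oppmxE) [_%:M i j]mxE [1%:M i j]mxE.
by case: (i == j); rewrite ?mulr1n ?mulr0n; field.
Qed.


Section Regularity.
Variables (AU : R -> 'M[R]_n) (BU : R -> 'rV[R]_n) (L : 'cV[R]_n) (i0 : 'I_n) (a b : R).
Variables (X dX : R -> 'M[R]_(n, 2)) (Y : R -> 'rV[R]_2).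
Hypothesis cA : forall i j, continuous (fun x => AU x i j).
Hypothesis cB : forall i j, continuous (fun x => BU x i j).
Hypothesis Li0 : L i0 0 != 0.
Hypothesis ab : a != 0 \/ b != 0.
Hypothesis lX : forall i c, locally_integrable setT (fun x => X x i c).
Hypothesis ldX : forall i c, locally_integrable setT (fun x => dX x i c).
Hypothesis lY : forall i c, locally_integrable setT (fun x => Y x i c).
Hypothesis wX : forall i c, weak_deriv (fun x => X x i c) (fun x => dX x i c).
Hypothesis balance_u : forall i c, weak_deriv (fun x => (AU x *m X x + L *m Y x) i c)
  (fun x => - (X x *m lam a b) i c).
Hypothesis balance_q : forall c phi, test_fun phi -> Rintegral mu setT (fun x =>
  - Y x 0 c * derive1 (derive1 phi) x + Y x 0 c * phi x - (BU x *m X x) 0 c * derive1 phi x) = 0.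

Lemma continuous_cst_mx m p (M : 'M[R]_(m, p)) i j : continuous (fun _ : R => M i j).
Proof. exact: cst_continuous. Qed.

Lemma mx_representative m p (Z dZ : R -> 'M[R]_(m, p)) :
  (forall i c, locally_integrable setT (fun x => Z x i c)) ->
  (forall i c, locally_integrable setT (fun x => dZ x i c)) ->
  (forall i c, weak_deriv (fun x => Z x i c) (fun x => dZ x i c)) ->
  exists z : R -> 'M[R]_(m, p), [/\ forall i c, antiderivative (fun x => z x i c) (fun x => dZ x i c),
    forall i c, continuous (fun x => z x i c) & {ae mu, forall x, Z x = z x}].
Proof.
move=> lZ ldZ wZ.
have /choice[F HF] : forall ic : 'I_m * 'I_p, exists F : R -> R,
    antiderivative F (fun x => dZ x ic.1 ic.2) /\ {ae mu, forall x, Z x ic.1 ic.2 = F x}.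
  move=> [i c]; have [F] := weak_deriv_antiderivative (lZ i c) (ldZ i c) (wZ i c).
  by exists F.
exists (fun x => \matrix_(i, c) F (i, c) x); split.
- by move=> i c; under eq_fun do rewrite mxE; exact: (HF (i, c)).1.
- move=> i c; under eq_fun do rewrite mxE.
  exact: antiderivative_continuous (ldZ i c) (HF (i, c)).1.
- have : {ae mu, forall x, forall ic, Z x ic.1 ic.2 = F ic x}.
    by apply: ae_forall_fin => ic; exact: (HF ic).2.
  by apply: ae_imply => x H; apply/matrixP => i c; rewrite mxE (H (i, c)).
Qed.

(** The flux A X + L Y has the continuous weak derivative - lambda u after correction on a null set,
    so it is continuously differentiable; dividing it by - lambda gives W. All other regularity is
    read off from the flux and from the second equation. *)
Lemma eigenfunction_regularity : exists (W u : R -> 'M[R]_(n, 2)) (q s : R -> 'rV[R]_2),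
  [/\ [/\ forall x, mx_derive x W (u x), forall x, mx_derive x q (s x + BU x *m u x),
        forall x, mx_derive x s (q x) & forall x, W x *m lam a b + AU x *m u x + L *m q x = 0],
      forall i c, continuous (fun x => u x i c),
      forall i c, antiderivative (fun x => u x i c) (fun x => dX x i c) &
      {ae mu, forall x, X x = u x} /\ {ae mu, forall x, Y x = q x}].
Proof.
have [u [AFu cu Xu]] := mx_representative lX ldX wX.
have cXl i c : locally_integrable setT (fun x => - (X x *m lam a b) i c).
  apply: locally_integrableN; under eq_fun do rewrite mxE.
  apply: locally_integrable_bigsum => k; under eq_fun do rewrite mulrC.
  by apply: locally_integrable_cmul => //; exact: cst_continuous.
have lV i c : locally_integrable setT (fun x => (AU x *m X x + L *m Y x) i c).
  under eq_fun do rewrite addmxE; apply: locally_integrableD; first exact: locally_integrable_mulmx.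
  by apply: locally_integrable_mulmx => // ? ?; exact: cst_continuous.
have [G [AFG cG VG]] : exists z : R -> 'M[R]_(n, 2),
    [/\ forall i c, antiderivative (fun x => z x i c) (fun x => (- (X x *m lam a b)) i c),
    forall i c, continuous (fun x => z x i c) & {ae mu, forall x, AU x *m X x + L *m Y x = z x}].
  apply: mx_representative => i c //.
    by under eq_fun do rewrite oppmxE; exact: cXl.
  by under [X in weak_deriv _ X]eq_fun do rewrite oppmxE; exact: balance_u.
have cul i c : continuous (fun x => (- (u x *m lam a b)) i c).
  move=> x; rewrite /continuous_at oppmxE; under eq_fun do rewrite oppmxE; apply: cvgN.
  exact: (continuous_mulmx cu (@continuous_cst_mx _ _ (lam a b))).
have dG x : mx_derive x G (- (u x *m lam a b)).
  move=> i c; apply: (@antiderivative_continuous_is_derive _ _ (fun x => (- (u x *m lam a b)) i c) x (cul i c)).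
  apply: antiderivative_ae (AFG i c).
  - by under eq_fun do rewrite oppmxE; exact: cXl.
  - exact/locally_integrable_continuous/cul.
  - by apply: ae_imply Xu => y ->.
(* One nonzero entry of [L] recovers q continuously from the flux; the full vector identity holds
   almost everywhere, hence everywhere by continuity. *)
pose q x : 'rV[R]_2 := (L i0 0)^-1 *: row i0 (G x - AU x *m u x).
have cq j c : continuous (fun x => q x j c).
  move=> x; rewrite /continuous_at !mxE; under eq_fun do rewrite !mxE.
  apply: cvgM; first exact: cvg_cst; apply: cvgB; first exact: cG.
  have := @continuous_mulmx _ _ _ _ _ _ cA cu i0 c x; rewrite /continuous_at mxE.
  by under eq_fun do rewrite mxE.
have Yq : {ae mu, forall x, Y x = q x}.
  apply: ae_imply2 Xu VG => x -> E.
  have -> : q x = (L i0 0)^-1 *: row i0 (L *m Y x) by rewrite /q -E addrC addKr.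
  apply/rowP => c; rewrite !mxE big_ord1 [in RHS]mulrA mulVf// mul1r; by congr (Y x _ _); rewrite ord1.
have GE x : G x = AU x *m u x + L *m q x.
  apply/matrixP => i c; move: x; apply: ae_eq_continuous; first exact: cG.
    move=> x; rewrite /continuous_at addmxE; under eq_fun do rewrite addmxE; apply: cvgD.
      exact: (continuous_mulmx cA cu).
    exact: (continuous_mulmx (@continuous_cst_mx _ _ L) cq).
  have XuYq : {ae mu, forall x, X x = u x /\ Y x = q x} by apply: ae_imply2 Xu Yq.
  by apply: ae_imply2 XuYq VG => x [<- <-] <-.
(* With q written as the derivative of P, integration by parts leaves only derivatives of the test
   function in the second equation, so it can be integrated once. The constant of integration goes
   into s = P - k. *)
have /choice[P HP] : forall c, exists P : R -> R, antiderivative P (fun x => q x 0 c).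
  by move=> c; have [P] := antiderivative_exists 0 (locally_integrable_continuous (cq 0 c)); exists P.
have dP c (x : R) : is_derive x 1 (P c) (q x 0 c).
  exact: antiderivative_continuous_is_derive (cq 0 c) (HP c).
have cP c : continuous (P c) by exact: is_derive_continuous (dP c).
have lBX c : locally_integrable setT (fun x => (BU x *m X x) 0 c) by exact: locally_integrable_mulmx.
have /choice[k Hk] : forall c, exists k, weak_deriv (fun x => Y x 0 c)
    (fun x => (P c x + (BU x *m X x) 0 c) - k).
  move=> c; apply: weak_deriv_of_second_order => //.
    by apply: locally_integrableD => //; exact: locally_integrable_continuous.
  move=> phi tphi; have t1 := test_fun_derive1 tphi; have t2 := test_fun_derive1 t1.
  have i1 := locally_integrable_mul_test (lY 0 c) t2.
  have i2 := locally_integrable_mul_test (lY 0 c) tphi.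
  have i3 := locally_integrable_mul_test (lBX c) t1.
  have i4 := locally_integrable_mul_test (locally_integrable_continuous (cP c)) t1.
  have IB := test_fun_IBP (dP c) (cq 0 c) tphi.
  have := balance_q c tphi.
  have E1 : Rintegral mu setT (fun x => Y x 0 c * phi x) = Rintegral mu setT (fun x => q x 0 c * phi x).
    rewrite /Rintegral; congr fine; apply: ae_eq_integral => //.
    - by have /integrableP[] := i2.
    - by have /integrableP[] := locally_integrable_mul_test (locally_integrable_continuous (cq 0 c)) tphi.
    - by apply: ae_imply Yq => x -> _.
  have -> : Rintegral mu setT (fun x => - Y x 0 c * derive1 (derive1 phi) x + Y x 0 c * phi x
      - (BU x *m X x) 0 c * derive1 phi x) =
      Rintegral mu setT (fun x => (Y x 0 c * phi x - Y x 0 c * derive1 (derive1 phi) x)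
      - (BU x *m X x) 0 c * derive1 phi x).
    by apply: eq_Rintegral => x _; rewrite mulNr [- _ + _]addrC.
  rewrite RintegralB//; last exact: (integrableB _ i2 i1).
  rewrite RintegralB// E1 => E.
  have -> : Rintegral mu setT (fun x => (P c x + (BU x *m X x) 0 c) * derive1 phi x) =
      Rintegral mu setT (fun x => P c x * derive1 phi x + (BU x *m X x) 0 c * derive1 phi x).
    by apply: eq_Rintegral => x _; rewrite mulrDl.
  have ar (x y z : R) : x - y - z = 0 -> y = - (- x + z).
    by move=> /eqP; rewrite -addrA -opprD subr_eq0 => /eqP ->; ring.
  rewrite RintegralD// IB; exact: ar.
pose s x : 'rV[R]_2 := \row_c (P c x - k c).
have cBu c : continuous (fun x => (BU x *m u x) 0 c) by exact: (continuous_mulmx cB cu).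
have csB c : continuous (fun x => (s x + BU x *m u x) 0 c).
  move=> x; rewrite /continuous_at addmxE; under eq_fun do rewrite addmxE; apply: cvgD; last exact: cBu.
  by rewrite mxE; under eq_fun do rewrite mxE; apply: cvgB; [exact: cP|exact: cvg_cst].
have lm c : locally_integrable setT (fun x => P c x + (BU x *m X x) 0 c - k c).
  apply: locally_integrableB; last exact/locally_integrable_continuous/cst_continuous.
  by apply: locally_integrableD => //; exact: locally_integrable_continuous.
have dq x : mx_derive x q (s x + BU x *m u x).
  move=> j c; rewrite (ord1 j); have [F AF YF] := weak_deriv_antiderivative (lY 0 c) (lm c) (Hk c).
  have -> : (fun y => q y 0 c) = F.
    apply/funext; apply: ae_eq_continuous; [exact: cq|exact: antiderivative_continuous AF|].
    by apply: ae_imply2 Yq YF => y <-.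
  apply: (@antiderivative_continuous_is_derive _ _ (fun x => (s x + BU x *m u x) 0 c) x (csB c)).
  apply: antiderivative_ae AF => //; first exact: locally_integrable_continuous.
  by apply: ae_imply Xu => y ->; rewrite addmxE [s y _ _]mxE; ring.
exists (fun x => - (G x *m lam_inv a b)), u, q, s; split => //; split => //.
- move=> x; have := mx_deriveN (mx_derive_mul (dG x) (mx_derive_cst x (lam_inv a b))).
  by rewrite mulmx0 addr0 mulNmx opprK -mulmxA lamK// mulmx1.
- move=> x j c; rewrite (ord1 j); under eq_fun do rewrite mxE.
  by have := is_deriveB (dP c x) (is_derive_cst (k c) x (1 : R)); rewrite subr0.
- move=> x; rewrite mulNmx -mulmxA (mulmx1C (lamK ab)) mulmx1 GE -addrA addrC subrr//.
Qed.

End Regularity.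

End EigenfunctionMatrix.

(** * Differentiability by Cramer's rule and integrable domination of the energy *)

Section Bounds.
Variable R : realType.
Local Notation mu := (@lebesgue_measure R).

Definition mx_derivable m p (x : R) (F : R -> 'M[R]_(m, p)) :=
  forall i j, derivable (fun y => F y i j) x 1.

Lemma mx_deriveP m p (x : R) (F : R -> 'M[R]_(m, p)) :
  mx_derivable x F -> mx_derive x F (\matrix_(i, j) ('D_1 (fun y => F y i j) x)).
Proof. by move=> D i j; rewrite mxE; apply: DeriveDef. Qed.

Lemma mx_derive_derivable m p (x : R) (F : R -> 'M[R]_(m, p)) dF :
  mx_derive x F dF -> mx_derivable x F.
Proof. by move=> D i j; have := D i j => ?; exact: ex_derive. Qed.

Lemma derivable_bigsum (I : Type) (r : seq I) (P : pred I) (f : I -> R -> R) (x : R) :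
  (forall i, derivable (f i) x 1) -> derivable (fun y => \sum_(i <- r | P i) f i y) x 1.
Proof.
move=> H; elim: r => [|i r IH].
  by under eq_fun do rewrite big_nil; exact: derivable_cst.
under eq_fun do rewrite big_cons; case: (P i); last exact: IH.
by apply: derivableD; [exact: H|exact: IH].
Qed.

Lemma derivable_bigprod (I : Type) (r : seq I) (P : pred I) (f : I -> R -> R) (x : R) :
  (forall i, derivable (f i) x 1) -> derivable (fun y => \prod_(i <- r | P i) f i y) x 1.
Proof.
move=> H; elim: r => [|i r IH].
  by under eq_fun do rewrite big_nil; exact: derivable_cst.
under eq_fun do rewrite big_cons; case: (P i); last exact: IH.
by apply: derivableM; [exact: H|exact: IH].
Qed.

Lemma derivable_det p (x : R) (F : R -> 'M[R]_p) : mx_derivable x F ->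
  derivable (fun y => \det (F y)) x 1.
Proof.
move=> H; apply: derivable_bigsum => s; apply: derivableM; first exact: derivable_cst.
exact: derivable_bigprod.
Qed.

Lemma mx_derivable_adj p (x : R) (F : R -> 'M[R]_p) : mx_derivable x F ->
  mx_derivable x (fun y => \adj (F y)).
Proof.
move=> H i j; under eq_fun do rewrite mxE; apply: derivableM; first exact: derivable_cst.
by apply: derivable_det => k l; under eq_fun do rewrite !mxE; exact: H.
Qed.

(** Near [x], Cramer's rule writes [u] through the determinant and adjugate of [A] and through
    [F]. *)
Lemma linear_system_derive p r (x : R) (A : R -> 'M[R]_p) (u F : R -> 'M[R]_(p, r)) :
  mx_derivable x A -> mx_derivable x F -> \det (A x) != 0 ->
  (\forall y \near x, A y *m u y = F y) ->
  exists du, mx_derive x u du.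
Proof.
move=> dA dF A0 E.
have Dd := derivable_det dA; have Da := mx_deriveP (mx_derivable_adj dA).
have Di := is_deriveV A0 (DeriveDef Dd erefl).
have D := mx_derive_scale Di (mx_derive_mul Da (mx_deriveP dF)).
eexists => i j; apply: near_eq_is_derive (D i j).
have cd : {for x, continuous (fun y => \det (A y))}.
  by apply: differentiable_continuous; apply/derivable1_diffP.
have : \forall y \near x, \det (A y) != 0.
  have /cvgrPdist_lt/(_ `|\det (A x)|) := cd; rewrite normr_gt0 => /(_ A0).
  by apply: filterS => y; apply: contraTneq => ->; rewrite subr0 ltxx.
apply: filterS2 E => y Ey y0; congr (_ _ i j).
by rewrite -Ey mulmxA mul_adj_mx mul_scalar_mx scalerA mulVf// scale1r.
Qed.

Lemma sqnormD m p (X Y : 'M[R]_(m, p)) : sqnorm (X + Y) <= 2 * (sqnorm X + sqnorm Y).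
Proof.
rewrite !sqnormE -big_split/= mulr_sumr ler_sum// => i _.
rewrite -big_split/= mulr_sumr ler_sum// => j _; rewrite addmxE.
by have := sqr_ge0 (X i j - Y i j); rewrite sqrrB sqrrD; lra.
Qed.

Lemma sqnormN m p (X : 'M[R]_(m, p)) : sqnorm (- X) = sqnorm X.
Proof. by rewrite !sqnormE; apply: eq_bigr => i _; apply: eq_bigr => j _; rewrite oppmxE sqrrN. Qed.

Lemma sqnorm_outer m p (X : 'cV[R]_m) (Y : 'rV[R]_p) : sqnorm (X *m Y) = sqnorm X * sqnorm Y.
Proof.
rewrite /sqnorm trmx_mul mulmxA -[Y^T *m X^T *m X]mulmxA [in LHS](mx11_scalar (X^T *m X)).
by rewrite mul_mx_scalar -scalemxAl mxtraceZ (trace_mx11 (X^T *m X)).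
Qed.

Lemma L2fun_sqnorm_integrable m p (X : R -> 'M[R]_(m, p)) :
  (forall i j, L2fun (fun x => X x i j)) -> mu.-integrable setT (EFin \o (fun x => sqnorm (X x))).
Proof.
move=> H; under [X in EFin \o X]eq_fun do rewrite sqnormE.
have isum (I : Type) (r : seq I) (f : I -> R -> R) : (forall i, mu.-integrable setT (EFin \o f i)) ->
    mu.-integrable setT (EFin \o (fun x => \sum_(i <- r) f i x)).
  move=> Hf; elim: r => [|i r IH].
    by under [X in EFin \o X]eq_fun do rewrite big_nil; exact: integrable0.
  by under [X in EFin \o X]eq_fun do rewrite big_cons; exact: (integrableD _ (Hf i) IH).
by apply: (isum) => i; apply: (isum) => j; exact: (H i j).2.
Qed.

(** The integrated equation bounds W by u and q. As q is given only in L^2, s is controlled by the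
    differentiated equation, L s = - (lambda u + A_x u + A u_x + L B u); this is where u in H^1
    enters. *)
Lemma energy_integrable n' (A dA : R -> 'M[R]_n'.+1) (B : R -> 'rV[R]_n'.+1) (L : 'cV[R]_n'.+1)
    (W u X dX : R -> 'M[R]_(n'.+1, 2)) (q s Y : R -> 'rV[R]_2) (a b c : R) :
  (forall x, mx_derive x A (dA x)) -> a != 0 \/ b != 0 -> L != 0 ->
  (forall x, sqnorm (A x) <= c) -> (forall x, sqnorm (dA x) <= c) -> (forall x, sqnorm (B x) <= c) ->
  (forall x, mx_derive x W (u x)) -> (forall x, mx_derive x q (s x + B x *m u x)) ->
  (forall x, W x *m lam a b + A x *m u x + L *m q x = 0) ->
  {ae mu, forall x, mx_derive x u (dX x)} ->
  {ae mu, forall x, X x = u x} -> {ae mu, forall x, Y x = q x} ->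
  (forall i j, L2fun (fun x => X x i j)) -> (forall i j, L2fun (fun x => dX x i j)) ->
  (forall i j, L2fun (fun x => Y x i j)) ->
  exists g : R -> R, mu.-integrable setT (EFin \o g) /\
    {ae mu, forall x, sqnorm (W x) + sqnorm (u x) + sqnorm (q x) + sqnorm (s x) <= g x}.
Proof.
move=> DA ab L0 bA bdA bB dW dq eq1 du Xu Yq LX LdX LY.
have l0 : 0 < sqnorm L by rewrite lt_def sqnorm_ge0 sqnorm_eq0 L0.
have c0 : 0 <= c by apply: le_trans (bA 0); rewrite sqnorm_ge0.
pose m := sqnorm (lam_inv a b)^T; pose m' := sqnorm (lam a b)^T.
have m0 : 0 <= m by exact: sqnorm_ge0.
have m'0 : 0 <= m' by exact: sqnorm_ge0.
have mulr_sq (Z : 'M[R]_(n'.+1, 2)) (P : 'M[R]_2) : sqnorm (Z *m P) <= sqnorm P^T * sqnorm Z.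
  by rewrite -sqnorm_tr trmx_mul -[sqnorm Z]sqnorm_tr; exact: sqnorm_mul.
pose l := sqnorm L; pose k := m * (2 * (c + l)) + (1 + 1 + l^-1 * (8 * (m' + c + c + l * c))).
have bW x : sqnorm (W x) <= m * (2 * (c * sqnorm (u x) + l * sqnorm (q x))).
  have -> : W x = - (A x *m u x + L *m q x) *m lam_inv a b.
    rewrite -[LHS]mulmx1 -(lamK ab) mulmxA; congr (_ *m _).
    by apply/eqP; rewrite -addr_eq0 addrA eq1.
  apply: (le_trans (mulr_sq _ _)); rewrite ler_wpM2l// sqnormN.
  apply: (le_trans (sqnormD _ _)); rewrite ler_wpM2l// sqnorm_outer lerD2r.
  by apply: (le_trans (sqnorm_mul _ _)); rewrite ler_wpM2r ?sqnorm_ge0.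
have bs x : mx_derive x u (dX x) -> l * sqnorm (s x) <=
    8 * (m' * sqnorm (u x) + c * sqnorm (u x) + c * sqnorm (dX x) + l * (c * sqnorm (u x))).
  move=> Du.
  have D := mx_deriveD (mx_deriveD (mx_derive_mul (dW x) (mx_derive_cst x (lam a b)))
    (mx_derive_mul (DA x) Du)) (mx_derive_mul (mx_derive_cst x L) (dq x)).
  have D0 := mx_derive_ext (fun y => esym (eq1 y)) (mx_derive_cst x 0).
  have := mx_derive_uniq D D0; rewrite mulmx0 addr0 mul0mx add0r (mulmxDr L) => E.
  rewrite -sqnorm_outer.
  have -> : L *m s x = - ((u x *m lam a b + dA x *m u x) + (A x *m dX x + L *m (B x *m u x))).
    by apply/eqP; rewrite -addr_eq0 -E; apply/eqP/matrixP => i j; rewrite !addmxE; ring.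
  rewrite sqnormN.
  have s1 := sqnormD (u x *m lam a b + dA x *m u x) (A x *m dX x + L *m (B x *m u x)).
  have s2 := sqnormD (u x *m lam a b) (dA x *m u x).
  have s3 := sqnormD (A x *m dX x) (L *m (B x *m u x)).
  have t1 := mulr_sq (u x) (lam a b).
  have t2 : sqnorm (dA x *m u x) <= c * sqnorm (u x).
    by apply: (le_trans (sqnorm_mul _ _)); rewrite ler_wpM2r ?sqnorm_ge0.
  have t3 : sqnorm (A x *m dX x) <= c * sqnorm (dX x).
    by apply: (le_trans (sqnorm_mul _ _)); rewrite ler_wpM2r ?sqnorm_ge0.
  have t4 : sqnorm (L *m (B x *m u x)) <= l * (c * sqnorm (u x)).
    rewrite sqnorm_outer ler_wpM2l ?(ltW l0)//.
    by apply: (le_trans (sqnorm_mul _ _)); rewrite ler_wpM2r ?sqnorm_ge0.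
  have p1 : 0 <= m' * sqnorm (u x) by rewrite mulr_ge0 ?sqnorm_ge0.
  have p2 : 0 <= c * sqnorm (u x) by rewrite mulr_ge0 ?sqnorm_ge0.
  have p3 : 0 <= c * sqnorm (dX x) by rewrite mulr_ge0 ?sqnorm_ge0.
  have p4 : 0 <= l * (c * sqnorm (u x)) by rewrite mulr_ge0 ?(ltW l0).
  move: s1 s2 s3 t1 t2 t3 t4 p1 p2 p3 p4; rewrite -/m'; lra.
pose g x := k * (sqnorm (X x) + sqnorm (dX x) + sqnorm (Y x)).
exists g; split.
  have i1 := L2fun_sqnorm_integrable LX; have i2 := L2fun_sqnorm_integrable LdX.
  have i3 := L2fun_sqnorm_integrable LY.
  have i4 := integrableD measurableT (integrableD measurableT i1 i2) i3.
  exact: (integrableZl measurableT k i4).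
have XY : {ae mu, forall x, X x = u x /\ Y x = q x} by apply: ae_imply2 Xu Yq.
apply: ae_imply2 XY du => x [Xx Yx] Du; rewrite /g Xx Yx /k.
have h1 := bW x; have := bs x Du.
have := sqnorm_ge0 (u x); have := sqnorm_ge0 (q x); have := sqnorm_ge0 (dX x).
have := sqnorm_ge0 (s x).
move: h1; have : 0 < l by []; clearbody m m' l.
move: (sqnorm (W x)) (sqnorm (u x)) (sqnorm (q x)) (sqnorm (s x)) (sqnorm (dX x)).
move=> w U Q S D l0' h1 S0 D0 Q0 U0 h2.
have h3 : S <= l^-1 * (8 * (m' * U + c * U + c * D + l * (c * U))) by rewrite mulrC ler_pdivlMr// mulrC.
have li : 0 <= l^-1 by rewrite invr_ge0 ltW.
have a1 : m * (2 * (c * U + l * Q)) <= m * (2 * (c + l)) * (U + D + Q).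
  rewrite -!mulrA ler_wpM2l// ler_wpM2l//.
  have := mulr_ge0 c0 D0; have := mulr_ge0 c0 Q0; have := mulr_ge0 (ltW l0') D0; have := mulr_ge0 (ltW l0') U0.
  by lra.
have a2 : l^-1 * (8 * (m' * U + c * U + c * D + l * (c * U))) <=
    l^-1 * (8 * (m' + c + c + l * c)) * (U + D + Q).
  rewrite -!mulrA ler_wpM2l// ler_wpM2l//.
  have := mulr_ge0 c0 D0; have := mulr_ge0 c0 Q0; have := mulr_ge0 m'0 D0; have := mulr_ge0 m'0 Q0.
  have := mulr_ge0 (ltW l0') (mulr_ge0 c0 D0); have := mulr_ge0 (ltW l0') (mulr_ge0 c0 Q0).
  have := mulr_ge0 c0 U0.
  by lra.
by lra.
Qed.

End Bounds.

(** * Vanishing of eigenfunctions under abstract coefficient bounds *)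

Section WeakStability.
Variables (R : realType) (n' : nat).
Local Notation n := n'.+1.
Local Notation mu := (@lebesgue_measure R).
Variables (A Ah S Sh : R -> 'M[R]_n) (B Bh : R -> 'rV[R]_n).
Variables (al v : R -> R) (L : 'cV[R]_n) (M : R) (K : 'M[R]_n) (x0 : R).
Variables (dl h e Cz Ck N k m cA : R).

Hypothesis dA : forall x, mx_derive x A (v x *: Ah x).
Hypothesis dS : forall x, mx_derive x S (v x *: Sh x).
Hypothesis dB : forall x, mx_derive x B (v x *: Bh x).
Hypothesis dal : forall x : R, is_derive x 1 al (- v x).
Hypothesis symS : forall x, (S x)^T = S x.
Hypothesis symSA : forall x, (S x *m A x)^T = S x *m A x.
Hypothesis SL : forall x, S x *m L = (B x)^T.
Hypothesis skewK : K^T = - K.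
Hypothesis L0 : L != 0.
Hypothesis detA : forall x, x != x0 -> \det (A x) != 0.
Hypothesis diss : dissipative dl h e Cz Ck N k m.
Hypothesis coef : forall x, coefficient_bounds A S B Ah Sh Bh al v L M K dl h e Cz Ck N k x.
Hypothesis bA : forall x, fnorm (A x) <= cA.
Hypothesis bdA : forall x, fnorm (v x *: Ah x) <= cA.
Hypothesis bB : forall x, fnorm (B x) <= cA.
Hypothesis bS : forall x, fnorm (S x) <= cA.
Hypothesis bal : forall x, `|M * al x| <= cA.

Lemma eigenfunction_vanishes (a b : R) (ur ui : R -> 'cV[R]_n) (qr qi : R -> R) :
  0 <= a -> a != 0 \/ b != 0 -> eig_weak_sol A B L a b ur ui qr qi ->
  {ae mu, forall x, [/\ ur x = 0, ui x = 0, qr x = 0 & qi x = 0]}.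
Proof.
move=> a0 ab [[[Lur [dur [Ldur wur]]] [Lui [dui [Ldui wui]]] Lqr Lqi] H].
pose X x := complex_mx (ur x) (ui x); pose dX x := complex_mx (dur x) (dui x).
pose Y x := complex_row (qr x) (qi x).
have [i0 Li0] : exists i0, L i0 0 != 0.
  apply: contrapT => /forallNP H0; move/eqP: L0; apply; apply/matrixP => i j.
  by rewrite (ord1 j) mxE; apply/eqP/negPn/negP; exact: H0.
have XE i c : (fun x => X x i c) = if c == 0 then (fun x => ur x i 0) else (fun x => ui x i 0).
  by apply/funext => x; rewrite mxE; case: ifP.
have dXE i c : (fun x => dX x i c) = if c == 0 then (fun x => dur x i 0) else (fun x => dui x i 0).
  by apply/funext => x; rewrite mxE; case: ifP.
have YE i c : (fun x => Y x i c) = if c == 0 then qr else qi.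
  by apply/funext => x; rewrite mxE; case: ifP.
have LX i c : L2fun (fun x => X x i c) by rewrite XE; case: ifP.
have LdX i c : L2fun (fun x => dX x i c) by rewrite dXE; case: ifP.
have LY i c : L2fun (fun x => Y x i c) by rewrite YE; case: ifP.
have lX i c := L2fun_locally_integrable (LX i c).
have ldX i c := L2fun_locally_integrable (LdX i c).
have lY i c := L2fun_locally_integrable (LY i c).
have wX i c : weak_deriv (fun x => X x i c) (fun x => dX x i c).
  by rewrite XE dXE; case: ifP.
have conA := mx_derive_continuous dA; have conB := mx_derive_continuous dB.
have balance_u i c : weak_deriv (fun x => (A x *m X x + L *m Y x) i c)
    (fun x => - (X x *m lam a b) i c).
  apply: weak_deriv_balance.
  - under eq_fun do rewrite addmxE; apply: locally_integrableD; first exact: locally_integrable_mulmx.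
    by apply: locally_integrable_mulmx => // ? ?; exact: cst_continuous.
  - under eq_fun do rewrite mxE; apply: locally_integrable_bigsum => j; under eq_fun do rewrite mulrC.
    by apply: locally_integrable_cmul => //; exact: cst_continuous.
  - move=> phi tphi; have [H1 H2 _ _] := H _ tphi.
    have LYE x : (L *m Y x) i c = if c == 0 then L i 0 * qr x else L i 0 * qi x.
      by rewrite mxE big_ord1 mxE; case: ifP.
    under eq_Rintegral do rewrite addmxE mulmx_complex LYE complex_lam.
    have [->|->] := ord2_cases c; rewrite /=; [exact: H1|exact: H2].
have balance_q c phi : test_fun phi -> Rintegral mu setT (fun x =>
    - Y x 0 c * derive1 (derive1 phi) x + Y x 0 c * phi x - (B x *m X x) 0 c * derive1 phi x) = 0.
  move=> tphi; have [_ _ H1 H2] := H _ tphi.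
  have YcE x : Y x 0 c = if c == 0 then qr x else qi x by rewrite mxE.
  under eq_Rintegral do rewrite mulmx_complex YcE.
  have [->|->] := ord2_cases c; rewrite /=; [exact: H1|exact: H2].
have [W [u [q [s [[dW dq ds eq1] cu AFu [Xu Yq]]]]]] :=
  eigenfunction_regularity conA conB Li0 ab lX ldX lY wX balance_u balance_q.
have cA0 : 0 <= cA by apply: le_trans (bA 0); rewrite fnorm_ge0.
have sqb p r (Z : 'M[R]_(p, r)) : fnorm Z <= cA -> sqnorm Z <= cA ^+ 2.
  by move=> ZA; rewrite -fnorm_sq ler_sqr ?nnegrE ?fnorm_ge0.
(* Almost everywhere suffices here: this derivative only serves to dominate [Psi], while
   monotonicity uses the classical derivative obtained off [x0]. *)
have aeu : {ae mu, forall x, mx_derive x u (dX x)}.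
  have : {ae mu, forall x, forall ic : 'I_n * 'I_2, lebesgue_pt (fun y => dX y ic.1 ic.2) x}.
    by apply: ae_forall_fin => ic; have := lebesgue_differentiation (ldX ic.1 ic.2).
  apply: ae_imply => x Hx i c.
  exact: (@antiderivative_is_derive _ _ (fun y => dX y i c) x (ldX i c) (AFu i c) (Hx (i, c))).
have [g [ig gb]] := energy_integrable dA ab L0 (fun x => sqb _ _ _ (bA x)) (fun x => sqb _ _ _ (bdA x))
  (fun x => sqb _ _ _ (bB x)) dW dq eq1 aeu Xu Yq LX LdX LY.
pose P := Psi A S B al M K b W u q s m.
have cP : continuous P by exact: (Psi_continuous dA dS dB dal symS symSA SL skewK dW dq ds eq1 cu).
have [c0 c00 Pb] : exists2 P0, 0 <= P0 & forall x,
    `|P x| <= P0 * (sqnorm (W x) + sqnorm (u x) + sqnorm (q x) + sqnorm (s x)).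
  have fm p r t (Z : 'M[R]_(p, r)) (Z' : 'M[R]_(r, t)) c : fnorm Z <= c -> fnorm Z' <= cA -> fnorm (Z *m Z') <= c * cA.
    move=> H1 H2; apply: (le_trans (fnorm_mul _ _)); apply: ler_pM; rewrite ?fnorm_ge0//.
  have fE x : fnorm (Emx A S al M x) <= cA + cA * (cA * cA).
    apply: (le_trans (fnormD _ _)); apply: lerD => //; rewrite fnormZ; apply: ler_pM; rewrite ?fnorm_ge0//; exact: fm.
  pose c := (cA + cA * (cA * cA)) * cA + (cA + cA * (cA * cA)) + cA * cA.
  have cc : 0 <= cA * cA by exact: mulr_ge0.
  have ccc : 0 <= cA * (cA * cA) by exact: mulr_ge0.
  have cccc : 0 <= (cA + cA * (cA * cA)) * cA by rewrite mulr_ge0// addr_ge0.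
  apply: (@Psi_bound _ _ A S B al M K b W u q s m c) => x.
  - by apply: (le_trans (fm _ _ _ _ _ _ (fE x) (bA x))); rewrite /c; lra.
  - apply: (@le_trans _ _ (cA + cA * (cA * cA))); last by rewrite /c; lra.
    apply: (le_trans (fnormD _ _)); apply: lerD => //; rewrite fnormZ.
    by apply: ler_pM; rewrite ?fnorm_ge0//; exact: fm.
  - by apply: (le_trans (fm _ _ _ _ _ _ (bS x) (bA x))); rewrite /c; lra.
have [[h0 e0 k0 m0] _ _ _ _] := diss.
pose G x := m * k / 2 * sqnorm (u x) + 2^-1 * sqnorm (q x) + 4^-1 * sqnorm (s x).
have mk0 : 0 < m * k / 2 by rewrite divr_gt0// mulr_gt0.
have G0 x : 0 <= G x by rewrite /G !addr_ge0 ?mulr_ge0 ?sqnorm_ge0// ltW.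
have derP x : x != x0 -> is_derive x 1 P ('D_1 P x) /\ 'D_1 P x <= - G x.
  move=> xx0.
  (* Away from [x0] the matrix A is invertible, and [u] solves a linear system whose data W and q
     are differentiable. *)
  have [du Du] : exists du, mx_derive x u du.
    have dF : mx_derive x (fun y => - (W y *m lam a b + L *m q y))
        (- (u x *m lam a b + W x *m 0 + (0 *m q x + L *m (s x + B x *m u x)))).
      exact: mx_deriveN (mx_deriveD (mx_derive_mul (dW x) (mx_derive_cst x _))
        (mx_derive_mul (mx_derive_cst x L) (dq x))).
    have Auy y : A y *m u y = - (W y *m lam a b + L *m q y).
      by apply/eqP; rewrite -addr_eq0 -(eq1 y); apply/eqP/matrixP => i j; rewrite !addmxE; ring.
    have nAu : \forall y \near x, A y *m u y = - (W y *m lam a b + L *m q y) by near=> y; exact: Auy.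
    exact: linear_system_derive (mx_derive_derivable (dA x)) (mx_derive_derivable dF) (detA xx0) nAu.
  have [D DP DG] := Psi_dissipation dA dS dB dal symS symSA SL skewK dW dq ds eq1 a0 diss (coef x) Du.
  have -> : 'D_1 P x = D by exact: (@derive_val _ _ _ _ _ _ _ DP).
  by split.
have Pg : {ae mu, forall x, `|P x| <= c0 * g x}.
  by apply: ae_imply gb => x Hx; apply: (le_trans (Pb x)); rewrite ler_wpM2l.
have icg : mu.-integrable setT (EFin \o (fun x => c0 * g x)) by exact: (integrableZl measurableT c0 ig).
have Z := dissipation_vanishes cP (fun x h => (derP x h).1) G0 (fun x h => (derP x h).2) icg Pg.
have nx0 : {ae mu, forall x, x != x0}.
  exists [set x0]; split; [exact: measurable_set1|exact: lebesgue_measure_set1|].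
  by move=> x /= /negP; rewrite negbK => /eqP.
have XYq : {ae mu, forall x, X x = u x /\ Y x = q x} by apply: ae_imply2 Xu Yq.
apply: ae_imply2 XYq nx0 => x [Xx Yx] /Z Gx.
have uq : u x = 0 /\ q x = 0.
  have pu : 0 <= m * k / 2 * sqnorm (u x) by rewrite mulr_ge0 ?sqnorm_ge0// ltW.
  have pq : 0 <= 2^-1 * sqnorm (q x) by rewrite mulr_ge0 ?sqnorm_ge0.
  have ps : 0 <= 4^-1 * sqnorm (s x) by rewrite mulr_ge0 ?sqnorm_ge0.
  move/eqP: Gx; rewrite /G paddr_eq0 ?addr_ge0// paddr_eq0// => /andP[/andP[+ +] _].
  rewrite (mulf_eq0 (m * k / 2)) (mulf_eq0 2^-1) !sqnorm_eq0 (gt_eqF mk0) invr_eq0 pnatr_eq0/=.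
  by move=> /eqP -> /eqP ->.
move: Xx Yx; rewrite uq.1 uq.2 => Xx Yx; split.
- by apply/colP => i; have /matrixP/(_ i 0) := Xx; rewrite !mxE.
- by apply/colP => i; have /matrixP/(_ i 1) := Xx; rewrite !mxE.
- by have /matrixP/(_ 0 0) := Yx; rewrite !mxE.
- by have /matrixP/(_ 0 1) := Yx; rewrite !mxE.
Unshelve. all: by end_near. Qed.

End WeakStability.

(** * Coefficients near the reference state *)

Definition mx_cvg {R : realType} {T : Type} (F : set_system T) m p (M : T -> 'M[R]_(m, p)) (M0 : 'M[R]_(m, p)) :=
  forall i j, M t i j @[t --> F] --> M0 i j.

Section MatrixLimits.
Context {R : realType} {T : Type} {F : set_system T} {FF : Filter F}.
Local Notation mx_cvg := (mx_cvg F).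

Lemma mx_cvg_cst m p (M : 'M[R]_(m, p)) : mx_cvg (fun=> M) M.
Proof. by move=> i j; exact: cvg_cst. Qed.

Lemma mx_cvgD m p (M N : T -> 'M[R]_(m, p)) M0 N0 :
  mx_cvg M M0 -> mx_cvg N N0 -> mx_cvg (fun t => M t + N t) (M0 + N0).
Proof.
move=> cM cN i j; rewrite addmxE; under eq_fun do rewrite addmxE.
by apply: cvgD; [exact: cM|exact: cN].
Qed.

Lemma mx_cvgN m p (M : T -> 'M[R]_(m, p)) M0 : mx_cvg M M0 -> mx_cvg (fun t => - M t) (- M0).
Proof.
move=> cM i j; rewrite oppmxE; under eq_fun do rewrite oppmxE; apply: cvgN; exact: cM.
Qed.

Lemma mx_cvgZ m p (a : T -> R) (M : T -> 'M[R]_(m, p)) (a0 : R) M0 : a t @[t --> F] --> a0 ->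
  mx_cvg M M0 -> mx_cvg (fun t => a t *: M t) (a0 *: M0).
Proof.
move=> ca cM i j; rewrite scalemxE; under eq_fun do rewrite scalemxE.
by apply: cvgM; [exact: ca|exact: cM].
Qed.

Lemma mx_cvgM m p q (M : T -> 'M[R]_(m, p)) (N : T -> 'M[R]_(p, q)) M0 N0 :
  mx_cvg M M0 -> mx_cvg N N0 -> mx_cvg (fun t => M t *m N t) (M0 *m N0).
Proof.
move=> cM cN i j; rewrite mxE; under eq_fun do rewrite mxE.
by apply: cvg_sum_real => k _; apply: cvgM; [exact: cM|exact: cN].
Qed.

Lemma mx_cvg_tr m p (M : T -> 'M[R]_(m, p)) M0 : mx_cvg M M0 -> mx_cvg (fun t => (M t)^T) M0^T.
Proof. by move=> cM i j; rewrite mxE; under eq_fun do rewrite mxE; exact: cM. Qed.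

Lemma mx_cvg_adj p (M : T -> 'M[R]_p) M0 : mx_cvg M M0 -> mx_cvg (fun t => \adj (M t)) (\adj M0).
Proof.
move=> cM i j; rewrite mxE /cofactor; under eq_fun do rewrite mxE /cofactor.
apply: cvgM; first exact: cvg_cst.
by apply: cvg_det => k l; rewrite !mxE; under eq_fun do rewrite !mxE; exact: cM.
Qed.

Lemma cvg_near_neq0 (f : T -> R) a : f t @[t --> F] --> a -> a != 0 -> \forall t \near F, f t != 0.
Proof.
move=> /cvgrPdist_lt/(_ `|a|) + a0; rewrite normr_gt0 => /(_ a0).
by apply: filterS => t; apply: contraTneq => ->; rewrite subr0 ltxx.
Qed.

Lemma cvg_near_lt (f : T -> R) a c : f t @[t --> F] --> a -> a < c -> \forall t \near F, f t < c.
Proof.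
move=> /cvgrPdist_lt/(_ (c - a)) + ac; rewrite subr_gt0 => /(_ ac).
by apply: filterS => t; rewrite ltr_norml => /andP[+ _]; lra.
Qed.

Lemma near_cvg_ext (f g : T -> R) (a : R) : (\forall t \near F, f t = g t) ->
  f t @[t --> F] --> a -> g t @[t --> F] --> a.
Proof.
move=> fg; apply: cvg_trans; apply: near_eq_cvg.
by apply: filterS fg => t ->.
Qed.

Lemma mx_cvg_unit p (M : T -> 'M[R]_p) M0 : mx_cvg M M0 -> M0 \in unitmx ->
  \forall t \near F, M t \in unitmx.
Proof.
move=> cM; rewrite unitmxE unitfE => d0.
apply: filterS (cvg_near_neq0 (cvg_det FF cM) d0) => t; by rewrite unitmxE unitfE.
Qed.

Lemma mx_cvg_inv p (M : T -> 'M[R]_p) M0 : mx_cvg M M0 -> M0 \in unitmx ->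
  mx_cvg (fun t => invmx (M t)) (invmx M0).
Proof.
move=> cM M0u; have U := mx_cvg_unit cM M0u.
have d0 : \det M0 != 0 by rewrite -unitfE -unitmxE.
have E0 : invmx M0 = (\det M0)^-1 *: \adj M0 by rewrite /invmx M0u.
have cd : (\det (M t))^-1 @[t --> F] --> (\det M0)^-1 by apply: cvgV => //; exact: cvg_det.
have := mx_cvgZ cd (mx_cvg_adj cM); rewrite -E0 => H i j; apply: cvg_trans (H i j); apply: near_eq_cvg.
by apply: filterS U => t tU; rewrite /invmx tU.
Qed.

Lemma mx_cvg_fnorm m p (M : T -> 'M[R]_(m, p)) M0 e : mx_cvg M M0 -> 0 < e ->
  \forall t \near F, fnorm (M t - M0) <= e.
Proof.
move=> cM e0; pose d := e / (m * p + 1)%:R.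
have d0 : 0 < d by rewrite divr_gt0// ltr0n addn1.
have : \forall t \near F, forall ij : 'I_m * 'I_p, `|M0 ij.1 ij.2 - M t ij.1 ij.2| <= d.
  by apply: filter_forall => ij; have /cvgrPdist_le/(_ _ d0) := cM ij.1 ij.2.
apply: filterS => t Ht; apply: le_trans (_ : (m * p)%:R * d <= _).
  apply: fnorm_le; first exact: ltW.
  by move=> i j; rewrite addmxE oppmxE distrC; exact: (Ht (i, j)).
by rewrite /d mulrCA ler_piMr ?(ltW e0)// ler_pdivrMr ?ltr0n ?addn1// mul1r ler_nat.
Qed.

Lemma mx_cvg_fnorm_lt m p (M : T -> 'M[R]_(m, p)) M0 c : mx_cvg M M0 -> fnorm M0 < c ->
  \forall t \near F, fnorm (M t) <= c.
Proof.
move=> cM Mc; have := mx_cvg_fnorm cM (_ : 0 < c - fnorm M0); rewrite subr_gt0 => /(_ Mc).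
apply: filterS => t Ht; rewrite -[M t](subrK M0); apply: (le_trans (fnormD _ _)); lra.
Qed.

(** Coercivity is open uniformly in the vector, because the Frobenius norm of the perturbation
    bounds its quadratic form. *)
Lemma mx_cvg_qform p (M : T -> 'M[R]_p.+1) M0 c d : mx_cvg M M0 -> d < c ->
  (forall X : 'cV[R]_p.+1, c * sqnorm X <= qform M0 X) ->
  \forall t \near F, forall X : 'cV[R]_p.+1, d * sqnorm X <= qform (M t) X.
Proof.
move=> cM dc H; have := mx_cvg_fnorm cM (_ : 0 < c - d); rewrite subr_gt0 => /(_ dc).
apply: filterS => t Ht X.
have -> : M t = M0 + (M t - M0) by rewrite addrC subrK.
rewrite qformD; have := H X; have := qform_bound (M t - M0) X; rewrite ler_norml => /andP[+ _].
have : fnorm (M t - M0) * sqnorm X <= (c - d) * sqnorm X by rewrite ler_wpM2r ?sqnorm_ge0.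
lra.
Qed.

End MatrixLimits.

Lemma derivable_coord (R : realType) (E : normedModType R) m (h : E -> 'cV[R]_m) (i : 'I_m) (u v : E) :
  derivable h u v ->
  derivable (fun w => h w i 0) u v /\ 'D_v (fun w => h w i 0) u = ('D_v h u) i 0.
Proof. by move=> dh; split; [exact: (derivable_mxP h u v).1|rewrite derive_mx// mxE]. Qed.

(** * Derivatives of the coefficients and of the speed along curves *)

Section CurveDerivative.
Variables (R : realType) (n' : nat).
Local Notation n := n'.+1.
Local Notation V := 'cV[R]_n.

Lemma C2on_partial_curve_C1 (W : set V) (h : V -> R) (us : V) (j : 'I_n) :
  open W -> W us -> C2on W h -> curve_C1 (nbhs us) us (fun u => 'D_(ebasis R j) h u).
Proof.
move=> oW Wus H; exists (fun u => grad_row ('D_(ebasis R j) h) u); split.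
- have [_ Hu] := H us Wus; have [_ [_ [c _]]] := Hu (ebasis R j) 0; exact: c.
- move=> k.
  have -> : (fun u => grad_row ('D_(ebasis R j) h) u 0 k) = 'D_(ebasis R k) ('D_(ebasis R j) h).
    by apply/funext => u; rewrite mxE.
  rewrite mxE; have [_ Hu] := H us Wus; have [_ [_ [_ c]]] := Hu (ebasis R j) (ebasis R k); exact: c.
- have : \forall u \near us, W u by exact: open_nbhs_nbhs.
  apply: filterS => u Wu gam x gx dg; rewrite -gx; apply: chain_rule_partials => //.
    rewrite gx; have : \forall u \near u, W u by exact: open_nbhs_nbhs.
    by apply: filterS => w Ww k; have [_ Hu] := H w Ww; have [_ []] := Hu (ebasis R j) (ebasis R k).
  move=> k; rewrite gx.
  by have [_ Hu] := H u Wu; have [_ [_ []]] := Hu (ebasis R j) (ebasis R k).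
Qed.

Lemma C2on_partial_coord_curve_C1 m (W : set V) (h : V -> 'cV[R]_m) (us : V) (i : 'I_m) (j : 'I_n) :
  open W -> W us -> C2on W h -> curve_C1 (nbhs us) us (fun u => ('D_(ebasis R j) h u) i 0).
Proof.
move=> oW Wus H; set F := fun u => _.
have part u k : W u -> derivable F u (ebasis R k) /\
    'D_(ebasis R k) F u = ('D_(ebasis R k) ('D_(ebasis R j) h) u) i 0.
  move=> Wu; have [_ Hu] := H u Wu; have [_ [d _]] := Hu (ebasis R j) (ebasis R k).
  by have [d1 d2] := derivable_coord i d; split.
have cc u (k : V -> 'cV[R]_m) (k' : V -> R) : W u -> {for u, continuous k} ->
    (forall y, W y -> k' y = k y i 0) -> {for u, continuous k'}.
  move=> Wu ck Ek; rewrite /prop_for /continuous_at Ek//.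
  have nW : \forall y \near u, W y by exact: open_nbhs_nbhs.
  apply: (@near_cvg_ext _ _ (nbhs u) _ (fun y => k y i 0)).
    by apply: filterS nW => y Wy; rewrite Ek.
  exact: cvg_comp ck (@coord_continuous _ _ _ i 0 (k u)).
have cpart u k : W u -> {for u, continuous ('D_(ebasis R k) F)}.
  move=> Wu; have [_ Hu] := H u Wu; have [_ [_ [_ c]]] := Hu (ebasis R j) (ebasis R k).
  by apply: cc c _ => // y Wy; have [] := part y k Wy.
exists (grad_row F); split.
- have [_ Hu] := H us Wus; have [_ [_ [c _]]] := Hu (ebasis R j) 0; exact: cc c _.
- move=> k; have -> : (fun u => grad_row F u 0 k) = 'D_(ebasis R k) F.
    by apply/funext => u; rewrite mxE.
  by rewrite mxE; exact: cpart.
- have : \forall u \near us, W u by exact: open_nbhs_nbhs.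
  apply: filterS => u Wu gam x gx dg; rewrite -gx; apply: chain_rule_partials => //.
    rewrite gx; have : \forall u \near u, W u by exact: open_nbhs_nbhs.
    by apply: filterS => w Ww k; have [] := part w k Ww.
  by move=> k; rewrite gx; exact: cpart.
Qed.

(** The derivative becomes one map of state and direction, homogeneous in the direction and with a
    joint limit at (us, z0): a profile enters later only through such pairs. *)
Lemma curve_C1mx_derivation m p (us : V) (M : V -> 'M[R]_(m, p)) : curve_C1mx (nbhs us) us M ->
  exists DM : V -> V -> 'M[R]_(m, p),
  [/\ mx_cvg (nbhs us) M (M us),
      forall z0, mx_cvg (nbhs (us, z0)) (fun uz => DM uz.1 uz.2) (DM us z0),
      forall u c z, DM u (c *: z) = c *: DM u z &
      \forall u \near us, forall (gam : R -> V) x, gam x = u -> derivable gam x 1 ->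
        mx_derive x (M \o gam) (DM u (derive1 gam x))].
Proof.
move=> H.
have /choice[G HG] : forall ij : 'I_m * 'I_p, exists g, curve_diff (nbhs us) us (fun u => M u ij.1 ij.2) g.
  by move=> ij; exact: H.
exists (fun u z => \matrix_(i, j) (G (i, j) u *m z) 0 0); split.
- by move=> i j; have [c _ _] := HG (i, j).
- move=> z0 i j; rewrite !mxE; under eq_fun do rewrite !mxE.
  apply: cvg_sum_real => k _; have [_ c _] := HG (i, j); apply: cvgM.
    have c1 : (fst : V * V -> V) @ nbhs (us, z0) --> us by exact: cvg_fst.
    exact: cvg_comp c1 (c k).
  have c2 : (snd : V * V -> V) @ nbhs (us, z0) --> z0 by exact: cvg_snd.
  exact: cvg_comp c2 (@coord_continuous _ _ _ k 0 z0).
- by move=> u c z; apply/matrixP => i j; rewrite scalemxE !mxE mulr_sumr; apply: eq_bigr => k _; rewrite mxE mulrCA.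
- have : \forall u \near us, forall ij, forall (gam : R -> V) x, gam x = u -> derivable gam x 1 ->
      is_derive x 1 ((fun u => M u ij.1 ij.2) \o gam) ((G ij u *m derive1 gam x) 0 0).
    by apply: near_forall => ij; have [_ _] := HG ij.
  apply: filterS => u Hu gam x gx dg i j; rewrite mxE; exact: (Hu (i, j)).
Qed.

(** Differentiating (A - al) R = 0 and pairing with the left eigenvector removes the derivative of
    R. That derivative exists because R, normalized by l R = 1, solves the invertible system (A - al
    + r l) R = r. *)
Lemma eigenvalue_derivative (A : R -> 'M[R]_n) (al : R -> R) (r : V) (l : 'rV[R]_n) (x : R) dA da
    (Lam : 'rV[R]_n) (Rv : V) :
  mx_derive x A dA -> is_derive x 1 al da ->
  (\forall y \near x, exists rr : V, [/\ A y *m rr = al y *: rr & l *m rr = 1%:M]) ->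
  A x - (al x)%:M + r *m l \in unitmx ->
  Lam *m A x = al x *: Lam -> A x *m Rv = al x *: Rv -> l *m Rv = 1%:M ->
  da * (Lam *m Rv) 0 0 = (Lam *m dA *m Rv) 0 0.
Proof.
move=> DA Dal near_ev uN LA AR lR.
(* An eigenvector is chosen point by point, with 0 where none is available; regularity comes
   afterwards from the linear system. *)
have /choice[rr Hrr] : forall y, exists z : V, (exists rr : V, [/\ A y *m rr = al y *: rr & l *m rr = 1%:M]) ->
    A y *m z = al y *: z /\ l *m z = 1%:M.
  move=> y; have [[z [h1 h2]]|h] := pselect (exists rr : V, [/\ A y *m rr = al y *: rr & l *m rr = 1%:M]).
    by exists z.
  by exists 0 => /h.
pose N y := A y - (al y)%:M + r *m l.
have NR y z : A y *m z = al y *: z -> l *m z = 1%:M -> N y *m z = r.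
  by move=> h1 h2; rewrite mulmxDl mulmxBl h1 mul_scalar_mx subrr add0r -mulmxA h2 mulmx1.
have Dsc : mx_derive x (fun y => (al y)%:M : 'M[R]_n) (da%:M).
  move=> i j; rewrite mxE; under eq_fun do rewrite mxE; case: (i == j).
    by rewrite mulr1n; under eq_fun do rewrite mulr1n.
  by rewrite mulr0n; under eq_fun do rewrite mulr0n; exact: is_derive_cst.
have DN := mx_deriveD (mx_deriveD DA (mx_deriveN Dsc)) (mx_derive_cst x (r *m l)).
have [dR DR] : exists dR, mx_derive x rr dR.
  apply: (linear_system_derive (mx_derive_derivable DN)
    (mx_derive_derivable (mx_derive_cst x r))); first by rewrite -unitfE -unitmxE.
  by apply: filterS near_ev => y /Hrr[h1 h2]; exact: NR.
have [h1 h2] : A x *m rr x = al x *: rr x /\ l *m rr x = 1%:M.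
  by apply: Hrr; exact: nbhs_singleton near_ev.
have rrx : rr x = Rv.
  by apply: (can_inj (mulKmx uN)); rewrite (NR x (rr x)) // (NR x Rv).
have D1 := mx_deriveD (mx_derive_mul DA DR) (mx_deriveN (mx_derive_scale Dal DR)).
have D0 : mx_derive x (fun y => A y *m rr y - al y *: rr y) (0 : V).
  move=> i j; apply: near_eq_is_derive (mx_derive_cst x (0 : V) i j).
  by apply: filterS near_ev => y /Hrr[e1 _]; rewrite e1 subrr.
have := congr1 (mulmx Lam) (mx_derive_uniq D1 D0).
rewrite mulmx0 !mulmxDr mulmxN mulmxDr -!scalemxAr !mulmxA LA rrx -scalemxAl opprD addrACA subrr addr0.
by move=> /matrixP/(_ 0 0); rewrite addmxE oppmxE scalemxE [RHS]mxE => /eqP; rewrite subr_eq0 => /eqP ->.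
Qed.

End CurveDerivative.

Section FrozenCoefficients.
Variables (R : realType) (n' : nat).
Local Notation n := n'.+1.
Local Notation V := 'cV[R]_n.

(** With N = A - a + r l, a left eigenvector satisfies ll N = (ll r) l, and ll r is nonzero since N
    is invertible. Pairing ll with N z = r gives l z = 1, and then (A - a) z = r - r = 0. *)
Lemma deflated_right_eigenvector (A : 'M[R]_n) (a : R) (r : V) (l ll : 'rV[R]_n) :
  A - a%:M + r *m l \in unitmx -> ll != 0 -> ll *m A = a *: ll ->
  let z := invmx (A - a%:M + r *m l) *m r in l *m z = 1%:M /\ A *m z = a *: z.
Proof.
set N := _ + _ => uN ll0 lA /=; set z := _ *m r.
have Nz : N *m z = r by rewrite mulKVmx.
have lN : ll *m N = (ll *m r) *m l.
  by rewrite mulmxDr mulmxBr lA mul_mx_scalar subrr add0r mulmxA.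
have lr0 : (ll *m r) 0 0 != 0.
  apply: contraNneq ll0 => lr0; have E : ll *m N = 0 by rewrite lN [ll *m r]mx11_scalar lr0 raddf0 mul0mx.
  by rewrite -(mulmxK uN ll) E mul0mx.
have lz : l *m z = 1%:M.
  have := congr1 (mulmx ll) Nz; rewrite mulmxA lN -mulmxA [ll *m r]mx11_scalar [l *m z]mx11_scalar.
  move: lr0; move: ((ll *m r) 0 0) ((l *m z) 0 0) => c d c0.
  rewrite -scalar_mxM => /matrixP/(_ 0 0); rewrite !mxE eqxx !mulr1n => E.
  by congr (_%:M); apply: (mulfI c0); rewrite mulr1.
split=> //; have := Nz; rewrite mulmxDl -mulmxA lz mulmx1 mulmxBl mul_scalar_mx.
by move=> /eqP; rewrite addrC -subr_eq0 addrAC subrr add0r subr_eq0 => /eqP.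
Qed.

Lemma deflated_left_eigenvector (A : 'M[R]_n) (a : R) (r rr : V) (l : 'rV[R]_n) :
  A - a%:M + r *m l \in unitmx -> rr != 0 -> A *m rr = a *: rr ->
  let z := l *m invmx (A - a%:M + r *m l) in z *m r = 1%:M /\ z *m A = a *: z.
Proof.
move=> uN rr0 Ar z.
have NT : (A - a%:M + r *m l)^T = A^T - a%:M + l^T *m r^T.
  by rewrite linearD/= linearB/= tr_scalar_mx trmx_mul.
have uNT : A^T - a%:M + l^T *m r^T \in unitmx by rewrite -NT unitmx_tr.
have rrT0 : rr^T != 0 by rewrite -trmx0 (inj_eq trmx_inj).
have rrA : rr^T *m A^T = a *: rr^T by rewrite -trmx_mul Ar linearZ.
have [z1 z2] := deflated_right_eigenvector uNT rrT0 rrA.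
have zT : z^T = invmx (A^T - a%:M + l^T *m r^T) *m l^T by rewrite trmx_mul trmx_inv NT.
rewrite -zT in z1 z2; split; apply: trmx_inj; rewrite trmx_mul.
  by rewrite z1 tr_scalar_mx.
by rewrite z2 linearZ.
Qed.

Lemma mx_cvg_fst m p (M : V -> 'M[R]_(m, p)) M0 (us z0 : V) : mx_cvg (nbhs us) M M0 ->
  mx_cvg (nbhs (us, z0)) (fun uz => M uz.1) M0.
Proof.
move=> H i j; have c1 : (fst : V * V -> V) @ nbhs (us, z0) --> us by exact: cvg_fst.
exact: cvg_comp c1 (H i j).
Qed.

Lemma near_fst (P : V -> Prop) (us z0 : V) : (\forall u \near us, P u) ->
  \forall uz \near (us, z0), P uz.1.
Proof.
have c1 : (fst : V * V -> V) @ nbhs (us, z0) --> us by exact: cvg_fst.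
exact: c1.
Qed.

Section Deflation.
Variables (A : V -> 'M[R]_n) (ap : V -> R) (us r : V) (l : 'rV[R]_n).

(** A - ap is singular, but this matrix stays invertible near [us], so that eigenvectors become
    solutions of linear systems and depend continuously on the state. The rank-one term is frozen at
    [us], since no continuity of the given eigenvectors is available. *)
Definition deflation u := A u - (ap u)%:M + r *m l.
Definition right_ev u : V := invmx (deflation u) *m r.
Definition left_ev u : 'rV[R]_n := l *m invmx (deflation u).

(* First-order perturbation formula for the derivative of the simple eigenvalue [ap] along [z]. *)
Definition speed_derivative (DA : V -> V -> 'M[R]_n) (u z : V) : R :=
  (left_ev u *m DA u z *m right_ev u) 0 0 / (left_ev u *m right_ev u) 0 0.

Hypothesis cA : mx_cvg (nbhs us) A (A us).
Hypothesis cap : ap u @[u --> us] --> ap us.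
Hypothesis eigs : \forall u \near us, exists (rr : V) (ll : 'rV[R]_n),
  [/\ A u *m rr = ap u *: rr, ll *m A u = ap u *: ll & ll *m rr = 1%:M].
Hypothesis Ar : A us *m r = ap us *: r.
Hypothesis lA : l *m A us = ap us *: l.
Hypothesis lr : l *m r = 1%:M.
Hypothesis uN : deflation us \in unitmx.

Lemma deflation_cvg : mx_cvg (nbhs us) deflation (deflation us).
Proof.
apply: mx_cvgD; last exact: mx_cvg_cst.
apply: mx_cvgD => //; apply: mx_cvgN => i j; rewrite mxE; under eq_fun do rewrite mxE.
case: (i == j); first by rewrite mulr1n; under eq_fun do rewrite mulr1n.
by rewrite mulr0n; under eq_fun do rewrite mulr0n; exact: cvg_cst.
Qed.

Lemma deflation_base : right_ev us = r /\ left_ev us = l.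
Proof.
split; [apply: (can_inj (mulKmx uN))|apply: (can_inj (mulmxK uN))].
  rewrite /right_ev mulKVmx// /deflation mulmxDl mulmxBl Ar mul_scalar_mx subrr add0r.
  by rewrite -mulmxA lr mulmx1.
rewrite /left_ev mulmxKV// /deflation mulmxDr mulmxBr lA mul_mx_scalar subrr add0r.
by rewrite mulmxA lr mul1mx.
Qed.

Lemma right_ev_cvg : mx_cvg (nbhs us) right_ev r.
Proof.
rewrite -deflation_base.1; apply: mx_cvgM; last exact: mx_cvg_cst.
exact: mx_cvg_inv deflation_cvg uN.
Qed.

Lemma left_ev_cvg : mx_cvg (nbhs us) left_ev l.
Proof.
rewrite -deflation_base.2; apply: mx_cvgM; first exact: mx_cvg_cst.
exact: mx_cvg_inv deflation_cvg uN.
Qed.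

Lemma lr_cvg : (left_ev u *m right_ev u) 0 0 @[u --> us] --> (1 : R).
Proof.
have : mx_cvg (nbhs us) (fun u => left_ev u *m right_ev u) (l *m r).
  by exact: mx_cvgM left_ev_cvg right_ev_cvg.
by move=> /(_ 0 0); rewrite lr mxE eqxx mulr1n.
Qed.

Lemma near_eigenvectors : \forall u \near us,
  [/\ deflation u \in unitmx, A u *m right_ev u = ap u *: right_ev u, l *m right_ev u = 1%:M,
      left_ev u *m A u = ap u *: left_ev u & (left_ev u *m right_ev u) 0 0 != 0].
Proof.
have U : \forall u \near us, deflation u \in unitmx by exact: mx_cvg_unit deflation_cvg uN.
have N0 : \forall u \near us, (left_ev u *m right_ev u) 0 0 != 0.
  by exact: cvg_near_neq0 lr_cvg (oner_neq0 R).
apply: filterS3 eigs U N0 => u [rr [ll [e1 e2 e3]]] Uu lr0.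
have rr0 : rr != 0.
  by apply/eqP => E; move/matrixP/(_ 0 0): e3; rewrite E mulmx0 !mxE eqxx mulr1n => /esym/eqP; rewrite oner_eq0.
have ll0 : ll != 0.
  by apply/eqP => E; move/matrixP/(_ 0 0): e3; rewrite E mul0mx !mxE eqxx mulr1n => /esym/eqP; rewrite oner_eq0.
have [h1 h2] := deflated_right_eigenvector Uu ll0 e2.
by have [h3 h4] := deflated_left_eigenvector Uu rr0 e1.
Qed.

(** Existence of the derivative of the speed along the curve is assumed and only its value is
    identified. This fits both the line of (H2) and the profile. *)
Lemma speed_derivativeP (DA : V -> V -> 'M[R]_n) :
  (\forall u \near us, forall (gam : R -> V) x, gam x = u -> derivable gam x 1 ->
        mx_derive x (A \o gam) (DA u (derive1 gam x))) ->
  \forall u \near us, forall (gam : R -> V) (x da : R), gam x = u -> derivable gam x 1 ->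
    is_derive x 1 (ap \o gam) da -> da = speed_derivative DA u (derive1 gam x).
Proof.
move=> HD.
pose P u := [/\ deflation u \in unitmx, A u *m right_ev u = ap u *: right_ev u,
  l *m right_ev u = 1%:M, left_ev u *m A u = ap u *: left_ev u & (left_ev u *m right_ev u) 0 0 != 0].
(* Differentiation needs eigenvectors along the curve near [x], hence at all states near [u] and not
   only at [u]. *)
have E : \forall u \near us, P u := near_eigenvectors; have EE := near_join E.
apply: filterS3 HD E EE => u Hu [Uu h1 h2 h3 h4] En gam x da gx dg Dap.
have cg : {for x, continuous gam}.
  have /derivable1_diffP dd := dg; exact: differentiable_continuous dd.
have := @eigenvalue_derivative _ _ (A \o gam) (ap \o gam) r l x _ da (left_ev u) (right_ev u)
  (Hu gam x gx dg) Dap.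
rewrite /= gx => H; rewrite /speed_derivative -H ?mulfK//.
have : \forall y \near x, P (gam y) by apply: (cg P); rewrite gx.
by apply: filterS => y [_ e1 e2 _ _]; exists (right_ev (gam y)).
Qed.

Lemma speed_derivative_cvg (DA : V -> V -> 'M[R]_n) :
  mx_cvg (nbhs (us, r)) (fun uz => DA uz.1 uz.2) (DA us r) ->
  speed_derivative DA uz.1 uz.2 @[uz --> (us, r)] --> (l *m DA us r *m r) 0 0.
Proof.
move=> cD; rewrite -[X in _ --> X]divr1.
have : mx_cvg (nbhs (us, r)) (fun uz => left_ev uz.1 *m DA uz.1 uz.2 *m right_ev uz.1)
    (l *m DA us r *m r).
  by exact: mx_cvgM (mx_cvgM (mx_cvg_fst r left_ev_cvg) cD) (mx_cvg_fst r right_ev_cvg).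
move=> /(_ 0 0) H1.
have c1 : (fst : V * V -> V) @ nbhs (us, r) --> us by exact: cvg_fst.
have H2 : (left_ev uz.1 *m right_ev uz.1) 0 0 @[uz --> (us, r)] --> (1 : R) := cvg_comp _ _ c1 lr_cvg.
exact: cvgM H1 (cvgV (oner_neq0 R) H2).
Qed.

End Deflation.

End FrozenCoefficients.

Lemma mx_derive_derive1 (R : realType) m p (x : R) (F : R -> 'M[R]_(m, p)) dF :
  mx_derive x F dF -> derivable F x 1 /\ derive1 F x = dF.
Proof.
move=> D; have dF' : derivable F x 1.
  by apply/derivable_mxP => i j; have := D i j => ?; exact: ex_derive.
split=> //; rewrite derive1E derive_mx//; apply/matrixP => i j; rewrite mxE.
exact: (@derive_val _ _ _ _ _ _ _ (D i j)).
Qed.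

(** The weight of the compensator: the three bounds cover the |B u|^2 it costs, its indefinite
    contribution proportional to Re lambda, and its cross term with q. *)
Lemma weight_exists (R : realFieldType) (N C e k : R) : 0 <= N -> 0 <= C -> 0 < e -> 0 < k ->
  exists m : R, [/\ 0 < m, m * N <= 4^-1, m * C <= e & m * C ^+ 2 <= k / 2].
Proof.
move=> N0 C0 e0 k0; pose y := 4 * N + C / e + 2 * C ^+ 2 / k + 1.
have t2 : 0 <= C / e by rewrite divr_ge0// ltW.
have t3 : 0 <= 2 * C ^+ 2 / k by apply: divr_ge0; [rewrite mulr_ge0 ?sqr_ge0|exact: ltW].
have y0 : 0 < y by rewrite /y; lra.
exists y^-1; split; first by rewrite invr_gt0.
- by rewrite mulrC ler_pdivrMr// /y; lra.
- by rewrite mulrC ler_pdivrMr// -ler_pdivrMl// mulrC /y; lra.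
- rewrite mulrC ler_pdivrMr//.
  have {1}-> : C ^+ 2 = k / 2 * (2 * C ^+ 2 / k) by field; rewrite gt_eqF.
  by rewrite ler_pM2l ?divr_gt0// /y; lra.
Qed.

(** The size allowed to the errors that vanish with the amplitude; it is chosen after the weight m,
    since they must be absorbed by m k |u|^2. *)
Lemma margin_exists (R : realFieldType) (C h m k : R) : 0 < h -> 0 < m -> 0 < k ->
  exists d : R, [/\ 0 < d, d <= 2^-1, d * C ^+ 2 / (2 * h) <= 4^-1 & d <= m * k / 4].
Proof.
move=> h0 m0 k0; have mk0 : 0 < m * k by rewrite mulr_gt0.
pose y := 2 + 2 * C ^+ 2 / h + 4 / (m * k).
have t1 : 0 <= 2 * C ^+ 2 / h by apply: divr_ge0; [rewrite mulr_ge0 ?sqr_ge0|exact: ltW].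
have t2 : 0 <= 4 / (m * k) by apply: divr_ge0; [|exact: ltW].
have y0 : 0 < y by rewrite /y; lra.
exists y^-1; split; first by rewrite invr_gt0.
- by rewrite lef_pV2 ?posrE// /y; lra.
- have -> : y^-1 * C ^+ 2 / (2 * h) = (2 * C ^+ 2 / h / 4) / y by field; rewrite !gt_eqF.
  by rewrite ler_pdivrMr// /y; lra.
- have -> : m * k / 4 = (4 / (m * k))^-1 by field; rewrite !gt_eqF.
  by rewrite lef_pV2 ?posrE ?divr_gt0// /y; lra.
Qed.

Lemma half_lt (R : realFieldType) (x : R) : 0 < x -> x / 2 < x.
Proof. by move=> x0; lra. Qed.

Lemma lt_sum4 (R : realDomainType) (a b c d : R) : 0 <= a -> 0 <= b -> 0 <= c -> 0 <= d ->
  [/\ a < a + b + c + d + 1, b < a + b + c + d + 1, c < a + b + c + d + 1,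
      d < a + b + c + d + 1 & 1 <= a + b + c + d + 1].
Proof. by move=> *; split; lra. Qed.

(** * Uniform coefficient bounds near the reference state and direction *)

Section NearCoefficients.
Variables (R : realType) (n' : nat).
Local Notation n := n'.+1.
Local Notation V := 'cV[R]_n.
Variables (A S : V -> 'M[R]_n) (B : V -> 'rV[R]_n) (ap : V -> R) (us r L : V) (l : 'rV[R]_n) (ds : R).

Hypothesis C1A : curve_C1mx (nbhs us) us A.
Hypothesis C1S : curve_C1mx (nbhs us) us S.
Hypothesis C1B : curve_C1mx (nbhs us) us B.
Hypothesis cap : ap u @[u --> us] --> ap us.
Hypothesis ap0 : ap us = 0.
Hypothesis eigs : \forall u \near us, exists (rr : V) (ll : 'rV[R]_n),
  [/\ A u *m rr = ap u *: rr, ll *m A u = ap u *: ll & ll *m rr = 1%:M].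
Hypothesis Ar : A us *m r = ap us *: r.
Hypothesis lA : l *m A us = ap us *: l.
Hypothesis lr : l *m r = 1%:M.
Hypothesis uN : deflation A ap r l us \in unitmx.
Hypothesis pS : posdef_mx (S us).
Hypothesis near_S : \forall u \near us,
  [/\ (S u)^T = S u, (S u *m A u)^T = S u *m A u & S u *m L = (B u)^T].
Hypothesis obs : obsmx (A us) (B us) \in unitmx.
Hypothesis dap : is_derive (0 : R) 1 (fun t : R => ap (us + t *: r)) ds.
Hypothesis ds0 : ds != 0.

(** As S A = A^T S, the row (S r)^T annihilates A; invertibility of the deflated matrix forces it to
    be a multiple of [l], and pairing with r gives the factor. *)
Lemma kernel_symmetrizer : (S us *m r)^T = qform (S us) r *: l.
Proof.
have [sS sSA _] := nbhs_singleton near_S.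
apply: (can_inj (mulmxK uN)); rewrite /deflation ap0 raddf0 subr0.
have SrA : (S us *m r)^T *m A us = 0.
  by rewrite trmx_mul sS -mulmxA -sSA trmx_mul sS mulmxA -trmx_mul Ar ap0 scale0r trmx0 mul0mx.
rewrite mulmxDr SrA add0r -scalemxAl mulmxDr lA ap0 scale0r add0r !mulmxA lr mul1mx.
rewrite [(S us *m r)^T *m r]mx11_scalar mul_scalar_mx; congr ((_ : R) *: _).
by rewrite trmx_mul sS.
Qed.

(** On the kernel the unknown derivative [S1] drops out because A r = 0, and r^T S = (r^T S r) l
    reduces the form to - (r^T S r)(l A1 r). *)
Lemma finsler_form_pos (A1 S1 : 'M[R]_n) : (l *m A1 *m r) 0 0 = -1 ->
  0 < qform (- (S1 *m A us + S us *m A1)) r.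
Proof.
move=> lA1; have r0 : r != 0.
  by apply/eqP => E; move/matrixP/(_ 0 0): lr; rewrite E mulmx0 !mxE eqxx mulr1n => /esym/eqP; rewrite oner_eq0.
have E : - (S1 *m A us + S us *m A1) *m r = - (S us *m (A1 *m r)).
  by rewrite mulNmx mulmxDl -!mulmxA Ar ap0 scale0r mulmx0 add0r.
rewrite /qform -mulmxA E mulmxN !mulmxA.
have [sS _ _] := nbhs_singleton near_S.
have -> : r^T *m S us = (S us *m r)^T by rewrite trmx_mul sS.
rewrite kernel_symmetrizer -!scalemxAl oppmxE scalemxE lA1 mulrN1 opprK.
exact: pS.2.
Qed.

(** At (us, r) all terms carrying M ap vanish, so [Emx] reduces to S and [Hmx] to the form of
    Finsler's lemma. The strict bounds there survive nearby with halved constants. The coefficients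
    are frozen as constant functions, and the evaluation point 0 is a dummy. *)
Lemma near_coefficients : exists (Ah Sh : V -> V -> 'M[R]_n) (Bh : V -> V -> 'rV[R]_n)
    (M : R) (K : 'M[R]_n) (dv dl h e Cz Ck N k m cA : R),
  [/\ dissipative dl h e Cz Ck N k m, K^T = - K, 0 < dv &
  \forall uz \near (us, r),
    [/\ forall (gam : R -> V) (x c da : R), gam x = uz.1 -> derivable gam x 1 ->
          derive1 gam x = c *: uz.2 -> is_derive x 1 (ap \o gam) da ->
          [/\ mx_derive x (A \o gam) (- da *: Ah uz.1 uz.2),
              mx_derive x (S \o gam) (- da *: Sh uz.1 uz.2) &
              mx_derive x (B \o gam) (- da *: Bh uz.1 uz.2)],
        [/\ (S uz.1)^T = S uz.1, (S uz.1 *m A uz.1)^T = S uz.1 *m A uz.1 & S uz.1 *m L = (B uz.1)^T],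
        forall v, 0 <= v <= dv -> fnorm (v *: Ah uz.1 uz.2) <= cA /\
          coefficient_bounds (fun=> A uz.1) (fun=> S uz.1) (fun=> B uz.1) (fun=> Ah uz.1 uz.2)
            (fun=> Sh uz.1 uz.2) (fun=> Bh uz.1 uz.2) (fun=> ap uz.1) (fun=> v) L M K dl h e Cz Ck N k 0 &
        [/\ fnorm (A uz.1) <= cA, fnorm (B uz.1) <= cA, fnorm (S uz.1) <= cA & `|M * ap uz.1| <= cA]]].
Proof.
have [DA [cA cDA linA derA]] := curve_C1mx_derivation C1A.
have [DS [cS cDS linS derS]] := curve_C1mx_derivation C1S.
have [DB [cB cDB linB derB]] := curve_C1mx_derivation C1B.
pose D := speed_derivative A ap r l DA.
have nD := speed_derivativeP cA cap eigs Ar lA lr uN derA.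
(* The straight line through [us] in the direction [r] identifies the derivative in (H2) with the
   perturbation formula at the base point. *)
have dsE : (l *m DA us r *m r) 0 0 = ds.
  pose gam (t : R) : V := us + t *: r.
  have g0 : gam 0 = us by rewrite /gam scale0r addr0.
  have := mx_deriveD (mx_derive_cst 0 us) (mx_derive_scale (is_derive_id (0 : R) 1) (mx_derive_cst 0 r)).
  rewrite scale0r addr0 scale1r add0r => /mx_derive_derive1[dg dg1].
  have := nbhs_singleton nD gam 0 ds g0 dg dap; rewrite dg1 /speed_derivative => ->.
  have [-> ->] := deflation_base Ar lA lr uN.
  by rewrite lr [1%:M 0 0]mxE eqxx mulr1n divr1.
have cD : D uz.1 uz.2 @[uz --> (us, r)] --> ds.
  by rewrite -dsE; exact: (speed_derivative_cvg cA cap Ar lA lr uN (cDA r)).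
pose Ah u z := - (D u z)^-1 *: DA u z.
pose Sh u z := - (D u z)^-1 *: DS u z.
pose Bh u z := - (D u z)^-1 *: DB u z.
have cDi : - (D uz.1 uz.2)^-1 @[uz --> (us, r)] --> - ds^-1 by exact: cvgN (cvgV ds0 cD).
pose A1 := - ds^-1 *: DA us r; pose S1 := - ds^-1 *: DS us r; pose B1 := - ds^-1 *: DB us r.
have cAh : mx_cvg (nbhs (us, r)) (fun uz => Ah uz.1 uz.2) A1 by exact: mx_cvgZ cDi (cDA r).
have cSh : mx_cvg (nbhs (us, r)) (fun uz => Sh uz.1 uz.2) S1 by exact: mx_cvgZ cDi (cDS r).
have cBh : mx_cvg (nbhs (us, r)) (fun uz => Bh uz.1 uz.2) B1 by exact: mx_cvgZ cDi (cDB r).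
have cA' : mx_cvg (nbhs (us, r)) (fun uz => A uz.1) (A us) by exact: mx_cvg_fst.
have cS' : mx_cvg (nbhs (us, r)) (fun uz => S uz.1) (S us) by exact: mx_cvg_fst.
have cB' : mx_cvg (nbhs (us, r)) (fun uz => B uz.1) (B us) by exact: mx_cvg_fst.
have c1 : (fst : V * V -> V) @ nbhs (us, r) --> us by exact: cvg_fst.
have cap' : ap uz.1 @[uz --> (us, r)] --> (0 : R) by rewrite -ap0; exact: cvg_comp c1 cap.
have lA1 : (l *m A1 *m r) 0 0 = -1.
  by rewrite /A1 -scalemxAr -scalemxAl scalemxE dsE mulNr mulVf.
have Ar0 : A us *m r = 0 by rewrite Ar ap0 scale0r.
have uN0 : A us + r *m l \in unitmx by have := uN; rewrite /deflation ap0 raddf0 subr0.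
have [M [h0 [M0 h00 Hf]]] := finsler Ar0 lr uN0 pS (finsler_form_pos S1 lA1).
have [eS eS0 HS] := posdef_coercive pS.
have [K [N [k0 [skK N0 k00 HK]]]] := compensator obs.
have cMap : M * ap uz.1 @[uz --> (us, r)] --> M * 0 by apply: cvgM; [exact: cvg_cst|exact: cap'].
pose Hs := - (S1 *m A us + S us *m A1) + M *: (S us *m A us *m A us)
  - (M * 0) *: (S1 *m A us *m A us + S us *m A1 *m A us + S us *m A us *m A1).
pose HH (uz : V * V) := - (Sh uz.1 uz.2 *m A uz.1 + S uz.1 *m Ah uz.1 uz.2)
   + M *: (S uz.1 *m A uz.1 *m A uz.1) - (M * ap uz.1) *: (Sh uz.1 uz.2 *m A uz.1 *m A uz.1
   + S uz.1 *m Ah uz.1 uz.2 *m A uz.1 + S uz.1 *m A uz.1 *m Ah uz.1 uz.2).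
have cH : mx_cvg (nbhs (us, r)) HH Hs.
  apply: mx_cvgD; first apply: mx_cvgD.
  - by apply: mx_cvgN; apply: mx_cvgD; apply: mx_cvgM.
  - by apply: mx_cvgZ; [exact: cvg_cst|apply: mx_cvgM => //; exact: mx_cvgM].
  - apply: mx_cvgN; apply: mx_cvgZ => //.
    by apply: mx_cvgD; [apply: mx_cvgD|]; apply: mx_cvgM => //; exact: mx_cvgM.
have [sS sSA _] := nbhs_singleton near_S.
have qH X : h0 * sqnorm X <= qform Hs X.
  apply: (le_trans (Hf X)); rewrite /Hs mulr0 scale0r subr0 qformD lerD2l qformZ ler_wpM2l//.
  by rewrite /qform trmx_mul -sSA trmx_mul sS !mulmxA.
pose Ef (uz : V * V) := S uz.1 + (M * ap uz.1) *: (S uz.1 *m A uz.1).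
have cE : mx_cvg (nbhs (us, r)) Ef
    (S us + (M * 0) *: (S us *m A us)).
  by apply: mx_cvgD => //; apply: mx_cvgZ => //; exact: mx_cvgM.
have qE X : eS * sqnorm X <= qform (S us + (M * 0) *: (S us *m A us)) X.
  by rewrite mulr0 scale0r addr0; exact: HS.
pose Kf (uz : V * V) := K *m A uz.1 + N *: ((B uz.1)^T *m B uz.1).
have cKK : mx_cvg (nbhs (us, r)) Kf
    (K *m A us + N *: ((B us)^T *m B us)).
  apply: mx_cvgD; first by apply: mx_cvgM => //; exact: mx_cvg_cst.
  by apply: mx_cvgZ; [exact: cvg_cst|apply: mx_cvgM => //; exact: mx_cvg_tr].
have qKK X : k0 * sqnorm X <= qform (K *m A us + N *: ((B us)^T *m B us)) X.
  by apply: (le_trans (HK X)); rewrite qformD lerD2l qformZ qform_rank1 expr2.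
pose Zs := B1 - M *: (B us *m A us) + (M * 0) *: (B1 *m A us + B us *m A1).
pose Zf (uz : V * V) := Bh uz.1 uz.2 - M *: (B uz.1 *m A uz.1)
    + (M * ap uz.1) *: (Bh uz.1 uz.2 *m A uz.1 + B uz.1 *m Ah uz.1 uz.2).
have cZ : mx_cvg (nbhs (us, r)) Zf Zs.
  apply: mx_cvgD; first apply: mx_cvgD => //.
    by apply: mx_cvgN; apply: mx_cvgZ; [exact: cvg_cst|exact: mx_cvgM].
  by apply: mx_cvgZ => //; apply: mx_cvgD; exact: mx_cvgM.
have cBA : mx_cvg (nbhs (us, r)) (fun uz => (M * ap uz.1) *: (B uz.1 *m A uz.1)) ((M * 0) *: (B us *m A us)).
  by apply: mx_cvgZ => //; exact: mx_cvgM.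
pose Ts := 2^-1 *: (S1 *m A us - S us *m A1).
have cT : mx_cvg (nbhs (us, r)) (fun uz => 2^-1 *: (Sh uz.1 uz.2 *m A uz.1 - S uz.1 *m Ah uz.1 uz.2)) Ts.
  apply: mx_cvgZ; first exact: cvg_cst.
  by apply: mx_cvgD; [|apply: mx_cvgN]; exact: mx_cvgM.
pose h := h0 / 2; pose e := eS / 2; pose k := k0 / 2.
have h_gt0 : 0 < h by rewrite divr_gt0.
have e_gt0 : 0 < e by rewrite divr_gt0.
have k_gt0 : 0 < k by rewrite divr_gt0.
pose Cz := fnorm Zs + 1; pose c4 := fnorm Ts + 1.
pose Ck := fnorm K + fnorm (K *m L).
have Ck0 : 0 <= Ck by rewrite addr_ge0 ?fnorm_ge0.
have [m [m0 mN mC mC2]] : exists m : R, [/\ 0 < m, m * N <= 4^-1, m * Ck <= e & m * Ck ^+ 2 <= k / 2].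
  exact: weight_exists.
have [dl [dl0 dl2 dlZ dlk]] : exists dl : R, [/\ 0 < dl, dl <= 2^-1,
    dl * Cz ^+ 2 / (2 * h) <= 4^-1 & dl <= m * k / 4].
  exact: margin_exists.
have c41 : 1 <= c4 by rewrite lerDr fnorm_ge0.
have c40 : 0 < c4 by exact: lt_le_trans c41.
(* The matrix bounded by [c4] does not tend to 0; its contribution is small only through the factor
   v, hence a separate bound on v. *)
pose dv := dl / c4; have dv0 : 0 < dv by rewrite divr_gt0.
have dvdl : dv <= dl by rewrite ler_pdivrMr// ler_peMr// ltW.
pose a0 := fnorm (A us) + fnorm (B us) + fnorm (S us) + fnorm A1 + 1.
have [aA aB aS aA1 a1] := lt_sum4 (fnorm_ge0 (A us)) (fnorm_ge0 (B us)) (fnorm_ge0 (S us)) (fnorm_ge0 A1).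
have dv1 : dv <= 1 by apply: (le_trans dvdl); apply: (le_trans dl2); rewrite invf_le1// ler1n.
exists Ah, Sh, Bh, M, K, dv, dl, h, e, Cz, Ck, N, k, m, a0; split => //.
  by split => //; split => //; rewrite mC andbT mulr_ge0// ltW.
have N1 : \forall uz \near (us, r), D uz.1 uz.2 != 0 by exact: cvg_near_neq0 cD ds0.
have N2 := near_fst r nD.
have N3 := near_fst r derA.
have N4 := near_fst r derS.
have N5 := near_fst r derB.
have N6 := near_fst r near_S.
have N7 : \forall uz \near (us, r), forall X : V, h * sqnorm X <= qform (HH uz) X.
  by apply: (mx_cvg_qform cH _ qH); exact: half_lt.
have N8 : \forall uz \near (us, r), forall X : V, e * sqnorm X <= qform (Ef uz) X.
  by apply: (mx_cvg_qform cE _ qE); exact: half_lt.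
have N9 : \forall uz \near (us, r), forall X : V, e * sqnorm X <= qform (S uz.1) X.
  by apply: (mx_cvg_qform cS' _ HS); exact: half_lt.
have N10 : \forall uz \near (us, r), forall X : V, k * sqnorm X <= qform (Kf uz) X.
  by apply: (mx_cvg_qform cKK _ qKK); exact: half_lt.
have N11 : \forall uz \near (us, r), fnorm (Zf uz) <= Cz.
  by apply: (mx_cvg_fnorm_lt cZ); rewrite /Cz ltrDl.
have N12 : \forall uz \near (us, r), fnorm ((M * ap uz.1) *: (B uz.1 *m A uz.1)) <= dl.
  by apply: (mx_cvg_fnorm_lt cBA); rewrite mulr0 scale0r /fnorm (eqP (_ : sqnorm 0 == 0)) ?sqnorm_eq0// sqrtr0.
have N13 : \forall uz \near (us, r), fnorm (2^-1 *: (Sh uz.1 uz.2 *m A uz.1 - S uz.1 *m Ah uz.1 uz.2)) <= c4.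
  by apply: (mx_cvg_fnorm_lt cT); rewrite /c4 ltrDl.
have N14 : \forall uz \near (us, r), fnorm (A uz.1) <= a0.
  by apply: (mx_cvg_fnorm_lt cA').
have N15 : \forall uz \near (us, r), fnorm (B uz.1) <= a0.
  by apply: (mx_cvg_fnorm_lt cB').
have N16 : \forall uz \near (us, r), fnorm (S uz.1) <= a0.
  by apply: (mx_cvg_fnorm_lt cS').
have N17 : \forall uz \near (us, r), fnorm (Ah uz.1 uz.2) <= a0.
  by apply: (mx_cvg_fnorm_lt cAh).
have N18 : \forall uz \near (us, r), `|M * ap uz.1| < 1.
  by apply: cvg_near_lt (cvg_norm cMap) _; rewrite mulr0 normr0.
near=> uz.
split.
- move=> gam x c da gx dg g1 Dap.
  have D0 : D uz.1 uz.2 != 0 by near: uz.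
  (* Homogeneity in the direction makes [da] and the matrix derivatives multiples of the same [c],
     which is eliminated without dividing by it; points with c = 0 need no special care. *)
  have daE : da = c * D uz.1 uz.2.
    have H2 : forall (gam : R -> V) (x da : R), gam x = uz.1 -> derivable gam x 1 ->
      is_derive x 1 (ap \o gam) da -> da = speed_derivative A ap r l DA uz.1 (derive1 gam x) by near: uz.
    rewrite (H2 gam x da gx dg Dap) g1 /D /speed_derivative linA -scalemxAr -scalemxAl scalemxE mulrA//.
  have ce p q (P : 'M[R]_(p, q)) : c *: P = - da *: (- (D uz.1 uz.2)^-1 *: P).
    by rewrite scalerA mulrNN daE mulfK.
  have H3 : forall (gam : R -> V) x, gam x = uz.1 -> derivable gam x 1 ->
    mx_derive x (A \o gam) (DA uz.1 (derive1 gam x)) by near: uz.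
  have H4 : forall (gam : R -> V) x, gam x = uz.1 -> derivable gam x 1 ->
    mx_derive x (S \o gam) (DS uz.1 (derive1 gam x)) by near: uz.
  have H5 : forall (gam : R -> V) x, gam x = uz.1 -> derivable gam x 1 ->
    mx_derive x (B \o gam) (DB uz.1 (derive1 gam x)) by near: uz.
  split; [have := H3 gam x gx dg|have := H4 gam x gx dg|have := H5 gam x gx dg];
    by rewrite g1 ?linA ?linS ?linB ce.
- by near: uz.
- move=> v /andP[v0 vdv]; split.
    rewrite fnormZ ger0_norm//; apply: (@le_trans _ _ (fnorm (Ah uz.1 uz.2))); last by near: uz.
    by rewrite ler_piMl ?fnorm_ge0// (le_trans vdv).
  split; first by rewrite v0 (le_trans vdv).
  + split; [by near: uz|by near: uz|by near: uz|].
    move=> X; have H10 : forall X : V, k * sqnorm X <= qform (Kf uz) X by near: uz.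
    by apply: (le_trans (H10 X)); rewrite qformD lerD2l qformZ qform_rank1 sqnormE !big_ord1 -expr2.
  + split; [by near: uz|by near: uz|].
    apply: (@le_trans _ _ (v * c4)); first by rewrite ler_wpM2l//; near: uz.
    by rewrite -ler_pdivlMr.
  + by split; rewrite /Ck ?lerDl ?lerDr ?fnorm_ge0.
- split; [by near: uz|by near: uz|by near: uz|].
  have H18 : `|M * ap uz.1| < 1 by near: uz.
  exact: ltW (lt_le_trans H18 a1).
Unshelve. all: by end_near. Qed.

End NearCoefficients.

(** * Small profiles *)

Section ProfileCloseness.
Variable R : realType.

(** On the left half-line f - K exp(k x) is nonincreasing, since the bound on the derivative is
    exactly the derivative of K exp(k x). Comparison with the limit at - oo gives f - lm <= K, and
    the same argument applies to - f. *)
Lemma decay_left_limit (f df : R -> R) (K k lm : R) : 0 <= K -> 0 <= k ->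
  (forall x : R, is_derive x 1 f (df x)) -> (forall x, `|df x| <= K * k * expR (- (k * `|x|))) ->
  f x @[x --> -oo] --> lm -> forall x, x <= 0 -> `|f x - lm| <= K.
Proof.
move=> K0 k0 Df bdf flm.
have one (g dg : R -> R) l : (forall x : R, is_derive x 1 g (dg x)) ->
    (forall x, `|dg x| <= K * k * expR (- (k * `|x|))) ->
    g x @[x --> -oo] --> l -> forall x, x <= 0 -> g x - l <= K.
  move=> Dg bdg gl x x0.
  have De (y : R) : is_derive y 1 (fun y => K * expR (k * y)) (K * (k * expR (k * y))).
    apply: is_derive1Ml.
    have D1 := is_derive1Ml k (is_derive_id y (1 : R)).
    have := is_derive1_comp (is_derive_expR (k * y)) D1.
    by rewrite mulr1 mulrC.
  pose P y := g y - K * expR (k * y).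
  have DP (y : R) : is_derive y 1 P (dg y - K * (k * expR (k * y))) := is_deriveB (Dg y) (De y).
  have mono y : y <= x -> P x <= P y.
    move=> yx; apply: (@ler0_derive1_le_cc _ P y x).
    - by move=> z _; have D1 := DP z; exact: ex_derive.
    - move=> z; rewrite in_itv/= => /andP[_ zx].
      rewrite derive1E (@derive_val _ _ _ _ _ _ _ (DP z)) subr_le0.
      apply: (le_trans (ler_norm _)); apply: (le_trans (bdg z)).
      by rewrite mulrA ler0_norm ?mulrN ?opprK// (le_trans (ltW zx)).
    - by apply: continuous_subspaceT; exact: is_derive_continuous DP.
    - by rewrite in_itv/= lexx yx.
    - by rewrite in_itv/= lexx yx.
    - exact: yx.
  rewrite leNgt; apply/negP => gK.
  have e0 : 0 < g x - l - K by rewrite subr_gt0.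
  have /cvgrPdist_lt/(_ _ e0) := gl => H.
  have H2 : \forall y \near -oo, y <= x by apply: nbhs_ninfty_le; exact: num_real.
  have [y [/= h1 h2]] := @filter_ex _ _ proper_ninfty_nbhs _ (filterI H H2).
  have := mono y h2; rewrite /P => h3.
  have ex : K * expR (k * x) <= K by rewrite ler_piMr// -expR0 ler_expR mulr_ge0_le0.
  have ey : 0 <= K * expR (k * y) by rewrite mulr_ge0 ?expR_ge0.
  by move: h1; rewrite ltr_norml => /andP[h4 _]; lra.
move=> x x0; rewrite ler_norml; apply/andP; split; last exact: one Df bdf flm x x0.
have DN (y : R) : is_derive y 1 (fun y => - f y) (- df y) by exact: is_deriveN.
have bN (y : R) : `|- df y| <= K * k * expR (- (k * `|y|)) by rewrite normrN.
have flmN : - f z @[z --> -oo] --> - lm by exact: cvgN.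
by have := one _ _ _ DN bN flmN x x0; lra.
Qed.

Lemma decay_right_limit (f df : R -> R) (K k lp : R) : 0 <= K -> 0 <= k ->
  (forall x : R, is_derive x 1 f (df x)) -> (forall x, `|df x| <= K * k * expR (- (k * `|x|))) ->
  f x @[x --> +oo] --> lp -> forall x, 0 <= x -> `|f x - lp| <= K.
Proof.
move=> K0 k0 Df bdf flp x x0.
have DN (y : R) : is_derive y 1 (fun y => f (- y)) (- df (- y)).
  have D1 : is_derive y 1 (fun y : R => - y) (-1) by exact: is_deriveN.
  by have := is_derive1_comp (Df (- y)) D1; rewrite mulrN1.
have bN (y : R) : `|- df (- y)| <= K * k * expR (- (k * `|y|)).
  by rewrite normrN -[`|y|]normrN; exact: bdf.
have flN : f (- y) @[y --> -oo] --> lp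
  by apply/cvgNy_compNP; have -> : (fun y => f (- - y)) = f by apply/funext => y; rewrite opprK.
by have := decay_left_limit K0 k0 DN bN flN (_ : - x <= 0); rewrite oppr_le0 opprK; exact.
Qed.

(** [K] is the integral over a half-line of the bound on U_x. For a decay rate k of order eps and a
    height K k of order eps^2, the profile stays within order eps of an end state. *)
Lemma profile_near_state m (U : R -> 'cV[R]_m) (um up : 'cV[R]_m) (K k : R) : 0 <= K -> 0 <= k ->
  (forall x, derivable U x 1) -> (forall x, `|derive1 U x| <= K * k * expR (- (k * `|x|))) ->
  U x @[x --> -oo] --> um -> U x @[x --> +oo] --> up ->
  forall x, `|U x - um| <= K \/ `|U x - up| <= K.
Proof.
move=> K0 k0 dU bU Um Up x.
have De i (y : R) : is_derive y 1 (fun z => U z i 0) (derive1 U y i 0).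
  have [d e] := derivable_coord i (dU y).
  by rewrite derive1E -e; apply: DeriveDef.
have bD i y : `|derive1 U y i 0| <= K * k * expR (- (k * `|y|)).
  exact: le_trans (mx_entry_le _ i 0) (bU y).
have [x0|x0] := leP x 0; [left|right]; apply: mx_norm_le => // i j; rewrite (ord1 j) addmxE oppmxE.
  apply: (decay_left_limit K0 k0 (De i) (bD i)) => //.
  exact: cvg_comp Um (@coord_continuous _ _ _ i 0 um).
apply: (decay_right_limit K0 k0 (De i) (bD i)); last exact: ltW.
exact: cvg_comp Up (@coord_continuous _ _ _ i 0 up).
Qed.

End ProfileCloseness.

(** * Regularity of the normalized symmetrizer *)

Section Symmetrizer.
Variables (R : realType) (n' : nat).
Local Notation n := n'.+1.
Local Notation V := 'cV[R]_n.

Lemma curve_C1mx_exp (us : V) (A : V -> 'M[R]_n) k : curve_C1mx (nbhs us) us A ->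
  curve_C1mx (nbhs us) us (fun u => A u ^+ k).
Proof.
move=> cA; elim: k => [|k IH].
  by move=> i j; under eq_fun do rewrite expr0; exact: curve_C1_cst.
by under eq_fun do rewrite exprS -mulmxE; exact: curve_C1mx_mul.
Qed.

Lemma curve_C1mx_obs (us : V) (A : V -> 'M[R]_n) (B : V -> 'rV[R]_n) :
  curve_C1mx (nbhs us) us A -> curve_C1mx (nbhs us) us B ->
  curve_C1mx (nbhs us) us (fun u => obsmx (A u) (B u)).
Proof.
move=> cA cB i j.
have E : (fun u => obsmx (A u) (B u) i j) = (fun u => (B u *m A u ^+ i) 0 j).
  by apply/funext => u; rewrite /obsmx mxE.
rewrite E; apply: curve_C1mx_mul => //; exact: curve_C1mx_exp.
Qed.

(* [A0 L = B^T] and the symmetry of [A0 A] force [((A^T)^k L)^T A0 = B A^k] for all [k]; solving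
   these equations by Cramer's rule shows that [A0] is as smooth in [u] as [A] and [B]. *)
Definition symmetrizer (A : 'M[R]_n) (B : 'rV[R]_n) (L : V) : 'M[R]_n :=
  (\det (obsmx A^T L^T))^-1 *: (\adj (obsmx A^T L^T) *m obsmx A B).

(** A normalized symmetrizer is determined by A, B and L, so existence at each state is enough to
    speak of its regularity. *)
Lemma symmetrizerE (A0 A : 'M[R]_n) (B : 'rV[R]_n) (L : V) : posdef_mx A0 ->
  symmetric_mx (A0 *m A) -> A0 *m L = B^T -> obsmx A B \in unitmx ->
  obsmx A^T L^T \in unitmx /\ symmetrizer A B L = A0.
Proof.
move=> pA0 sA0A A0L uO; have E := obsmx_symmetrizer pA0.1 sA0A A0L.
have uC : obsmx A^T L^T \in unitmx.
  by move: uO; rewrite -E unitmx_mul => /andP[].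
split=> //; rewrite /symmetrizer -E mulmxA mul_adj_mx mul_scalar_mx scalerA mulVf ?scale1r//.
by rewrite -unitfE -unitmxE.
Qed.

Lemma curve_C1mx_symmetrizer (us : V) (A : V -> 'M[R]_n) (B : V -> 'rV[R]_n) (L : V) :
  curve_C1mx (nbhs us) us A -> curve_C1mx (nbhs us) us B -> obsmx (A us)^T L^T \in unitmx ->
  curve_C1mx (nbhs us) us (fun u => symmetrizer (A u) (B u) L).
Proof.
move=> cA cB uC.
have cC : curve_C1mx (nbhs us) us (fun u => obsmx (A u)^T L^T).
  apply: (@curve_C1mx_obs us (fun u => (A u)^T) (fun=> L^T)); first exact: curve_C1mx_tr.
  by move=> i j; exact: curve_C1_cst.
move=> i j; rewrite /symmetrizer; under eq_fun do rewrite scalemxE.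
apply: curve_C1M.
  by apply: curve_C1V; [rewrite -unitfE -unitmxE|exact: curve_C1_det].
by apply: curve_C1mx_mul; [exact: curve_C1mx_adj|exact: curve_C1mx_obs].
Qed.

End Symmetrizer.

Lemma near_pair_ball (R : realType) m (us z0 : 'cV[R]_m) (P : 'cV[R]_m * 'cV[R]_m -> Prop) :
  (\forall uz \near (us, z0), P uz) ->
  exists2 d : R, 0 < d & forall u z, `|us - u| < d -> `|z0 - z| < d -> P (u, z).
Proof.
move=> [[X Y] [/= nX nY] XY].
have [d1 /= d10 H1] := (nbhs_ballP us X).1 nX; have [d2 /= d20 H2] := (nbhs_ballP z0 Y).1 nY.
exists (Num.min d1 d2); first by rewrite lt_min d10 d20.
move=> u z; rewrite !lt_min => /andP[u1 _] /andP[_ z2].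
by apply: XY; split; [apply: H1|apply: H2]; rewrite -ball_normE.
Qed.

Lemma near_same_sign (R : realType) (T : Type) (F : set_system T) (FF : Filter F) (f : T -> R) (a : R) :
  f t @[t --> F] --> a -> a != 0 -> \forall t \near F, 0 < f t * a.
Proof.
move=> fa a0; have c2 : f t * a @[t --> F] --> a * a by apply: cvgM => //; exact: cvg_cst.
by apply: (cvgr_gt _ c2); rewrite -expr2 exprn_even_gt0.
Qed.

Lemma count_mem1_nth (T : eqType) (x0 x : T) (s : seq T) i j : count_mem x s = 1%N ->
  (i < size s)%N -> (j < size s)%N -> nth x0 s i = x -> nth x0 s j = x -> i = j.
Proof.
elim: s i j => //= y s IH [|i] [|j] //=.
- move=> cnt _ js yx sj; move: cnt; rewrite yx eqxx add1n => -[] /eqP.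
  by rewrite -leqn0 leqNgt -has_count has_pred1 -sj mem_nth.
- move=> cnt js _ sj yx; move: cnt; rewrite yx eqxx add1n => -[] /eqP.
  by rewrite -leqn0 leqNgt -has_count has_pred1 -sj mem_nth.
- move=> cnt is_ js si sj; congr _.+1; apply: IH => //.
  move: cnt; case: eqP => [_|_]; rewrite ?add0n// add1n => -[] /eqP.
  by rewrite -leqn0 leqNgt -has_count has_pred1 -sj mem_nth.
Qed.

Lemma small_scale_exists (R : realFieldType) (a b c d v : R) :
  0 <= a -> 0 <= b -> 0 <= c -> 0 < d -> 0 < v ->
  exists e : R, [/\ 0 < e, e <= 1, e * a <= d, e * b <= d & e * c <= v].
Proof.
move=> a0 b0 c0 d0 v0; pose y := 1 + a / d + b / d + c / v.
have t1 : 0 <= a / d by rewrite divr_ge0// ltW.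
have t2 : 0 <= b / d by rewrite divr_ge0// ltW.
have t3 : 0 <= c / v by rewrite divr_ge0// ltW.
have y1 : 1 <= y by rewrite /y; lra.
have y0 : 0 < y by exact: lt_le_trans y1.
exists y^-1; split; rewrite ?invr_gt0 ?invf_le1//.
- by rewrite mulrC ler_pdivrMr// -ler_pdivrMl// mulrC /y; lra.
- by rewrite mulrC ler_pdivrMr// -ler_pdivrMl// mulrC /y; lra.
- by rewrite mulrC ler_pdivrMr// -ler_pdivrMl// mulrC /y; lra.
Qed.

Theorem theorem1p2 (R : realType) (n p : nat) (Uset : set 'cV[R]_n)
    (f : 'cV[R]_n -> 'cV[R]_n) (g : 'cV[R]_n -> R) (L : 'cV[R]_n)
    (ap : 'cV[R]_n -> R) (rp : 'cV[R]_n -> 'cV[R]_n) (lp : 'cV[R]_n -> 'rV[R]_n)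
    (Uopen : open Uset) (hp : (0 < p <= n)%N)
    (* (S0) *)
    (S0 : C2on Uset f /\ C2on Uset g)
    (* (S1): symmetrizer *)
    (S1 : forall u, Uset u -> exists A0 : 'M[R]_n,
        [/\ posdef_mx A0, symmetric_mx (A0 *m jac f u),
            possemidef_mx (A0 *m (L *m grad_row g u)) &
            \rank (A0 *m (L *m grad_row g u)) = 1%N])
    (* (S1): a_p(u) is the p-th eigenvalue a_1 <= ... <= a_n of A(u), simple *)
    (Hap : forall u, Uset u -> exists s, [/\ spec_list (jac f u) s,
        s`_p.-1 = ap u & count_mem (ap u) s = 1%N])
    (* r_p, l_p : right / left eigenvectors for a_p, normalized by l_p r_p = 1 *)
    (Hrl : forall u, Uset u -> [/\ jac f u *m rp u = ap u *: rp u,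
        lp u *m jac f u = ap u *: lp u & lp u *m rp u = 1%:M])
    (* (S2) *)
    (S2 : forall u, Uset u -> forall (m : R) (v : 'cV[R]_n), v != 0 ->
        jac f u *m v = m *: v -> (L *m grad_row g u) *m v != 0)
    (* (H2) *)
    (H2 : forall u, Uset u -> derivable ap u (rp u) /\ 'D_(rp u) ap u != 0) :
  forall ustar : 'cV[R]_n, Uset ustar ->
  forall C eta theta : R, 0 < C -> 0 < eta -> 0 < theta ->
  exists eps0 : R, 0 < eps0 /\
  forall (U : R -> 'cV[R]_n) (Q : R -> R) (um up : 'cV[R]_n),
    stat_profile Uset f g L U Q um up ->
    (* (H0) *)
    f up = f um ->
    (* (H1) *)
    (exists s, [/\ spec_list (jac f up) s, s`_p.-1 < 0 &
                   ((p < n)%N -> 0 < s`_p)]) ->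
    (exists s, [/\ spec_list (jac f um) s, ((1 < p)%N -> s`_p.-2 < 0) &
                   0 < s`_p.-1]) ->
    (* (H3) *)
    0 < (lp up *m L *m grad_row g up *m rp up) 0 0 ->
    0 < (lp um *m L *m grad_row g um *m rp um) 0 0 ->
    (* small amplitude eps = |u+ - u-| *)
    `|up - um| < eps0 ->
    (* structure of the profile in the small-amplitude regime *)
    let eps := `|up - um| in
    `|up - ustar| <= eps -> `|um - ustar| <= eps ->
    (forall x, derivable (derive1 U) x 1) ->
    (exists (c : R -> R) (w : R -> 'cV[R]_n), forall x,
        [/\ derive1 U x = c x *: (rp ustar + w x),
            `|c x| <= C * eps ^+ 2 * expR (- (eta * eps * `|x|)) &
            `|w x| <= C * eps]) ->
    (forall x, `|derive1 (derive1 U) x| <= C * eps ^+ 3 * expR (- (theta * eps * `|x|))) ->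
    (forall x y, x < y -> ap (U y) < ap (U x)) ->
    (forall x, derivable (ap \o U) x 1 /\
               `|derive1 (ap \o U) x| <= C * `|derive1 U x|) ->
    (* spectral stability *)
    forall (a b : R) (ur ui : R -> 'cV[R]_n) (qr qi : R -> R),
      0 <= a -> (a != 0 \/ b != 0) ->
      eig_weak_sol (fun x => jac f (U x)) (fun x => grad_row g (U x)) L
        a b ur ui qr qi ->
      {ae (@lebesgue_measure R), forall x,
         [/\ ur x = 0, ui x = 0, qr x = 0 & qi x = 0]}.
Proof.
case: n Uset f g L ap rp lp Uopen hp S0 S1 Hap Hrl S2 H2 => [|n'] Uset f g L ap rp lp Uopen hp S0 S1 Hap Hrl S2 H2.
  by case: p hp {Hap} => [|p].
move=> us Wus C eta theta C0 eta0 theta0.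
have /andP[p0 pn] := hp; have pn' : (p.-1 < n'.+1)%N by rewrite prednK.
have C1A : curve_C1mx (nbhs us) us (jac f).
  move=> i j; have -> : (fun u => jac f u i j) = (fun u => ('D_(ebasis R j) f u) i 0).
    by apply/funext => u; rewrite mxE.
  exact: C2on_partial_coord_curve_C1 Uopen Wus S0.1.
have C1B : curve_C1mx (nbhs us) us (grad_row g).
  move=> i j; have -> : (fun u => grad_row g u i j) = 'D_(ebasis R j) g.
    by apply/funext => u; rewrite mxE.
  exact: C2on_partial_curve_C1 Uopen Wus S0.2.
have nW : \forall u \near us, Uset u by exact: open_nbhs_nbhs.
have cA : mx_cvg (nbhs us) (jac f) (jac f us).
  by have [DA [cA _ _ _]] := curve_C1mx_derivation C1A.
have BS2 u : Uset u -> forall (m : R) (v : 'cV[R]_n'.+1), v != 0 -> jac f u *m v = m *: v -> grad_row g u *m v != 0.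
  move=> Wu m v v0 Av; apply: contraNneq (S2 u Wu m v v0 Av) => Bv.
  by rewrite -mulmxA Bv mulmx0.
have obsU u : Uset u -> obsmx (jac f u) (grad_row g u) \in unitmx.
  by move=> Wu; have [s [Hs _ _]] := Hap u Wu; exact: obsmx_unit Hs (BS2 u Wu).
(* The matrices given state by state in (S1) are replaced by this formula, which inherits the
   regularity of A and B. *)
pose S u := symmetrizer (jac f u) (grad_row g u) L.
have Sprop u : Uset u -> [/\ posdef_mx (S u), symmetric_mx (S u *m jac f u),
    S u *m L = (grad_row g u)^T & obsmx (jac f u)^T L^T \in unitmx].
  move=> Wu; have [A0 [pA0 sA0A psd rk]] := S1 u Wu.
  have [A1 [pA1 sA1A A1L]] := symmetrizer_normalize pA0 sA0A psd rk.
  by have [uC SE] := symmetrizerE pA1 sA1A A1L (obsU u Wu); rewrite /S SE.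
have C1S : curve_C1mx (nbhs us) us S.
  by apply: curve_C1mx_symmetrizer => //; have [] := Sprop us Wus.
have /choice[s Hs] : forall u, exists s : seq R, Uset u ->
    [/\ spec_list (jac f u) s, s`_p.-1 = ap u & count_mem (ap u) s = 1%N].
  move=> u; have [Wu|nWu] := pselect (Uset u); last by exists [::].
  by have [s Hs] := Hap u Wu; exists s.
have [Hs0 sp0 cnt0] := Hs us Wus.
have cs i : (i < n'.+1)%N -> (s u)`_i @[u --> us] --> (s us)`_i.
  move=> ni; apply: (spec_list_cvg _ cA _ Hs0) => //.
  by apply: filterS nW => u Wu; have [] := Hs u Wu.
(* Continuity of [ap] comes from its place in the sorted spectrum. *)
have cap : ap u @[u --> us] --> ap us.
  rewrite -sp0; apply: near_cvg_ext (cs _ pn').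
  by apply: filterS nW => u Wu; have [] := Hs u Wu.
have apE u t : Uset u -> spec_list (jac f u) t -> t`_p.-1 = ap u.
  by move=> Wu Ht; have [Hu <- _] := Hs u Wu; rewrite (spec_list_uniq Ht Hu).
have [ap0|ap_neq0] := eqVneq (ap us) 0; last first.
  have : \forall u \near us, Uset u /\ 0 < ap u * ap us.
    by apply: filterS2 nW (near_same_sign _ cap ap_neq0).
  move=> /nbhs_ballP[e /= e0 He]; exists e; split=> // U Q um up _ _ [sp [Hsp sp_lt _]] [sm [Hsm _ sm_gt]] _ _.
  move=> epse upe ume.
  have [Wp Pp] : Uset up /\ 0 < ap up * ap us.
    by apply: He; rewrite -ball_normE /= distrC (le_lt_trans upe).
  have [Wm Pm] : Uset um /\ 0 < ap um * ap us.
    by apply: He; rewrite -ball_normE /= distrC (le_lt_trans ume).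
  move: sp_lt sm_gt; rewrite (apE up sp Wp Hsp) (apE um sm Wm Hsm) => sp_lt sm_gt.
  by move: Pp Pm; rewrite nmulr_rgt0// pmulr_rgt0// => h1 h2; have := lt_trans h1 h2; rewrite ltxx.
have [Ar lA lr] := Hrl us Wus.
have uN : deflation (jac f) ap (rp us) (lp us) us \in unitmx.
  exact: deflated_unit Ar lA lr (BS2 us Wus).
have eigs : \forall u \near us, exists (rr : 'cV[R]_n'.+1) (ll : 'rV[R]_n'.+1),
    [/\ jac f u *m rr = ap u *: rr, ll *m jac f u = ap u *: ll & ll *m rr = 1%:M].
  by apply: filterS nW => u Wu; exists (rp u), (lp u); exact: Hrl.
have near_S : \forall u \near us, [/\ (S u)^T = S u, (S u *m jac f u)^T = S u *m jac f u &
    S u *m L = (grad_row g u)^T].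
  by apply: filterS nW => u Wu; have [[h1 _] h2 h3 _] := Sprop u Wu.
have [pS _ _ _] := Sprop us Wus.
have [dap dap0] := H2 us Wus.
have Dap : is_derive (0 : R) 1 (fun t : R => ap (us + t *: rp us)) ('D_(rp us) ap us).
  by have := @is_derive_line _ _ ap us (rp us) 0; rewrite scale0r addr0; apply.
have [Ah [Sh [Bh [M [K [dv [dl [h [e [Cz [Ck [N [k [m [ca [diss skK dv0 near_uz]]]]]]]]]]]]]]]] :=
  near_coefficients C1A C1S C1B cap ap0 eigs Ar lA lr uN pS near_S (obsU us Wus) Dap dap0.
(* Simplicity of the zero eigenvalue at [us] keeps all other eigenvalues away from 0 nearby, so A(U)
   can only be singular where ap(U) = 0. *)
have near_s : \forall u \near us, forall i : 'I_n'.+1, i != p.-1 :> nat -> (s u)`_i != 0.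
  apply: near_forall => i; have [ip|ip] := eqVneq (i : nat) p.-1.
    by near=> u.
  have si0 : (s us)`_i != 0.
    apply/eqP => si0.
    have sz := spec_list_size Hs0; move/eqP: ip; apply.
    by apply: (count_mem1_nth (x0 := 0) cnt0); rewrite ?sz// si0.
  apply: filterS (cvg_near_neq0 (cs i (ltn_ord i)) si0); by [].
have near_W := near_fst (rp us) nW.
have near_s2 := near_fst (rp us) near_s.
have [d d0 Hd] := near_pair_ball (filterI near_uz (filterI near_W near_s2)).
pose r := rp us; pose Cr := C * (`|r| + C).
have Cr0 : 0 <= Cr by rewrite mulr_ge0 ?addr_ge0// ltW.
(* The last three demands keep U within d of [us], the direction within d of [rp us], and v below
   dv; eps0 <= 1 lets eps^2 be replaced by eps. *)
have [eps0 [eps00 eps1 epsU epsw epsv]] : exists eps0 : R, [/\ 0 < eps0, eps0 <= 1, eps0 * (Cr / eta + 1) <= d,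
    eps0 * C <= d & eps0 * (C * Cr) <= dv].
  by apply: small_scale_exists; rewrite ?mulr_ge0 ?addr_ge0 ?divr_ge0// ltW.
exists eps0; split=> // U Q um up [UW Uder _ _ [Up Um _ _]] _ _ _ _ _ epslt eps upe ume _ [c [w Hcw]] _ apU dapU.
move=> a b ur ui qr qi a0 ab Heig.
have eps_ge0 : 0 <= eps by exact: normr_ge0.
have eps_le1 : eps <= 1 by exact: le_trans (ltW epslt) eps1.
have dU x : derivable U x 1 by have [] := Uder x.
have bz x : `|r + w x| <= `|r| + C.
  apply: (le_trans (ler_normD _ _)); rewrite lerD2l; have [_ _ bw] := Hcw x.
  by apply: (le_trans bw); rewrite ler_piMr// ltW.
(* The factor eps^2 is split so that the decay rate eta eps appears; what remains is the distance,
   of order eps, from the end states. *)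
have bU1 x : `|derive1 U x| <= (Cr / eta * eps) * (eta * eps) * expR (- (eta * eps * `|x|)).
  have [-> bc _] := Hcw x; rewrite normrZ; apply: (le_trans (ler_pM _ _ bc (bz x))) => //.
  have -> : Cr / eta * eps * (eta * eps) = C * eps ^+ 2 * (`|r| + C).
    by rewrite /Cr; field; rewrite gt_eqF.
  by rewrite mulrAC.
have Uus x : `|U x - us| < d.
  have Ke : 0 <= Cr / eta * eps by rewrite mulr_ge0// divr_ge0// ltW.
  have ke : 0 <= eta * eps by rewrite mulr_ge0// ltW.
  have tri z : `|U x - z| <= Cr / eta * eps -> `|z - us| <= eps -> `|U x - us| < d.
    move=> h1 h2; rewrite -(subrKA z); apply: (le_lt_trans (ler_normD _ _)).
    apply: (le_lt_trans (lerD h1 h2)); apply: (lt_le_trans _ epsU).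
    have -> : Cr / eta * eps + eps = eps * (Cr / eta + 1) by ring.
    by rewrite ltr_pM2r// ltr_wpDl// divr_ge0// ltW.
  by have [h1|h1] := profile_near_state Ke ke dU bU1 Um Up x; [exact: tri h1 ume|exact: tri h1 upe].
have wd x : `|w x| < d.
  have [_ _ bw] := Hcw x; apply: (le_lt_trans bw); apply: (lt_le_trans _ epsw).
  by rewrite mulrC ltr_pM2r.
have Uus' x : `|us - U x| < d by rewrite distrC.
have wd' x : `|r - (r + w x)| < d by rewrite opprD addrA subrr add0r normrN.
pose v (x : R) : R := - derive1 (ap \o U) x.
have Dal (x : R) : is_derive x 1 (ap \o U) (- v x).
  by rewrite opprK derive1E; apply: DeriveDef => //; have [] := dapU x.
have v_ge0 x : 0 <= v x.
  rewrite oppr_ge0; apply: (@decr_derive1_le0 _ (ap \o U) setT).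
  - by move=> z _; have [] := dapU z.
  - by move=> z t _ _; exact: apU.
  - by rewrite interiorT.
have v_le x : v x <= dv.
  apply: (le_trans (ler_norm _)); rewrite normrN; have [_ bv] := dapU x; apply: (le_trans bv).
  have [-> bc _] := Hcw x.
  have bc' : `|c x| <= C * eps.
    apply: (le_trans bc); have E1 : expR (- (eta * eps * `|x|)) <= 1.
      by rewrite -expR0 ler_expR oppr_le0 !mulr_ge0// ltW.
    have E0 := expR_ge0 (- (eta * eps * `|x|)); move: (expR _) E0 E1 => E E0 E1.
    have -> : C * eps ^+ 2 * E = C * eps * (eps * E) by ring.
    by rewrite ler_piMr ?mulr_ge0 ?mulr_ile1// ltW.
  have : C * `|c x *: (r + w x)| <= C * (C * eps * (`|r| + C)).
    by rewrite ler_pM2l// normrZ ler_pM.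
  move=> /le_trans; apply; apply: (le_trans _ epsv).
  have -> : C * (C * eps * (`|r| + C)) = eps * (C * Cr) by rewrite /Cr; ring.
  by apply: ler_wpM2r; [rewrite mulr_ge0// ltW|exact: ltW].
have H1 x := (Hd _ _ (Uus' x) (wd' x)).1.
have H3 x : Uset (U x) /\ forall i : 'I_n'.+1, i != p.-1 :> nat -> (s (U x))`_i != 0 :=
  (Hd _ _ (Uus' x) (wd' x)).2.
have dall x : [/\ mx_derive x (jac f \o U) (v x *: Ah (U x) (r + w x)),
    mx_derive x (S \o U) (v x *: Sh (U x) (r + w x)) &
    mx_derive x (grad_row g \o U) (v x *: Bh (U x) (r + w x))].
  have [hd _ _ _] := H1 x; rewrite -[v x](opprK); apply: (hd U x (c x)) => //; by have [] := Hcw x.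
(* Strict monotonicity of the speed allows at most one sonic point; 0 is a dummy when there is
   none. *)
have [x0 Hx0] : exists x0, forall x, x != x0 -> ap (U x) != 0.
  have [[x0 Ux0]|nx] := pselect (exists x0, ap (U x0) = 0).
    exists x0 => x; rewrite neq_lt => /orP[xx|xx]; have := apU _ _ xx; rewrite Ux0 => h1.
      by rewrite gt_eqF.
    by rewrite lt_eqF.
  by exists 0 => x _; apply/eqP => Ux; apply: nx; exists x.
have L0 : L != 0.
  apply/eqP => LE; have [A0 [_ _ _]] := S1 us Wus.
  by rewrite LE mul0mx mulmx0 mxrank0.
apply: (@eigenfunction_vanishes R n' (jac f \o U) (fun x => Ah (U x) (r + w x)) (S \o U)
  (fun x => Sh (U x) (r + w x)) (grad_row g \o U) (fun x => Bh (U x) (r + w x)) (ap \o U) v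
  L M K x0 dl h e Cz Ck N k m ca _ _ _ Dal _ _ _ skK L0 _ diss _ _ _ _ _ _ a b ur ui qr qi a0 ab Heig).
- by move=> x; have [] := dall x.
- by move=> x; have [] := dall x.
- by move=> x; have [] := dall x.
- by move=> x; have [_ [h1 h2 h3] _ _] := H1 x; exact: h1.
- by move=> x; have [_ [h1 h2 h3] _ _] := H1 x; exact: h2.
- by move=> x; have [_ [h1 h2 h3] _ _] := H1 x; exact: h3.
- move=> x xx0; rewrite -unitfE -unitmxE; have [Ws HsU] := H3 x.
  have [HsUx sUp _] := Hs _ Ws.
  apply: (spec_list_det HsUx) => i ni; have [ip|ip] := eqVneq i p.-1.
    by rewrite ip sUp; exact: Hx0.
  exact: (HsU (Ordinal ni)).
- by move=> x; have [_ _ hc _] := H1 x; have [|_ hb] := hc (v x); [by rewrite v_ge0 v_le|exact: hb].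
- by move=> x; have [_ _ _ [h1 h2 h3 h4]] := H1 x; exact: h1.
- by move=> x; have [_ _ hc _] := H1 x; have [|hb _] := hc (v x); [by rewrite v_ge0 v_le|exact: hb].
- by move=> x; have [_ _ _ [h1 h2 h3 h4]] := H1 x; exact: h2.
- by move=> x; have [_ _ _ [h1 h2 h3 h4]] := H1 x; exact: h3.
- by move=> x; have [_ _ _ [h1 h2 h3 h4]] := H1 x; exact: h4.
Unshelve. all: by end_near. Qed.
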